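(* The problem RelBuechi-MD (defined in the context) is strongly NP-complete. Strong NP-hardness already holds for the following special cases: given an MDP $\mathcal{M}$, states $s_1,s_2\in S$ and target sets $T_1,T_2\subseteq S$, decide whether (a) there exists a memoryless deterministic scheduler $\sigma$ with $\Pr^{\sigma}_{s_1}(\mathbf{G}\mathbf{F}\,T_1)-\Pr^{\sigma}_{s_2}(\mathbf{G}\mathbf{F}\,T_2)=0$; (b) there exist memoryless deterministic schedulers $\sigma_1,\sigma_2$ with $\Pr^{\sigma_1}_{s_1}(\mathbf{G}\mathbf{F}\,T_1)-\Pr^{\sigma_2}_{s_2}(\mathbf{G}\mathbf{F}\,T_2)=0$. Strong NP-hardness of (a) and (b) holds irrespective of whether $s_1=s_2$ and whether $T_1$ and/or $T_2$ are absorbing. Moreover, the variants of (a) and (b) in which $=0$ is replaced by $\approx_\epsilon 0$ for a given $\epsilon>0$ are NP-hard.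
   Context: A Markov decision process (MDP) is a triple $\mathcal{M}=(S,\mathit{Act},\mathbf{P})$ with $S$ a non-empty finite set of states, $\mathit{Act}$ a non-empty finite set of actions and $\mathbf{P}:S\times\mathit{Act}\times S\to[0,1]$ such that for every $s$ the set $\mathit{Act}(s)=\{\alpha\mid \sum_{s'}\mathbf{P}(s,\alpha,s')=1\}$ is non-empty and $\sum_{s'}\mathbf{P}(s,\alpha,s')=0$ for $\alpha\notin\mathit{Act}(s)$. A state $s$ is absorbing if $\mathbf{P}(s,\alpha,s)=1$ for all $\alpha\in\mathit{Act}(s)$; a set is absorbing if all its states are. A scheduler maps finite paths to distributions over enabled actions of the last state; it is memoryless deterministic (MD) if its choice depends only on the last state of the path and is a point distribution. $\Pr^\sigma_s(\mathbf{G}\mathbf{F}\,T)$ is the probability under $\sigma$ from $s$ of visiting $T$ infinitely often. $r\approx_\epsilon r'$ iff $|r-r'|\le\epsilon$, $r\not\approx_\epsilon r'$ iff $|r-r'|>\epsilon$. RelBuechi-MD: given an MDP, naturals $m,n$, rationals $q_1,\dots,q_m,q$, states $s_1,\dots,s_m$, indices $k_1,\dots,k_m$ with $\{k_1,\dots,k_m\}=\{1,\dots,n\}$, sets $T_1,\dots,T_m\subseteq S$ and $\bowtie\in\{>,\ge,\approx_\epsilon,\not\approx_\epsilon\mid\epsilon\in\mathbb{Q}_{\ge0}\}$, decide whether there exist MD schedulers $\sigma_1,\dots,\sigma_n$ with $\sum_{i=1}^m q_i\Pr^{\sigma_{k_i}}_{s_i}(\mathbf{G}\mathbf{F}\,T_i)\bowtie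 q$. Strongly NP-hard means NP-hard even when all numbers in the input are encoded in unary. *)

(* Defs.v *)
From HB Require Import structures.
From mathcomp Require Import all_boot all_order all_algebra.
From mathcomp Require Import all_classical all_reals all_analysis.

Set Implicit Arguments.
Unset Strict Implicit.
Unset Printing Implicit Defensive.

Import Order.TTheory GRing.Theory Num.Theory.
Local Open Scope classical_set_scope.
Local Open Scope ring_scope.

(** * Polynomial time, NP and NP-hardness *)

Variant move := MoveLeft | Stay | MoveRight.

(* Deterministic multi-tape Turing machines with input alphabet [A] and output
   alphabet [B]. A tape symbol is an input symbol, an output symbol, a work
   symbol, or the blank [None]. There are [tm_extra.+1] tapes; the machine halts
   when [tm_delta] returns [None]. *)
Record tm (A B : finType) := TM {
  tm_work : finType;
  tm_state : finType;
  tm_extra : nat;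
  tm_start : tm_state;
  tm_delta : tm_state -> {ffun 'I_tm_extra.+1 -> option (A + B + tm_work)} ->
    option (tm_state *
            {ffun 'I_tm_extra.+1 -> option (A + B + tm_work) * move}) }.

Section TuringMachines.
Variables (A B : finType) (M : tm A B).

Definition tm_symbol := option (A + B + tm_work M).

(* A two-way infinite tape: the cells strictly left of the head, nearest first,
   and the cells from the head rightwards; cells beyond either list are blank. *)
Definition tm_tape : Type := seq tm_symbol * seq tm_symbol.

Definition tm_config : Type :=
  tm_state M * {ffun 'I_(tm_extra M).+1 -> tm_tape}.

Definition tape_read (t : tm_tape) : tm_symbol := head None t.2.

Definition tape_act (t : tm_tape) (sm : tm_symbol * move) : tm_tape :=
  let r := sm.1 :: behead t.2 in
  match sm.2 with
  | MoveLeft => (behead t.1, head None t.1 :: r)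
  | Stay => (t.1, r)
  | MoveRight => (sm.1 :: t.1, behead t.2)
  end.

Definition tm_next (c : tm_config) : option tm_config :=
  if tm_delta c.1 [ffun i => tape_read (c.2 i)] is Some (q, act)
  then Some (q, [ffun i => tape_act (c.2 i) (act i)]) else None.

Definition tm_run (n : nat) (c : tm_config) : tm_config :=
  iter n (fun c => odflt c (tm_next c)) c.

Definition tm_halted (c : tm_config) : Prop := tm_next c = None.

(* The input is written on the first tape, with the head on its first symbol. *)
Definition tm_init (x : seq A) : tm_config :=
  (tm_start M,
   [ffun i => if i == ord0 then ([::], [seq Some (inl (inl a)) | a <- x])
              else ([::], [::])]).

Fixpoint output_prefix (s : seq tm_symbol) : seq B :=
  if s is Some (inl (inr b)) :: s' then b :: output_prefix s' else [::].

(* The output is the longest block of output symbols that starts at the head of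
   the last tape. *)
Definition tm_output (c : tm_config) : seq B := output_prefix (c.2 ord_max).2.

End TuringMachines.

Definition polytime (A B : finType) (f : seq A -> seq B) : Prop :=
  exists (M : tm A B) (p : {poly nat}), forall x : seq A,
    exists n : nat, [/\ (n <= p.[size x])%N,
      tm_halted (tm_run n (tm_init M x)) &
      tm_output (tm_run n (tm_init M x)) = f x].

Definition polytime_decidable (A : finType) (d : seq A -> bool) : Prop :=
  polytime (fun x => [:: d x]).

Definition language (A : finType) := seq A -> Prop.

(* A word [x] and a certificate [c] are given to the verifier as the word [xc]
   over the disjoint union of the two alphabets. *)
Definition NP (A : finType) (L : language A) : Prop :=
  exists (V : seq (A + bool)%type -> bool) (p : {poly nat}),
    polytime_decidable V /\
    forall x : seq A, L x <-> exists c : seq bool,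
      (size c <= p.[size x])%N /\ V (map inl x ++ map inr c).

Definition poly_reducible (A B : finType) (K : language A) (L : language B) :=
  exists f : seq A -> seq B, polytime f /\ forall x, K x <-> L (f x).

Definition NP_hard (A : finType) (L : language A) : Prop :=
  forall (B : finType) (K : language B), NP K -> poly_reducible K L.

(** * Decision problems with numerical data *)

(* An instance is described by a list of natural numbers, which is then written
   down as a word over digits, with [None] ending each number. *)
Record problem := Problem {
  instance : Type;
  numbers : instance -> seq nat;
  is_yes : instance -> Prop }.

(* Binary digits, least significant first, without leading zeros. *)
Definition binary (n : nat) : seq bool :=
  [seq odd (n %/ 2 ^ i) | i <- iota 0 (up_log 2 n.+1)].

Definition unary (n : nat) : seq bool := nseq n true.

Definition write (digits : nat -> seq bool) (ns : seq nat) : seq (option bool) :=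
  flatten [seq rcons (map Some (digits n)) None | n <- ns].

Definition language_of (digits : nat -> seq bool) (P : problem) :
    language (option bool) :=
  fun w => exists I : instance P, is_yes I /\ w = write digits (numbers I).

Definition problem_in_NP (P : problem) : Prop := NP (language_of binary P).

Definition problem_NP_hard (P : problem) : Prop :=
  NP_hard (language_of binary P).

Definition strongly_NP_hard (P : problem) : Prop :=
  NP_hard (language_of unary P).

Definition strongly_NP_complete (P : problem) : Prop :=
  problem_in_NP P /\ strongly_NP_hard P.

Definition subproblem (P : problem) (C : instance P -> Prop) : problem :=
  @Problem {I : instance P | C I} (fun I => numbers (sval I))
    (fun I => is_yes (sval I)).

(** * Markov decision processes *)

Record mdp := MDP {
  mdp_ns : nat;
  mdp_na : nat;
  trans : 'I_mdp_ns.+1 -> 'I_mdp_na.+1 -> 'I_mdp_ns.+1 -> rat;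
  trans_bounds : forall s a t, 0 <= trans s a t <= 1;
  trans_enabled : forall s, exists a, \sum_t trans s a t = 1;
  trans_disabled : forall s a, \sum_t trans s a t <> 1 ->
    \sum_t trans s a t = 0 }.

Notation state M := 'I_(mdp_ns M).+1.
Notation action M := 'I_(mdp_na M).+1.

Definition enabled (M : mdp) (s : state M) (a : action M) : bool :=
  \sum_t trans s a t == 1.

Definition absorbing_state (M : mdp) (s : state M) : bool :=
  [forall a, enabled s a ==> (trans s a s == 1)].

Definition absorbing (M : mdp) (T : {set state M}) : bool :=
  [forall s in T, absorbing_state s].

(* [decision h s] is the distribution chosen after the finite path [rcons h s]. *)
Record scheduler (R : realType) (M : mdp) := Scheduler {
  decision : seq (state M) -> state M -> action M -> R;
  decision_ge0 : forall h s a, 0 <= decision h s a;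
  decision_sum1 : forall h s, \sum_a decision h s a = 1;
  decision_enabled : forall h s a, ~~ enabled s a -> decision h s a = 0 }.

Definition memoryless_deterministic (R : realType) (M : mdp)
    (sigma : scheduler R M) : Prop :=
  exists d : state M -> action M,
    forall h s a, decision sigma h s a = (a == d s)%:R.

HB.instance Definition _ (n : nat) := isPointed.Build (ordinal n.+1) ord0.

Definition cylinder (M : mdp) (w : seq (state M)) : set (nat -> state M) :=
  [set p | forall i, (i < size w)%N -> p i = nth ord0 w i].

Definition paths (M : mdp) :=
  g_sigma_algebraType [set cylinder w | w in [set: seq (state M)]].

Section PathMeasure.
Variables (R : realType) (M : mdp) (sigma : scheduler R M).
Implicit Types (h w : seq (state M)) (s t : state M).

Definition step_prob h s t : R :=
  \sum_a decision sigma h s a * ratr (trans s a t).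

(* The probability that the finite path [rcons h s] is continued by [w]. *)
Fixpoint path_prob h s w : R :=
  if w is t :: w' then step_prob h s t * path_prob (rcons h s) t w' else 1.

(* The measure exists: subdivide [0, 1[ into intervals of length [path_prob],
   and push the Lebesgue measure of [0, 1[ forward along the map sending [u] to
   the path whose intervals contain [u]. *)

Let step_prob_ge0 h s t : 0 <= step_prob h s t.
Proof.
apply: sumr_ge0 => a _; apply: mulr_ge0; first exact: decision_ge0.
by rewrite ler0q; case/andP: (trans_bounds s a t).
Qed.

Let sum_step_prob h s : \sum_t step_prob h s t = 1.
Proof.
rewrite /step_prob exchange_big /= -(decision_sum1 sigma h s).
apply: eq_bigr => a _; rewrite -mulr_sumr.
have [en|/decision_enabled->] := boolP (enabled s a); last by rewrite mul0r.
by rewrite -rmorph_sum /= (eqP en) rmorph1 mulr1.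
Qed.

Let path_prob_rcons h s w t :
  path_prob h s (rcons w t) =
  path_prob h s w * step_prob (h ++ belast s w) (last s w) t.
Proof.
elim: w h s => [|x w IH] h s /=; first by rewrite cats0 mul1r mulr1.
by rewrite IH mulrA cat_rcons.
Qed.

Let path_prob_ge0 h s w : 0 <= path_prob h s w.
Proof. by elim: w h s => //= t w IH h s; rewrite mulr_ge0. Qed.

Let cumul h s (k : nat) : R := \sum_(t : state M | (t < k)%N) step_prob h s t.

Let cumulS h s t : cumul h s t.+1 = cumul h s t + step_prob h s t.
Proof.
rewrite /cumul (bigD1 t) //= addrC; congr (_ + _).
by apply: eq_bigl => i; rewrite ltnS (ltn_neqAle i t) andbC.
Qed.

Let cumul0 h s : cumul h s 0 = 0.
Proof. by rewrite /cumul big1. Qed.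

Let cumulT h s : cumul h s (mdp_ns M).+1 = 1.
Proof.
by rewrite -(sum_step_prob h s); apply: eq_bigl => t; rewrite ltn_ord.
Qed.

Let le_cumul h s (j k : nat) : (j <= k)%N -> cumul h s j <= cumul h s k.
Proof.
move=> jk; rewrite /cumul [leRHS]big_mkcond [leLHS]big_mkcond.
apply: ler_sum => t _; case: ifP => [tj|_]; last by case: ifP.
by rewrite (leq_trans tj jk).
Qed.

Let low := fix low h s w : R :=
  if w is t :: w' then cumul h s t + step_prob h s t * low (rcons h s) t w'
  else 0.

Let low_rcons h s w t : low h s (rcons w t) =
  low h s w + path_prob h s w * cumul (h ++ belast s w) (last s w) t.
Proof.
elim: w h s => [|x w IH] h s /=.
  by rewrite mul1r mulr0 addr0 add0r cats0.
by rewrite IH cat_rcons mulrDr addrA mulrA.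
Qed.

Variable s0 : state M.
Let lo w := low [::] s0 w.
Let pp w := path_prob [::] s0 w.

Let lo_rcons w t :
  lo (rcons w t) = lo w + pp w * cumul (belast s0 w) (last s0 w) t.
Proof. exact: low_rcons. Qed.

Let pp_rcons w t :
  pp (rcons w t) = pp w * step_prob (belast s0 w) (last s0 w) t.
Proof. exact: path_prob_rcons. Qed.

Let inI (u : R) w : bool := (lo w <= u < lo w + pp w).

Let inI0 u : inI u [::] = (0 <= u < 1).
Proof. by rewrite /inI /lo /pp /= add0r. Qed.

Let inI_rcons u w t : inI u (rcons w t) =
  (lo w + pp w * cumul (belast s0 w) (last s0 w) t <= u
    < lo w + pp w * cumul (belast s0 w) (last s0 w) t.+1).
Proof. by rewrite /inI lo_rcons pp_rcons -addrA -mulrDr -cumulS. Qed.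

Let inI_sub u w t : inI u (rcons w t) -> inI u w.
Proof.
rewrite inI_rcons => /andP[l r]; apply/andP; split.
  by apply: le_trans l; rewrite lerDl mulr_ge0 ?path_prob_ge0 // sumr_ge0.
apply: (lt_le_trans r); rewrite lerD2l ler_piMr ?path_prob_ge0 //.
by rewrite -(cumulT (belast s0 w) (last s0 w)) le_cumul.
Qed.

Let inI_uniq u w t t' : inI u (rcons w t) -> inI u (rcons w t') -> t = t'.
Proof.
wlog le_tt' : t t' / (t <= t')%N => [wl|].
  by case/orP: (leq_total t t') => /wl // h1 h2 h3; rewrite (h1 h3 h2).
rewrite !inI_rcons => /andP[_ r] /andP[l _]; apply/val_inj/eqP.
rewrite eqn_leq le_tt' /= leqNgt; apply/negP => tt'.
have := le_lt_trans l r; rewrite ltNge => /negP; apply.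
by rewrite lerD2l ler_wpM2l ?path_prob_ge0 // le_cumul.
Qed.

Let inI_ex u w : inI u w -> exists t, inI u (rcons w t).
Proof.
move=> /andP[l r]; set c := cumul (belast s0 w) (last s0 w).
have ex : exists k, u < lo w + pp w * c k.
  by exists (mdp_ns M).+1; rewrite /c cumulT mulr1.
case: (ex_minnP ex) => [[|k]] ku kmin.
  by move: ku; rewrite /c cumul0 mulr0 addr0 ltNge l.
have kN : (k < (mdp_ns M).+1)%N by apply: kmin; rewrite /c cumulT mulr1.
exists (Ordinal kN); rewrite inI_rcons /= ku andbT leNgt.
by apply/negP => /kmin; rewrite ltnn.
Qed.

Let next u w : state M := odflt s0 [pick t | inI u (rcons w t)].

Let pre u n : seq (state M) := iter n (fun w => rcons w (next u w)) [::].

Let size_pre u n : size (pre u n) = n.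
Proof. by elim: n => //= n IH; rewrite size_rcons IH. Qed.

Let inI_pre u n : 0 <= u < 1 -> inI u (pre u n).
Proof.
move=> u01; elim: n => [|n IH] /=; first by rewrite inI0.
rewrite /next; case: pickP => //= no.
by have [t] := inI_ex IH; rewrite no.
Qed.

Let pre_uniq u w : inI u w -> pre u (size w) = w.
Proof.
elim/last_ind: w => [|w t IH] //= uw.
have uw' := inI_sub uw.
rewrite size_rcons /= IH //; congr rcons.
rewrite /next; case: pickP => /= [t' /inI_uniq|/(_ t)]; first by apply.
by rewrite uw.
Qed.

Let walk (u : R) : paths M := fun n => last s0 (pre u n).

Let nth_pre u n i : (i < n)%N -> nth ord0 (pre u n) i = walk u i.+1.
Proof.
elim: n => // n IH; rewrite ltnS leq_eqVlt => /orP[/eqP->|lt_in].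
  by rewrite /walk /= nth_rcons size_pre ltnn eqxx last_rcons.
by rewrite /= nth_rcons size_pre lt_in IH.
Qed.

Let walkE u s w :
  (walk u \in cylinder (s :: w)) = (s == s0) && (pre u (size w) == w).
Proof.
apply/idP/idP.
  rewrite inE => H; have := H 0%N isT; rewrite /walk /= => <-; rewrite eqxx /=.
  apply/eqP/(@eq_from_nth _ ord0); rewrite size_pre // => i iw.
  by rewrite nth_pre // (H i.+1).
move=> /andP[/eqP-> /eqP eqw]; rewrite inE => -[|i] //=.
by rewrite ltnS => iw; rewrite -(nth_pre u iw) eqw.
Qed.

Let walk_in u w : 0 <= u < 1 -> (walk u \in cylinder (s0 :: w)) = inI u w.
Proof.
move=> u01; rewrite walkE eqxx /=; apply/eqP/idP => [<-|/pre_uniq//].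
exact: inI_pre.
Qed.

Let pre_out u n : ~~ (0 <= u < 1) -> pre u n = nseq n s0.
Proof.
move=> u01; elim: n => // n IH /=; rewrite IH.
have -> : next u (nseq n s0) = s0; last by rewrite -cats1 -(nseqD n 1) addn1.
rewrite /next; case: pickP => // t; rewrite -[rcons _ _]cats0.
suff H w : ~~ inI u w by rewrite (negPf (H _)).
elim/last_ind: w => [|w t' IHw]; first by rewrite inI0.
by apply: contra IHw => /inI_sub.
Qed.

Let itvI w : [set u | inI u w] = `[lo w, lo w + pp w[%classic.
Proof. by apply/seteqP; split => u /=; rewrite in_itv. Qed.

Let walk_preimage w : walk @^-1` cylinder (s0 :: w) `&` `[0, 1[%classic =
  `[lo w, lo w + pp w[%classic.
Proof.
rewrite -itvI; apply/seteqP; split => u /=; rewrite in_itv /=.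
  by move=> [H u01]; rewrite -walk_in // inE.
move=> uw; suff u01 : 0 <= u < 1 by split => //; rewrite -inE walk_in.
elim/last_ind: w uw => [|w t IH]; first by rewrite inI0.
by move/inI_sub.
Qed.

Let measurable_walk :
  measurable_fun [set: measurableTypeR R] (walk : measurableTypeR R -> paths M).
Proof.
apply: measurability => // _ [_ [w _ <-] <-]; rewrite setTI.
case: w => [|s w].
  by rewrite (_ : _ @^-1` _ = setT)//; apply/seteqP; split.
have [->|ns] := eqVneq s s0; last first.
  rewrite (_ : _ @^-1` _ = set0)//; apply/seteqP; split => // u /= /mem_set.
  by rewrite walkE (negPf ns).
rewrite -[_ @^-1` _]setIT -(setUv `[0, 1[%classic) setIUr.
have -> : walk @^-1` cylinder (s0 :: w) `&` ~` `[0, 1[%classic =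
    if w == nseq (size w) s0 then ~` `[0, 1[%classic else set0.
  apply/seteqP; split => u /=.
    rewrite in_itv /= => -[/mem_set]; rewrite walkE eqxx /= => ew /negP nu.
    by rewrite pre_out // eq_sym in ew; rewrite ew /= in_itv /=; apply/negP.
  case: ifP => // ew; rewrite /= in_itv /= => nu; split => //.
  apply/set_mem; rewrite walkE eqxx /= pre_out; last exact/negP.
  by rewrite eq_sym.
apply: measurableU; first by rewrite walk_preimage; exact: measurable_itv.
by case: ifP => _ //; apply: measurableC; exact: measurable_itv.
Qed.

Let mU : measurable (`[0, 1[%classic : set (measurableTypeR R)).
Proof. exact: measurable_itv. Qed.

Let mu := pushforward (mrestr (@lebesgue_measure R) mU) walk.

Let mu0 : mu set0 = 0%E.
Proof. by rewrite /mu /pushforward preimage_set0 measure0. Qed.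

Let mu_ge0 A : (0 <= mu A)%E.
Proof. exact: measure_ge0. Qed.

Let mu_sigma_additive : semi_sigma_additive mu.
Proof.
move=> F mF tF mUF; rewrite /mu /pushforward preimage_bigcup.
apply: measure_semi_sigma_additive.
- by move=> n; rewrite -[X in measurable X]setTI; exact: measurable_walk.
- by apply/trivIsetP => i j _ _ ij; rewrite -preimage_setI;
    move/trivIsetP : tF => /(_ _ _ _ _ ij) ->//; rewrite preimage_set0.
- by rewrite -preimage_bigcup -[X in measurable X]setTI; exact: measurable_walk.
Qed.

Let mu_cylinder w : mu (cylinder (s0 :: w)) = (pp w)%:E.
Proof.
rewrite /mu /pushforward /mrestr walk_preimage lebesgue_measure_itv /= lte_fin.
case: ifPn => [_|]; first by rewrite -EFinB addrC addKr.
rewrite ltrDl -leNgt => pw; congr EFin; apply/eqP.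
by rewrite eq_le pw path_prob_ge0.
Qed.

Let mu_setT : mu setT = 1%E.
Proof.
rewrite /mu /pushforward preimage_setT /mrestr setTI lebesgue_measure_itv /=.
by rewrite lte_fin ltr01 oppr0 addr0.
Qed.

Lemma path_measure_exists : exists P : probability (paths M) R,
  forall w, P (cylinder (s0 :: w)) = (path_prob [::] s0 w)%:E.
Proof.
pose mu' : {measure set (paths M) -> \bar R} := HB.pack mu
  (isMeasure.Build _ _ _ mu mu0 mu_ge0 mu_sigma_additive).
pose P : probability (paths M) R := HB.pack mu
  (isMeasure.Build _ _ _ mu mu0 mu_ge0 mu_sigma_additive)
  (Measure_isProbability.Build _ _ _ mu' mu_setT).
by exists P => w; exact: mu_cylinder.
Qed.

(* Unique, as the cylinders generate the sigma-algebra and are stable under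
   nonempty intersection. *)
Definition path_measure : probability (paths M) R :=
  sval (cid path_measure_exists).

Lemma path_measure_cylinder w :
  path_measure (cylinder (s0 :: w)) = (path_prob [::] s0 w)%:E.
Proof. exact: (svalP (cid path_measure_exists)). Qed.

End PathMeasure.

(** * The decision problems *)

Definition visits_infinitely_often (M : mdp) (T : {set state M}) :
    set (paths M) :=
  [set p | forall i, exists j, (i <= j)%N /\ p j \in T].

Definition buechi_prob (R : realType) (M : mdp) (sigma : scheduler R M)
    (s : state M) (T : {set state M}) : R :=
  fine (path_measure sigma s (visits_infinitely_often T)).

Definition approx_eq (R : realType) (eps r r' : R) : Prop := `|r - r'| <= eps.

Variant relop :=
  | OpGt
  | OpGe
  | OpApprox (eps : rat) of 0 <= eps
  | OpNotApprox (eps : rat) of 0 <= eps.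

Definition relop_holds (R : realType) (c : relop) (r r' : R) : Prop :=
  match c with
  | OpGt => r > r'
  | OpGe => r >= r'
  | OpApprox eps _ => approx_eq (ratr eps) r r'
  | OpNotApprox eps _ => `|r - r'| > ratr eps
  end.

Definition rat_numbers (q : rat) : seq nat :=
  [:: nat_of_bool (q < 0)%R; `|numq q|%N; `|denq q|%N].

Definition list_all (T : finType) (f : T -> seq nat) : seq nat :=
  flatten [seq f x | x <- enum T].

Definition mdp_numbers (M : mdp) : seq nat :=
  [:: (mdp_ns M).+1; (mdp_na M).+1] ++
  list_all (fun s : state M => list_all (fun a : action M =>
    list_all (fun t : state M => rat_numbers (trans s a t)))).

Definition set_numbers (M : mdp) (T : {set state M}) : seq nat :=
  [seq (s \in T) : nat | s <- enum (state M)].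

Definition relop_numbers (c : relop) : seq nat :=
  match c with
  | OpGt => [:: 0%N]
  | OpGe => [:: 1%N]
  | OpApprox eps _ => 2%N :: rat_numbers eps
  | OpNotApprox eps _ => 3%N :: rat_numbers eps
  end.

Record rel_buechi_instance := RelBuechiInstance {
  rb_mdp : mdp;
  rb_m : nat;
  rb_n : nat;
  rb_coef : 'I_rb_m -> rat;
  rb_bound : rat;
  rb_init : 'I_rb_m -> state rb_mdp;
  rb_index : 'I_rb_m -> 'I_rb_n;
  rb_index_surj : forall j, exists i, rb_index i = j;
  rb_target : 'I_rb_m -> {set state rb_mdp};
  rb_op : relop }.

Definition rel_buechi_numbers (I : rel_buechi_instance) : seq nat :=
  mdp_numbers (rb_mdp I) ++ [:: rb_m I; rb_n I] ++
  list_all (fun i : 'I_(rb_m I) =>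
    rat_numbers (rb_coef i) ++ [:: (rb_init i : nat); (rb_index i : nat)] ++
    set_numbers (rb_target i)) ++
  rat_numbers (rb_bound I) ++ relop_numbers (rb_op I).

Definition RelBuechi_MD (R : realType) : problem :=
  @Problem rel_buechi_instance rel_buechi_numbers (fun I =>
    exists sigma : 'I_(rb_n I) -> scheduler R (rb_mdp I),
      (forall j, memoryless_deterministic (sigma j)) /\
      relop_holds (rb_op I)
        (\sum_(i < rb_m I) ratr (rb_coef i) *
           buechi_prob (sigma (rb_index i)) (rb_init i) (rb_target i))
        (ratr (rb_bound I))).

Record buechi_pair := BuechiPair {
  bp_mdp : mdp;
  bp_s1 : state bp_mdp;
  bp_s2 : state bp_mdp;
  bp_T1 : {set state bp_mdp};
  bp_T2 : {set state bp_mdp} }.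

Definition buechi_pair_numbers (I : buechi_pair) : seq nat :=
  mdp_numbers (bp_mdp I) ++ [:: (bp_s1 I : nat); (bp_s2 I : nat)] ++
  set_numbers (bp_T1 I) ++ set_numbers (bp_T2 I).

Definition buechi_diff (R : realType) (I : buechi_pair)
    (sigma1 sigma2 : scheduler R (bp_mdp I)) : R :=
  buechi_prob sigma1 (bp_s1 I) (bp_T1 I) -
  buechi_prob sigma2 (bp_s2 I) (bp_T2 I).

Definition BuechiEq_one_scheduler (R : realType) : problem :=
  @Problem buechi_pair buechi_pair_numbers (fun I =>
    exists sigma : scheduler R (bp_mdp I),
      memoryless_deterministic sigma /\ buechi_diff sigma sigma = 0).

Definition BuechiEq_two_schedulers (R : realType) : problem :=
  @Problem buechi_pair buechi_pair_numbers (fun I =>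
    exists sigma1 sigma2 : scheduler R (bp_mdp I),
      [/\ memoryless_deterministic sigma1, memoryless_deterministic sigma2 &
          buechi_diff sigma1 sigma2 = 0]).

Record buechi_pair_eps := BuechiPairEps {
  bpe_pair : buechi_pair;
  bpe_eps : rat;
  bpe_eps_gt0 : 0 < bpe_eps }.

Definition buechi_pair_eps_numbers (I : buechi_pair_eps) : seq nat :=
  buechi_pair_numbers (bpe_pair I) ++ rat_numbers (bpe_eps I).

Definition BuechiApprox_one_scheduler (R : realType) : problem :=
  @Problem buechi_pair_eps buechi_pair_eps_numbers (fun I =>
    exists sigma : scheduler R (bp_mdp (bpe_pair I)),
      memoryless_deterministic sigma /\
      approx_eq (ratr (bpe_eps I)) (buechi_diff sigma sigma) 0).

Definition BuechiApprox_two_schedulers (R : realType) : problem :=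
  @Problem buechi_pair_eps buechi_pair_eps_numbers (fun I =>
    exists sigma1 sigma2 : scheduler R (bp_mdp (bpe_pair I)),
      [/\ memoryless_deterministic sigma1, memoryless_deterministic sigma2 &
          approx_eq (ratr (bpe_eps I)) (buechi_diff sigma1 sigma2) 0]).

Definition pair_shape (same_init abs1 abs2 : bool) (I : buechi_pair) : Prop :=
  [/\ (bp_s1 I == bp_s2 I) = same_init,
      absorbing (bp_T1 I) = abs1 & absorbing (bp_T2 I) = abs2].

(* Main.v *)
From HB Require Import structures.
Require Import Defs.
From mathcomp Require Import all_boot all_order all_algebra.
From mathcomp Require perm all_classical all_reals all_analysis.
From mathcomp Require Import ring lra zify.

(* Hardness. The tableau of a polynomial-time verifier is a constraint satisfaction
   problem. The scheduler chooses the value of every variable and, for every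
   constraint, an allowed tuple; the difference of the base-[G] codes of the
   chosen values and of the chosen tuple is an integer defect. A chain of
   geometrically decreasing weights turns the defects into one Buechi probability,
   which equals a reference probability exactly when every defect vanishes, and
   otherwise misses it by a gap that leaves room for an epsilon.

   Membership. Under a memoryless deterministic scheduler the process is a finite
   Markov chain. Its Buechi probabilities are 0 and 1 on two closed sets and, in
   between, the unique harmonic function: by the maximum principle it suffices
   that some rank decreases along a transition from every other state. By
   Cramer's rule the values have a common denominator of polynomially many bits,
   so the scheduler, the labels, the ranks and the values form a certificate that
   exact arithmetic checks. *)


Set Implicit Arguments.
Unset Strict Implicit.
Unset Printing Implicit Defensive.

(** Strong hardness forbids large numbers in the instance, so the exponentially small weights cannot
    be transition probabilities; they arise as products along the chain, one factor [cD] per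
    constraint. The alphabet size [G], the arity 5 and the tables depend only on the verifier
    machine, hence all instances of one reduction use fractions over the same denominator and only
    the number of states grows. The gap is exponentially small in the number of constraints, so
    [eps] has polynomially many binary digits; this is why the approximate variants are treated in
    binary. The reference probability is the same for all schedulers, so one process serves both for
    one and for two of them. Polynomial time means Turing machines. None is written by hand:
    programs over stacks are compiled, binary trees are the universal data type, and [pt] collects
    the functions on encoded data that such programs compute, so that reductions and verifier are
    terms covered by closure lemmas. The verifier does not parse its input: the certificate carries
    the instance too, and its canonical encoding is compared with the word. *)

Module StackCharts.

(** * Flowcharts over stacks and their compilation to Turing machines *)

Section Charts.
Variables (A B : finType).

Definition sym : finType := (A + B + bool)%type.
Definition nstacks := 7.
Definition stacks := seq (seq sym).
Definition stack (c : stacks) (i : nat) : seq sym := nth [::] c i.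
Definition set_stack (c : stacks) (i : nat) (s : seq sym) : stacks :=
  set_nth [::] c i s.

Variant instr (S : Type) :=
  | IPush of 'I_nstacks & sym & option S
  | IPop of 'I_nstacks & (option sym -> option S).

Definition map_instr S S' (f : option S -> option S') (i : instr S) : instr S' :=
  match i with
  | IPush j a q => IPush j a (f q)
  | IPop j k => IPop j (fun x => f (k x))
  end.

(* A flowchart over stacks; the exit point is [None]. *)
Record chart := Chart {
  node : finType;
  entry : option node;
  instr_at : node -> instr node }.

Definition chart_step (M : chart) (qc : option (node M) * stacks) :
    option (node M) * stacks :=
  if qc.1 is Some q then
    match instr_at q with
    | IPush i a q' => (q', set_stack qc.2 i (a :: stack qc.2 i))
    | IPop i k => if stack qc.2 i is a :: s
        then (k (Some a), set_stack qc.2 i s) else (k None, qc.2)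
    end
  else qc.

Definition reach (M : chart) (x y : option (node M) * stacks) (n : nat) : Prop :=
  exists2 m, m <= n & iter m (@chart_step M) x = y.

Definition exec (M : chart) (c c' : stacks) (n : nat) : Prop :=
  @reach M (entry M, c) (None, c') n.

Lemma reach_refl M x n : @reach M x x n.
Proof. by exists 0. Qed.

Lemma reach_trans M x y z n m : @reach M x y n -> @reach M y z m ->
  @reach M x z (n + m).
Proof.
move=> [n' le_n <-] [m' le_m <-]; exists (m' + n'); last by rewrite iterD.
by rewrite addnC leq_add.
Qed.

Lemma reach_step M x y n : @reach M (@chart_step M x) y n -> @reach M x y n.+1.
Proof. by move=> [m le_m <-]; exists m.+1; rewrite ?ltnS // iterSr. Qed.

Lemma reachW M x y n m : n <= m -> @reach M x y n -> @reach M x y m.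
Proof. by move=> le_nm [k le_k <-]; exists k => //; exact: leq_trans le_nm. Qed.

Lemma execW M c c' n m : n <= m -> exec M c c' n -> exec M c c' m.
Proof. exact: reachW. Qed.

(** A chart copied into a larger one takes the same steps there, with its exit redirected to [e].
    Sequences, switches and loops all rest on this. *)
Lemma reach_embed (M N : chart) (f : node M -> node N) (e : option (node N)) :
  let lift q := if q is Some q then Some (f q) else e in
  (forall q, instr_at (f q) = map_instr lift (instr_at q)) ->
  forall q c c' n, @reach M (q, c) (None, c') n ->
    @reach N (lift q, c) (e, c') n.
Proof.
move=> lift fE q c c' n [m le_m].
elim: m n le_m q c => [|m IH] n le_m q c.
  by case=> -> ->; exact: reach_refl.
case: q => [q|]; last first.
  have -> : iter m.+1 (@chart_step M) (None, c) = (None, c).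
    by elim: m.+1 => //= k ->.
  by case=> ->; exact: reach_refl.
case: n le_m => // n; rewrite ltnS iterSr => le_m.
case E: (chart_step _) => [q1 c1] run.
apply: reach_step; have := IH _ le_m _ _ run.
suff -> : @chart_step N (Some (f q), c) = (lift q1, c1) by [].
move: E; rewrite /chart_step /= fE.
case: (instr_at q) => [i a q'|i k] /=; first by case=> <- <-.
by case: (stack c i) => [|a s] [<- <-].
Qed.

Definition skip_chart : chart :=
  @Chart unit None (fun q => @IPop unit ord0 (fun _ => None)).

Lemma exec_skip c n : exec skip_chart c c n.
Proof. exact: reach_refl. Qed.

Definition push_chart (i : 'I_nstacks) (a : sym) : chart :=
  @Chart unit (Some tt) (fun _ => IPush i a None).

Lemma exec_push (i : 'I_nstacks) a c n :
  exec (push_chart i a) c (set_stack c i (a :: stack c i)) n.+1.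
Proof. by apply: reach_step; exact: reach_refl. Qed.

Definition seq_chart (M N : chart) : chart :=
  @Chart (node M + node N)%type
    (if entry M is Some q then Some (inl q) else omap inr (entry N))
    (fun q => match q with
      | inl q => map_instr
          (fun r => if r is Some r then Some (inl r) else omap inr (entry N))
          (instr_at q)
      | inr q => map_instr (omap inr) (instr_at q)
      end).

Lemma exec_seq M N c c1 c2 n m : exec M c c1 n -> exec N c1 c2 m ->
  exec (seq_chart M N) c c2 (n + m).
Proof.
move=> eM eN; apply: (@reach_trans (seq_chart M N) _ (omap inr (entry N), c1)).
  exact: (@reach_embed M (seq_chart M N) inl _ _ _ _ _ _ eM).
have := @reach_embed N (seq_chart M N) inr None _ _ _ _ _ eN.
by rewrite /=; case: (entry N) => [q|] /=; apply => q'.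
Qed.

(** The node [None] pops; the empty stack is one of the cases. The popped symbol is gone, so a
    branch that only inspects it has to push it back. *)
Definition switch_chart (i : 'I_nstacks) (Ms : option sym -> chart) : chart :=
  @Chart (option {x : option sym & node (Ms x)}) (Some None)
    (fun q => match q with
      | None => IPop i (fun x =>
          omap (fun q => Some (Tagged (fun x => node (Ms x)) q)) (entry (Ms x)))
      | Some q => map_instr
          (omap (fun r => Some (Tagged (fun x => node (Ms x)) r)))
          (instr_at (tagged q))
      end).

Lemma exec_switch (i : 'I_nstacks) Ms c c' n :
  exec (Ms (ohead (stack c i)))
    (if stack c i is _ :: s then set_stack c i s else c) c' n ->
  exec (switch_chart i Ms) c c' n.+1.
Proof.
move=> eM; apply: reach_step.
have := @reach_embed _ (switch_chart i Ms)
  (fun q => Some (Tagged (fun x => node (Ms x)) q)) None _ _ _ _ _ eM.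
rewrite /chart_step /=.
by case: (stack c i) => [|a s] /=; case: (entry _) => [q|] /=; apply.
Qed.

(** The node [None] is the head of the loop, to which the exits of all bodies lead back. The number
    of rounds is governed by a stack, which a body may refill. *)
Definition loop_chart (i : 'I_nstacks) (Ms : sym -> chart) : chart :=
  @Chart (option {x : sym & node (Ms x)}) (Some None)
    (fun q =>
      let lift x r := if r is Some r then
        Some (Some (Tagged (fun x => node (Ms x)) r)) else Some None in
      match q with
      | None => IPop i (fun x => if x is Some x
          then lift x (entry (Ms x)) else None)
      | Some q => map_instr (lift (tag q)) (instr_at (tagged q))
      end).

Lemma exec_loop0 (i : 'I_nstacks) Ms c n : stack c i = [::] -> exec (loop_chart i Ms) c c n.+1.
Proof.
by move=> ci; apply: reach_step; rewrite /chart_step /= ci; exact: reach_refl.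
Qed.

Lemma exec_loopS (i : 'I_nstacks) Ms c a s c1 c2 n m : stack c i = a :: s ->
  exec (Ms a) (set_stack c i s) c1 n -> exec (loop_chart i Ms) c1 c2 m ->
  exec (loop_chart i Ms) c c2 (n + m).+1.
Proof.
move=> ci eM eL; apply: reach_step; rewrite /chart_step /= ci.
apply: reach_trans eL.
exact: (@reach_embed _ (loop_chart i Ms)
  (fun q => Some (Tagged (fun x => node (Ms x)) q)) (Some None) _ _ _ _ _ eM).
Qed.

Section Compile.
Variable M : chart.

(** The top of a stack lies under the head of its tape. A push moves left in one step and writes in
    a second one, which the boolean in the state announces; a pop erases the top and moves right at
    once. *)
Definition tm_of_chart : tm A B :=
  @TM A B bool (option (node M * bool)) nstacks.-1
    (omap (fun q => (q, false)) (entry M))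
    (fun q rd =>
      if q is Some (q, second) then
        match instr_at q with
        | IPush i a q' =>
          if second then
            Some (omap (fun q => (q, false)) q',
                  [ffun j => (if j == i then Some a else rd j, Stay)])
          else Some (Some (q, true),
                 [ffun j => (rd j, if j == i then MoveLeft else Stay)])
        | IPop i k =>
          Some (omap (fun q => (q, false)) (k (rd i)),
            [ffun j => if (j == i) && isSome (rd i) then (None, MoveRight)
                       else (rd j, Stay)])
        end
      else None).

(** The padding accounts for blanks that the head has visited. The cells to the left are left open,
    since a push overwrites what it finds there. *)
Definition tape_holds (t : tm_tape tm_of_chart) (s : seq sym) : Prop :=
  exists n, t.2 = map Some s ++ nseq n None.

Lemma tape_holds_read t s : tape_holds t s ->
  @tape_read A B tm_of_chart t = ohead s.
Proof. by case: t => l r [n /= ->]; case: s => [|a s] //=; case: n. Qed.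

Lemma tape_holds_stay t s : tape_holds t s ->
  tape_holds (@tape_act A B tm_of_chart t (tape_read t, Stay)) s.
Proof.
case: t => l r [n /= ->]; case: s => [|a s] /=; last by exists n.
by exists n.-1.+1; case: n.
Qed.

Lemma tape_holds_pop t a s : tape_holds t (a :: s) ->
  tape_holds (@tape_act A B tm_of_chart t (None, MoveRight)) s.
Proof. by case: t => l r [n /= ->]; exists n. Qed.

Lemma tape_holds_push t a s : tape_holds t s ->
  tape_holds (@tape_act A B tm_of_chart
    (tape_act t (tape_read t, MoveLeft)) (Some a, Stay)) (a :: s).
Proof.
move=> ts; have [n /= E] := tape_holds_stay ts; case: t ts E => l r ts E.
by exists n; rewrite /= -E.
Qed.

Definition tapes_hold (c : tm_config tm_of_chart)
    (qs : option (node M) * stacks) : Prop :=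
  c.1 = omap (fun q => (q, false)) qs.1 /\
  forall i, tape_holds (c.2 i) (stack qs.2 i).

Lemma tm_simulates_step c qs : tapes_hold c qs ->
  exists2 n, n <= 2 & tapes_hold (tm_run n c) (@chart_step M qs).
Proof.
case: c qs => q t [[p|] s] [/= -> ts]; last by exists 0.
case E: (instr_at p) => [i a q'|i k].
- exists 2 => //; rewrite /tm_run /= /tm_next /= E /= E /chart_step /= E.
  split=> //= j; rewrite !ffunE;  case: eqP => [->|ne].
    rewrite /stack /set_stack nth_set_nth /= eqxx; exact: tape_holds_push.
  rewrite /stack /set_stack nth_set_nth /=.
  have [eq|_] := eqVneq (nat_of_ord j) (nat_of_ord i).
    by case: ne; apply: val_inj.
  by do 2! apply: tape_holds_stay; exact: ts.
- exists 1 => //; rewrite /tm_run /= /tm_next /= E /chart_step /= E !ffunE.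
  rewrite (tape_holds_read (ts i)); split=> /=.
    by case: (stack s i).
  move=> j; rewrite !ffunE; case: eqP => [->|ne] /=.
    case Es: (stack s i) (ts i) => [|a l] /= ti.
      by have := tape_holds_stay ti; rewrite Es.
    rewrite /stack nth_set_nth /= eqxx.
    exact: tape_holds_pop ti.
  have tj := tape_holds_stay (ts j).
  case Es: (stack s i) => [|a l] //=.
  rewrite /stack nth_set_nth /=.
  have [eq|//] := eqVneq (nat_of_ord j) (nat_of_ord i).
  by case: ne; apply: val_inj.
Qed.

Lemma tm_simulates m c qs : tapes_hold c qs ->
  exists2 n, n <= m.*2 & tapes_hold (tm_run n c) (iter m (@chart_step M) qs).
Proof.
move=> cqs; elim: m => [|m [n le_n IH]]; first by exists 0.
have [k le_k run] := tm_simulates_step IH; exists (k + n).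
  by rewrite doubleS -add2n leq_add.
by rewrite /tm_run iterD.
Qed.

End Compile.

Definition chart_input (x : seq A) : stacks :=
  [:: [seq inl (inl a) | a <- x]; [::]; [::]; [::]; [::]; [::]; [::]].

Lemma polytime_of_chart (M : chart) (f : seq A -> seq B) (k : nat) :
  (forall x, exists2 c, exec M (chart_input x) c ((size x + 2) ^ k) &
     stack c nstacks.-1 = [seq inl (inr b) | b <- f x]) ->
  polytime f.
Proof.
(* The factor 2 is the cost of a push on the machine. *)
move=> H; exists (tm_of_chart M), ((('X + 2%:P) ^+ k) *+ 2)%R => x.
have [c [m le_m run] out] := H x.
have init : tapes_hold (tm_init (tm_of_chart M) x) (entry M, chart_input x).
  split=> //= i; rewrite ffunE; case: eqP => [->|ne] /=.
    by exists 0; rewrite cats0 -map_comp.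
  exists 0; case: i ne => [[|[|[|[|[|[|[|//]]]]]]] p] //= ne.
  by case: ne; exact: val_inj.
have [n le_n] := tm_simulates m init; rewrite run => -[/= st ts].
exists n; split.
- apply: (leq_trans le_n); rewrite hornerMn horner_exp hornerD hornerX hornerC.
  by rewrite -GRing.mulr_natr !natrE -muln2 leq_mul2r le_m orbT.
- by rewrite /tm_halted /tm_next st.
- have [j] := ts ord_max; rewrite [stack _ _]out /tm_output => ->.
  by elim: (f x) => [|b s IH] /=; [case: j|rewrite IH].
Qed.

End Charts.

End StackCharts.
Import StackCharts.

(** * Polynomial bounds, and stack programs on coded binary trees *)

Module TreeMachines.

Lemma leq_exp2rW m n e : m <= n -> m ^ e <= n ^ e.
Proof. by case: e => // e; rewrite leq_exp2r. Qed.

Section PolyBounds.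
Variables (X : Type) (s : X -> nat).

(** The base is at least 2, so a single exponent absorbs constants, sums and products, and no
    polynomials have to be exhibited. *)
Definition pbounded (g : X -> nat) : Prop :=
  exists k, forall x, g x <= (s x + 2) ^ k.

Lemma pbounded_le g h : (forall x, g x <= h x) -> pbounded h -> pbounded g.
Proof. by move=> gh [k hk]; exists k => x; apply: leq_trans (hk x). Qed.

Lemma pbounded_const c : pbounded (fun=> c).
Proof.
exists c => x; apply: leq_trans (ltnW (@ltn_expl 2 c isT)) _.
by apply: leq_exp2rW; rewrite addn2.
Qed.

Lemma pbounded_size : pbounded s.
Proof. by exists 1 => x; rewrite expn1 leq_addr. Qed.

Lemma pbounded_mul g h :
  pbounded g -> pbounded h -> pbounded (fun x => g x * h x).
Proof.
move=> [k hk] [l hl]; exists (k + l) => x; rewrite expnD.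
exact: leq_mul (hk x) (hl x).
Qed.

Lemma pbounded_add g h :
  pbounded g -> pbounded h -> pbounded (fun x => g x + h x).
Proof.
move=> [k hk] [l hl]; exists (k + l).+1 => x.
have p0 m : 0 < (s x + 2) ^ m by rewrite expn_gt0 addn2.
rewrite expnS; apply: (@leq_trans (2 * (s x + 2) ^ (k + l))); last first.
  by rewrite leq_mul2r leq_addl orbT.
rewrite mul2n -addnn expnD; apply: leq_add.
  by apply: leq_trans (hk x) _; rewrite leq_pmulr.
by apply: leq_trans (hl x) _; rewrite leq_pmull.
Qed.

Lemma pbounded_exp g k : pbounded g -> pbounded (fun x => g x ^ k).
Proof.
move=> [l hl]; exists (l * k) => x; rewrite expnM.
exact: leq_exp2rW.
Qed.

End PolyBounds.

Lemma pbounded_comp (X Y : Type) (s : X -> nat) (u : Y -> nat) (f : X -> Y)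
    (g : Y -> nat) :
  pbounded u g -> pbounded s (fun x => u (f x)) -> pbounded s (fun x => g (f x)).
Proof.
move=> [k gk] uf; apply: (@pbounded_le _ _ _ (fun x => (u (f x) + 2) ^ k)).
  by move=> x; exact: gk.
by apply/pbounded_exp/pbounded_add => //; exact: pbounded_const.
Qed.

Ltac pbd := repeat first
  [ assumption | exact: pbounded_size | exact: pbounded_const
  | apply: pbounded_add | apply: pbounded_mul | apply: pbounded_exp ].

Inductive tree := Leaf | Branch of tree & tree.

(** A prefix code: it delimits itself, so several trees can lie on one stack without separators. *)
Fixpoint code (x : tree) : seq bool :=
  if x is Branch a b then true :: code a ++ code b else [:: false].

Fixpoint tsize (x : tree) : nat :=
  if x is Branch a b then (tsize a + tsize b).+1 else 1.

Lemma size_code x : size (code x) = tsize x.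
Proof. by elim: x => //= a IHa b IHb; rewrite size_cat IHa IHb. Qed.

Lemma tsize_gt0 x : 0 < tsize x.
Proof. by case: x. Qed.

Definition thd x := if x is Branch a _ then a else Leaf.
Definition ttl x := if x is Branch _ b then b else Leaf.

Section TreeCharts.
Variables (A B : finType).
Local Notation sym := (sym A B).
Local Notation chart := (chart A B).
Local Notation bit b := (inr b : sym).

(* The input, main, two auxiliary, counter, flag and output stacks. *)
Definition s_in : 'I_nstacks := @Ordinal nstacks 0 isT.
Definition s_main : 'I_nstacks := @Ordinal nstacks 1 isT.
Definition s_aux : 'I_nstacks := @Ordinal nstacks 2 isT.
Definition s_aux' : 'I_nstacks := @Ordinal nstacks 3 isT.
Definition s_ct : 'I_nstacks := @Ordinal nstacks 4 isT.
Definition s_fl : 'I_nstacks := @Ordinal nstacks 5 isT.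
Definition s_out : 'I_nstacks := @Ordinal nstacks 6 isT.

Definition tcode (x : tree) : seq sym := [seq bit b | b <- code x].

Lemma tcode_cons a b : tcode (Branch a b) = bit true :: tcode a ++ tcode b.
Proof. by rewrite /tcode /= map_cat. Qed.

Lemma size_tcode x : size (tcode x) = tsize x.
Proof. by rewrite size_map size_code. Qed.

Definition work (m a a' c f : seq sym) : stacks A B :=
  [:: [::]; m; a; a'; c; f; [::]].
Definition idle (m : seq sym) : stacks A B := work m [::] [::] [::] [::].

(** [C l t] describes the stacks when [l] is still to be read and [t] has been accumulated. *)
Lemma exec_loop_each (T : Type) (i : 'I_nstacks) (Ms : sym -> chart)
    (C : seq sym -> T -> stacks A B) (g : T -> sym -> T) n :
  (forall (l : seq sym) (t : T), stack (C l t) i = l) ->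
  (forall (a : sym) (l : seq sym) (t : T), exec (Ms a) (set_stack (C (a :: l) t) i l) (C l (g t a)) n) ->
  forall l t, exec (loop_chart i Ms) (C l t) (C [::] (foldl g t l))
    (n.+1 * size l + 1).
Proof.
move=> Ci eM; elim=> [|a l IH] t /=; first by rewrite muln0; apply: exec_loop0; exact: Ci.
have -> : n.+1 * (size l).+1 + 1 = (n + (n.+1 * size l + 1)).+1 by lia.
by apply: exec_loopS (IH _); [exact: Ci|exact: eM].
Qed.

Lemma foldl_cons (T : Type) (s l : seq T) : foldl (fun u a => a :: u) s l = rev l ++ s.
Proof. by elim: l s => //= a l IH s; rewrite IH rev_cons cat_rcons. Qed.

(** The counter stack holds one mark for every subtree still to be read: a branch bit trades its
    mark for two, a leaf bit uses its mark up. The loop ends exactly at the end of the tree, which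
    arrives reversed. *)
Definition move_tree (j : 'I_nstacks) : chart :=
  loop_chart s_ct (fun _ => switch_chart s_main (fun x =>
    match x with
    | Some (inr true) =>
      seq_chart (push_chart j (bit true))
        (seq_chart (push_chart s_ct (bit true)) (push_chart s_ct (bit true)))
    | Some (inr false) => push_chart j (bit false)
    | _ => skip_chart A B
    end)).

(** Both subtrees are read by the same running loop, so the claim is stated with an arbitrary
    continuation of the run; the induction then chains the two subtrees. *)
Lemma exec_move_aux x r a a' c f c2 m :
  exec (move_tree s_aux) (work r (rev (tcode x) ++ a) a' c f) c2 m ->
  exec (move_tree s_aux) (work (tcode x ++ r) a a' (bit true :: c) f) c2
    (m + 5 * tsize x).
Proof.
elim: x r a c c2 m => [|x IHx y IHy] r a c c2 m run.
  have -> : m + 5 * tsize Leaf = (3 + (m + 1)).+1 by rewrite /=; lia.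
  apply: exec_loopS => //=; last by apply: execW run; rewrite leq_addr.
  by apply: exec_switch; exact: exec_push.
rewrite tcode_cons /= -catA.
have -> : m + 5 * (tsize x + tsize y).+1 =
  (4 + (m + 5 * tsize y + 5 * tsize x)).+1 by lia.
apply: exec_loopS => //=.
  apply: exec_switch => /=.
  apply: (@exec_seq _ _ _ _ _ _ _ 1 2); first exact: exec_push.
  by apply: (@exec_seq _ _ _ _ _ _ _ 1 1); exact: exec_push.
apply: IHx; apply: IHy; move: run.
by rewrite tcode_cons rev_cons rev_cat cat_rcons -catA.
Qed.

Lemma exec_move_aux' x r a a' c f c2 m :
  exec (move_tree s_aux') (work r a (rev (tcode x) ++ a') c f) c2 m ->
  exec (move_tree s_aux') (work (tcode x ++ r) a a' (bit true :: c) f) c2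
    (m + 5 * tsize x).
Proof.
elim: x r a' c c2 m => [|x IHx y IHy] r a' c c2 m run.
  have -> : m + 5 * tsize Leaf = (3 + (m + 1)).+1 by rewrite /=; lia.
  apply: exec_loopS => //=; last by apply: execW run; rewrite leq_addr.
  by apply: exec_switch; exact: exec_push.
rewrite tcode_cons /= -catA.
have -> : m + 5 * (tsize x + tsize y).+1 =
  (4 + (m + 5 * tsize y + 5 * tsize x)).+1 by lia.
apply: exec_loopS => //=.
  apply: exec_switch => /=.
  apply: (@exec_seq _ _ _ _ _ _ _ 1 2); first exact: exec_push.
  by apply: (@exec_seq _ _ _ _ _ _ _ 1 1); exact: exec_push.
apply: IHx; apply: IHy; move: run.
by rewrite tcode_cons rev_cons rev_cat cat_rcons -catA.
Qed.

Definition take_tree (j : 'I_nstacks) : chart :=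
  seq_chart (push_chart s_ct (bit true)) (move_tree j).

Lemma exec_take_aux x r a' f :
  exec (take_tree s_aux) (work (tcode x ++ r) [::] a' [::] f)
    (work r (rev (tcode x)) a' [::] f) (5 * tsize x + 2).
Proof.
have -> : 5 * tsize x + 2 = 1 + (1 + 5 * tsize x) by lia.
apply: exec_seq; first exact: exec_push.
by apply: exec_move_aux; rewrite cats0; exact: exec_loop0.
Qed.

Lemma exec_take_aux' x r a f :
  exec (take_tree s_aux') (work (tcode x ++ r) a [::] [::] f)
    (work r a (rev (tcode x)) [::] f) (5 * tsize x + 2).
Proof.
have -> : 5 * tsize x + 2 = 1 + (1 + 5 * tsize x) by lia.
apply: exec_seq; first exact: exec_push.
by apply: exec_move_aux'; rewrite cats0; exact: exec_loop0.
Qed.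

Definition pour (i j : 'I_nstacks) : chart :=
  loop_chart i (fun a => push_chart j a).

Definition drop_chart : chart :=
  seq_chart (take_tree s_aux) (loop_chart s_aux (fun _ => skip_chart A B)).

Lemma exec_drop x r : exec drop_chart (idle (tcode x ++ r)) (idle r)
  (10 * tsize x + 10).
Proof.
have E := @exec_take_aux x r [::] [::].
have := exec_seq E (@exec_loop_each unit s_aux (fun _ => skip_chart A B)
  (fun l _ => work r l [::] [::] [::]) (fun _ _ => tt) 0 (fun _ _ => erefl)
  (fun _ _ _ => exec_skip _ _) _ tt).
by apply: execW; rewrite size_rev size_tcode; lia.
Qed.

Definition swap_chart : chart :=
  seq_chart (take_tree s_aux) (seq_chart (take_tree s_aux')
    (seq_chart (pour s_aux s_main) (pour s_aux' s_main))).

Lemma exec_swap x y r :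
  exec swap_chart (idle (tcode x ++ tcode y ++ r)) (idle (tcode y ++ tcode x ++ r))
    (10 * (tsize x + tsize y) + 20).
Proof.
have E1 := @exec_take_aux x (tcode y ++ r) [::] [::].
have E2 := @exec_take_aux' y r (rev (tcode x)) [::].
have E3 := @exec_loop_each _ s_aux (fun a => push_chart s_main a)
  (fun l t => work t l (rev (tcode y)) [::] [::]) (fun t a => a :: t) 1
  (fun _ _ => erefl) (fun _ _ _ => exec_push _ _ _ _) (rev (tcode x)) r.
rewrite foldl_cons revK in E3.
have E4 := @exec_loop_each _ s_aux' (fun a => push_chart s_main a)
  (fun l t => work t [::] l [::] [::]) (fun t a => a :: t) 1
  (fun _ _ => erefl) (fun _ _ _ => exec_push _ _ _ _) (rev (tcode y))
  (tcode x ++ r).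
rewrite foldl_cons revK in E4.
have := exec_seq E1 (exec_seq E2 (exec_seq E3 E4)).
by apply: execW; rewrite !size_rev !size_tcode; lia.
Qed.

(** The reversed copy is poured onto the main stack and onto a second stack at once; one more
    reversal brings the latter into the order needed for the second copy. *)
Definition dup_chart : chart :=
  seq_chart (take_tree s_aux)
    (seq_chart (loop_chart s_aux (fun a =>
       seq_chart (push_chart s_main a) (push_chart s_aux' a)))
    (seq_chart (pour s_aux' s_aux) (pour s_aux s_main))).

Lemma exec_dup x r :
  exec dup_chart (idle (tcode x ++ r)) (idle (tcode x ++ tcode x ++ r))
    (20 * tsize x + 20).
Proof.
have E1 := @exec_take_aux x r [::] [::].
have E2 := @exec_loop_each _ s_aux (fun a => seq_chart (push_chart s_main a)
    (push_chart s_aux' a))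
  (fun l t => work t.1 l t.2 [::] [::]) (fun t a => (a :: t.1, a :: t.2)) 2
  (fun _ _ => erefl) (fun _ _ _ =>
    @exec_seq _ _ _ _ _ _ _ 1 1 (exec_push _ _ _ _) (exec_push _ _ _ _))
  (rev (tcode x)) (r, [::]).
have F (l : seq sym) t : foldl (fun t a => (a :: t.1, a :: t.2)) t l =
    (rev l ++ t.1, rev l ++ t.2).
  elim: l t => [|b l IH] [t1 t2] //=.
  by rewrite IH /= rev_cons !cat_rcons.
rewrite F revK cats0 /= in E2.
have E3 := @exec_loop_each _ s_aux' (fun a => push_chart s_aux a)
  (fun l t => work (tcode x ++ r) t l [::] [::]) (fun t a => a :: t) 1
  (fun _ _ => erefl) (fun _ _ _ => exec_push _ _ _ _) (tcode x) [::].
rewrite foldl_cons cats0 in E3.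
have E4 := @exec_loop_each _ s_aux (fun a => push_chart s_main a)
  (fun l t => work t l [::] [::] [::]) (fun t a => a :: t) 1
  (fun _ _ => erefl) (fun _ _ _ => exec_push _ _ _ _) (rev (tcode x))
  (tcode x ++ r).
rewrite foldl_cons revK in E4.
have := exec_seq E1 (exec_seq E2 (exec_seq E3 E4)).
by apply: execW; rewrite !size_rev !size_tcode; lia.
Qed.

(** The left subtree is a branch exactly when the code starts with two branch bits. The flag is
    raised in this case, and the inspected bits are put back. *)
Definition test_loop : chart :=
  switch_chart s_main (fun x =>
    if x is Some (inr true) then
      switch_chart s_main (fun y =>
        if y is Some (inr true) then
          seq_chart (push_chart s_main (bit true))
            (seq_chart (push_chart s_main (bit true))
              (push_chart s_fl (bit true)))
        else seq_chart (push_chart s_main (bit false))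
               (push_chart s_main (bit true)))
    else push_chart s_main (bit false)).

Lemma exec_test_loop x r : exec test_loop (idle (tcode x ++ r))
  (work (tcode x ++ r) [::] [::] [::]
     (if thd x is Branch _ _ then [:: bit true] else [::])) 5.
Proof.
case: x => [|[|a b] y].
- by apply: exec_switch; exact: exec_push.
- apply: exec_switch; apply: exec_switch => /=.
  by apply: (@exec_seq _ _ _ _ _ _ _ 1 2); exact: exec_push.
- rewrite !tcode_cons; apply: exec_switch; apply: exec_switch => /=.
  apply: (@exec_seq _ _ _ _ _ _ _ 1 2); first exact: exec_push.
  by apply: (@exec_seq _ _ _ _ _ _ _ 1 1); exact: exec_push.
Qed.

Definition while_chart (M : chart) : chart :=
  seq_chart test_loop
    (loop_chart s_fl (fun _ => seq_chart M test_loop)).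

Lemma exec_while M (X : Type) (e : X -> tree) (f : X -> X) (t : X -> nat)
    (b : nat) n x r :
  (forall x r, exec M (idle (tcode (e x) ++ r)) (idle (tcode (e (f x)) ++ r))
     (t x)) ->
  (forall i, i < n -> thd (e (iter i f x)) <> Leaf) ->
  thd (e (iter n f x)) = Leaf ->
  (forall i, i < n -> t (iter i f x) <= b) ->
  exec (while_chart M) (idle (tcode (e x) ++ r))
    (idle (tcode (e (iter n f x)) ++ r)) (n * (b + 6) + 6).
Proof.
move=> Mf ne e0 tb.
have -> : n * (b + 6) + 6 = 5 + (n * (b + 6) + 1) by lia.
apply: exec_seq (exec_test_loop _ _) _.
elim: n x ne e0 tb => [|n IH] x ne e0 tb.
  by move: e0 => /= ->; exact: exec_loop0.
have := ne 0 isT; rewrite /=; case E: (thd (e x)) => [//|u v] _.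
have -> : n.+1 * (b + 6) + 1 = (b + 5 + (n * (b + 6) + 1)).+1 by lia.
apply: exec_loopS => //=.
  apply: exec_seq (exec_test_loop _ _).
  by apply: execW (Mf x r); apply: (tb 0).
rewrite -/(iter n.+1 f x) iterSr; apply: IH.
- by move=> i lt_in; rewrite -iterSr; apply: ne.
- by rewrite -iterSr.
- by move=> i lt_in; rewrite -iterSr; apply: tb.
Qed.

End TreeCharts.

Structure encType := EncType { esort :> Type; enc : esort -> tree }.
Arguments enc {_} _.
Definition sz {X : encType} (x : X) : nat := tsize (enc x).

(** The bound on the output size is what keeps compositions polynomial. Whatever lies below the
    argument is preserved, so programs can run on top of data that others still need. *)
Definition pt {X Y : encType} (f : X -> Y) : Prop :=
  pbounded sz (fun x => sz (f x)) /\
  forall A B : finType, exists (M : chart A B) (t : X -> nat),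
    pbounded sz t /\
    forall x r, exec M (idle (tcode A B (enc x) ++ r))
      (idle (tcode A B (enc (f x)) ++ r)) (t x).

Lemma pt_size (X Y : encType) (f : X -> Y) :
  pt f -> pbounded sz (fun x => sz (f x)).
Proof. by case. Qed.

Section TreeOperations.
Context {X Y Z W : encType}.

(** Programs see codes only. This lemma passes between types whose codes coincide, and from a
    function to any extensionally equal definition of it. *)
Lemma pt_recode (f : X -> Y) (g : X -> Z) :
  (forall x, enc (f x) = enc (g x)) -> pt f -> pt g.
Proof.
move=> fg [sf H]; split; first by apply: pbounded_le sf => x; rewrite /sz fg.
move=> A B; have [M [t [ptt Mf]]] := H A B; exists M, t; split=> // x r.
by rewrite -fg.
Qed.

Lemma pt_id : pt (fun x : X => x).
Proof.
split; first exact: pbounded_size.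
move=> A B; exists (skip_chart A B), (fun=> 0); split; first exact: pbounded_const.
by move=> x r; exact: exec_skip.
Qed.

Lemma pt_comp (f : Y -> Z) (g : X -> Y) : pt f -> pt g -> pt (fun x => f (g x)).
Proof.
move=> [sf Hf] [sg Hg]; split; first exact: (pbounded_comp sf).
move=> A B; have [M [t [ptt Mf]]] := Hf A B; have [N [u [pu Ng]]] := Hg A B.
exists (seq_chart N M), (fun x => u x + t (g x)); split.
  by apply: pbounded_add => //; exact: (pbounded_comp ptt).
by move=> x r; exact: exec_seq (Ng x r) (Mf (g x) r).
Qed.

Lemma pt_tnil (h : X -> Y) : (forall x, enc (h x) = Leaf) -> pt h.
Proof.
move=> hN; split.
  by apply: (@pbounded_le _ _ _ (fun=> 1)); [move=> x; rewrite /sz hN|pbd].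
move=> A B; exists (seq_chart (drop_chart A B) (push_chart s_main (inr false))).
exists (fun x => 10 * sz x + 10 + 1); split; first by pbd.
by move=> x r; rewrite hN; apply: exec_seq (exec_drop _ _) (exec_push _ _ _ _).
Qed.

(** The argument is duplicated, [g] is computed on the upper copy, the result is swapped below the
    other copy, [f] is computed, and one branch bit joins the two codes. *)
Lemma pt_tcons (f : X -> Y) (g : X -> Z) (h : X -> W) :
  (forall x, enc (h x) = Branch (enc (f x)) (enc (g x))) -> pt f -> pt g -> pt h.
Proof.
move=> hE [sf Hf] [sg Hg]; split.
  apply: (@pbounded_le _ _ _ (fun x => 1 + (sz (f x) + sz (g x)))); last by pbd.
  by move=> x; rewrite /sz hE.
move=> A B; have [M [t [ptt Mf]]] := Hf A B; have [N [u [pu Ng]]] := Hg A B.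
exists (seq_chart (dup_chart A B) (seq_chart N (seq_chart (swap_chart A B)
  (seq_chart M (push_chart s_main (inr true)))))).
exists (fun x => (20 * sz x + 20) + (u x +
  ((10 * (sz (g x) + sz x) + 20) + (t x + 1)))).
split; first by pbd.
move=> x r; apply: exec_seq (exec_dup _ _) _; apply: exec_seq (Ng _ _) _.
apply: exec_seq (exec_swap _ _ _) _; apply: exec_seq (Mf _ _) _.
by rewrite hE tcode_cons /= -catA; exact: exec_push.
Qed.

Lemma tsize_thd x : tsize (thd x) <= tsize x.
Proof. by case: x => //= a b; lia. Qed.

Lemma tsize_ttl x : tsize (ttl x) <= tsize x.
Proof. by case: x => //= a b; lia. Qed.

Lemma pt_thd (f : X -> Y) : (forall x, enc (f x) = thd (enc x)) -> pt f.
Proof.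
move=> fE; split.
  apply: pbounded_le (pbounded_size _) => x; rewrite /sz fE; exact: tsize_thd.
move=> A B; exists (switch_chart s_main (fun x => if x is Some (inr true)
  then seq_chart (swap_chart A B) (drop_chart A B)
  else push_chart s_main (inr false))), (fun x => 20 * sz x + 40).
split; first by pbd.
move=> x r; rewrite fE /sz; case: (enc x) => [|a b]; rewrite [_ + 40]addnS.
  by apply: exec_switch; rewrite addnS; exact: exec_push.
rewrite tcode_cons /= -catA; apply: exec_switch => /=.
have := exec_seq (exec_swap a b r) (exec_drop b (tcode A B a ++ r)).
by apply: execW; lia.
Qed.

Lemma pt_ttl (f : X -> Y) : (forall x, enc (f x) = ttl (enc x)) -> pt f.
Proof.
move=> fE; split.
  apply: pbounded_le (pbounded_size _) => x; rewrite /sz fE; exact: tsize_ttl.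
move=> A B; exists (switch_chart s_main (fun x => if x is Some (inr true)
  then drop_chart A B
  else push_chart s_main (inr false))), (fun x => 20 * sz x + 40).
split; first by pbd.
move=> x r; rewrite fE /sz; case: (enc x) => [|a b]; rewrite [_ + 40]addnS.
  by apply: exec_switch; rewrite addnS; exact: exec_push.
rewrite tcode_cons /= -catA; apply: exec_switch => /=.
by apply: execW (exec_drop a (tcode A B b ++ r)); lia.
Qed.

Lemma pt_tif (b : X -> W) (f g h : X -> Y) :
  (forall x, h x = if enc (b x) is Branch _ _ then f x else g x) ->
  pt b -> pt f -> pt g -> pt h.
Proof.
move=> hE [sb Hb] [sf Hf] [sg Hg]; split.
  apply: (@pbounded_le _ _ _ (fun x => sz (f x) + sz (g x))); last by pbd.
  by move=> x; rewrite hE; case: (enc (b x)) => *; rewrite ?leq_addl ?leq_addr.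
move=> A B; have [M [t [ptt Mf]]] := Hf A B; have [N [u [pu Ng]]] := Hg A B.
have [C [v [pv Cb]]] := Hb A B.
(* The switch consumes the first bit of the guard; a branch leaves two further trees to drop, a leaf
   leaves none. *)
exists (seq_chart (dup_chart A B) (seq_chart C (switch_chart s_main (fun x =>
  if x is Some (inr true)
  then seq_chart (drop_chart A B) (seq_chart (drop_chart A B) M) else N)))).
exists (fun x => (20 * sz x + 20) + (v x +
  ((10 * sz (b x) + 20) + (t x + u x)).+1)).
split.
  apply: (@pbounded_le _ _ _ (fun x => (20 * sz x + 20) + (v x +
    (1 + ((10 * sz (b x) + 20) + (t x + u x)))))) => //.
  by pbd.
move=> x r; apply: exec_seq (exec_dup _ _) _; apply: exec_seq (Cb _ _) _.
rewrite hE /sz; case: (enc (b x)) => [|p q]; apply: exec_switch => /=.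
  by apply: execW (Ng x r); lia.
rewrite map_cat -/(tcode A B p) -/(tcode A B q) -!catA.
have := exec_seq (exec_drop p (tcode A B q ++ tcode A B (enc x) ++ r))
  (exec_seq (exec_drop q _) (Mf x r)).
by apply: execW; rewrite /=; lia.
Qed.

(* The loop runs while the head of the state is not [Leaf]. *)
Lemma pt_while (f : X -> X) (n : X -> nat) : pt f ->
  (forall x i, i < n x -> thd (enc (iter i f x)) <> Leaf) ->
  (forall x, thd (enc (iter (n x) f x)) = Leaf) ->
  pbounded sz n ->
  (exists2 b, pbounded sz b & forall x i, i <= n x -> sz (iter i f x) <= b x) ->
  pt (fun x => iter (n x) f x).
Proof.
move=> [sf Hf] ne e pn [b pb bb]; split.
  by apply: pbounded_le pb => x; exact: bb.
move=> A B; have [M [t [[k ptt] Mf]]] := Hf A B.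
exists (while_chart M), (fun x => n x * ((b x + 2) ^ k + 6) + 6); split; first by pbd.
move=> x r; apply: (exec_while _ Mf) => //; first exact: ne.
move=> i lt_in; apply: leq_trans (ptt _) _.
by apply: leq_exp2rW; rewrite leq_add2r bb // ltnW.
Qed.

End TreeOperations.

End TreeMachines.
Import TreeMachines.

(** * Polynomial-time functions on booleans, unary numbers, pairs and lists *)

Module PolytimeFunctions.
Import boolp.
Canonical tree_encType := @EncType tree id.
Canonical unit_encType := @EncType unit (fun _ => Leaf).
Canonical bool_encType :=
  @EncType bool (fun b => if b then Branch Leaf Leaf else Leaf).
(** Unary, with a code shaped like a list: these numbers serve as counters, indices and lengths, and
    conversions from and to lists of units cost nothing. *)
Canonical nat_encType := @EncType nat (fun n => iter n (Branch Leaf) Leaf).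
Canonical prod_encType (X Y : encType) :=
  @EncType (X * Y) (fun p => Branch (enc p.1) (enc p.2)).
Canonical seq_encType (X : encType) :=
  @EncType (seq X) (foldr (fun a t => Branch (enc a) t) Leaf).

Lemma sz_pair (X Y : encType) (p : X * Y) :
  sz p = (sz p.1 + sz p.2).+1.
Proof. by []. Qed.

Lemma sz_cons (X : encType) (a : X) l : sz (a :: l) = (sz a + sz l).+1.
Proof. by []. Qed.

Lemma sz_nat (n : nat) : sz n = n.*2.+1.
Proof.
rewrite /sz /=; elim: n => //= n ->.
by rewrite doubleS.
Qed.

Lemma sz_bool (b : bool) : sz b <= 3.
Proof. by case: b. Qed.

Lemma sz_gt0 (X : encType) (x : X) : 0 < sz x.
Proof. exact: tsize_gt0. Qed.

Lemma sz_cat (X : encType) (l l' : seq X) : (sz (l ++ l')).+1 = sz l + sz l'.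
Proof. by elim: l => //= a l IH; rewrite !sz_cons addSn -addnA -IH; lia. Qed.

Lemma size_sz (X : encType) (l : seq X) : size l <= sz l.
Proof. by elim: l => //= a l IH; rewrite sz_cons; lia. Qed.

Lemma sz_seq_le (X : encType) (l : seq X) m :
  all (fun a => sz a <= m) l -> sz l <= (m + 1) * size l + 1.
Proof.
elim: l => [|a l IH] /=; first by rewrite muln0.
by move=> /andP[am /IH]; rewrite sz_cons mulnS; lia.
Qed.

Section Basics.
Context {X : encType}.

Lemma pt_const (Y : encType) (y : Y) : pt (fun _ : X => y).
Proof.
have H (t : tree) : pt (fun _ : X => t).
  elim: t => [|a IHa b IHb]; first exact: pt_tnil.
  exact: (pt_tcons _ IHa IHb).
exact: (pt_recode _ (H (enc y))).
Qed.

Lemma pt_pair (Y Z : encType) (f : X -> Y) (g : X -> Z) :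
  pt f -> pt g -> pt (fun x => (f x, g x)).
Proof. exact: pt_tcons. Qed.

Lemma pt_fst (Y Z : encType) (f : X -> Y * Z) :
  pt f -> pt (fun x => (f x).1).
Proof. by apply: pt_comp; exact: pt_thd. Qed.

Lemma pt_snd (Y Z : encType) (f : X -> Y * Z) :
  pt f -> pt (fun x => (f x).2).
Proof. by apply: pt_comp; exact: pt_ttl. Qed.

Lemma pt_if (Y : encType) (b : X -> bool) (f g : X -> Y) :
  pt b -> pt f -> pt g -> pt (fun x => if b x then f x else g x).
Proof. by apply: pt_tif => x; case: (b x). Qed.

Lemma pt_cons (Y : encType) (f : X -> Y) (g : X -> seq Y) :
  pt f -> pt g -> pt (fun x => f x :: g x).
Proof. exact: pt_tcons. Qed.

Lemma pt_behead (Y : encType) (f : X -> seq Y) :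
  pt f -> pt (fun x => behead (f x)).
Proof. by apply: pt_comp; apply: pt_ttl => -[|a l]. Qed.

Lemma pt_head (Y : encType) (d : X -> Y) (f : X -> seq Y) :
  pt d -> pt f -> pt (fun x => head (d x) (f x)).
Proof.
move=> pd pf.
apply: (@pt_recode _ _ _
  (fun x => if f x is a :: _ then enc a else enc (d x))).
  by move=> x; case: (f x).
apply: (@pt_tif _ _ _ f (fun x => thd (enc (f x))) (fun x => enc (d x))) => //.
- by move=> x; case: (f x).
- apply: (@pt_comp _ _ _ (fun y => thd (enc y))) => //; exact: pt_thd.
Qed.

Lemma pt_nilb (Y : encType) (f : X -> seq Y) :
  pt f -> pt (fun x => nilp (f x)).
Proof.
move=> pf; apply: (@pt_tif _ _ _ f (fun=> false) (fun=> true)) => //.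
- by move=> x; case: (f x).
- exact: pt_const.
- exact: pt_const.
Qed.

Lemma pt_negb (f : X -> bool) : pt f -> pt (fun x => ~~ f x).
Proof.
move=> pf; apply: (@pt_tif _ _ _ f (fun=> false) (fun=> true)) => //.
- by move=> x; case: (f x).
- exact: pt_const.
- exact: pt_const.
Qed.

Lemma pt_andb (f g : X -> bool) : pt f -> pt g -> pt (fun x => f x && g x).
Proof. by move=> pf pg; apply: pt_if => //; exact: pt_const. Qed.

Lemma pt_orb (f g : X -> bool) : pt f -> pt g -> pt (fun x => f x || g x).
Proof. by move=> pf pg; apply: pt_if => //; exact: pt_const. Qed.

Lemma pt_implyb (f g : X -> bool) : pt f -> pt g -> pt (fun x => f x ==> g x).
Proof. by move=> pf pg; apply: pt_if => //; exact: pt_const. Qed.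

Lemma pt_succn (f : X -> nat) : pt f -> pt (fun x => (f x).+1).
Proof. by move=> pf; apply: (@pt_tcons _ _ _ _ (fun=> tt) f) => //; exact: pt_const. Qed.

Lemma pt_predn (f : X -> nat) : pt f -> pt (fun x => (f x).-1).
Proof. by apply: pt_comp; apply: pt_ttl => -[|n]. Qed.

Lemma pt_eqn0 (f : X -> nat) : pt f -> pt (fun x => f x == 0).
Proof.
move=> pf; apply: (@pt_tif _ _ _ f (fun=> false) (fun=> true)) => //.
- by move=> x; case: (f x).
- exact: pt_const.
- exact: pt_const.
Qed.

Lemma pt_nseq_tt (f : X -> nat) : pt f -> pt (fun x => nseq (f x) tt).
Proof. by apply: pt_recode => x; elim: (f x) => //= n ->. Qed.

Lemma pt_size_unit (f : X -> seq unit) : pt f -> pt (fun x => size (f x)).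
Proof. by apply: pt_recode => x; elim: (f x) => //= a l=> ->. Qed.

Lemma pt_bool_nat (f : X -> bool) : pt f -> pt (fun x => f x : nat).
Proof. by apply: pt_recode => x; case: (f x). Qed.

End Basics.

Lemma pt_app2 (X Y Z W : encType) (h : Y -> Z -> W) (f : X -> Y) (g : X -> Z) :
  pt (fun p : Y * Z => h p.1 p.2) -> pt f -> pt g -> pt (fun x => h (f x) (g x)).
Proof. by move=> ph pf pg; exact: (pt_comp ph (pt_pair pf pg)). Qed.

Lemma pt_app3 (X Y Z W V : encType) (h : Y -> Z -> W -> V) (f : X -> Y)
    (g : X -> Z) (k : X -> W) :
  pt (fun p : Y * Z * W => h p.1.1 p.1.2 p.2) -> pt f -> pt g -> pt k ->
  pt (fun x => h (f x) (g x) (k x)).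
Proof. by move=> ph pf pg pk; exact: (pt_comp ph (pt_pair (pt_pair pf pg) pk)). Qed.

(** The fold is a while loop whose state has the remaining list as its head, so the loop test
    detects the end of the list. Intermediate accumulators are folds over prefixes, which the size
    hypothesis covers because it speaks of all lists. *)
Lemma pt_foldl_raw (X E S : encType)
    (l : X -> seq E) (i : X -> S) (step : X -> S -> E -> S) :
  pt l -> pt i -> pt (fun p : X * S * E => step p.1.1 p.1.2 p.2) ->
  (exists k, forall x s l,
     sz (foldl (step x) s l) <= (sz x + sz s + sz l + 2) ^ k) ->
  pt (fun x => foldl (step x) (i x) (l x)).
Proof.
move=> pl pi ps [k bd].
(* The loop body needs a default element for [head]. If there is none, all lists are empty and the
   fold returns its initial value. *)
have [[e0 _]|noE] := EM (exists e : E, True); last first.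
  suff -> : (fun x => foldl (step x) (i x) (l x)) = i by [].
  by apply: funext => x; case: (l x) => // e; case: noE; exists e.
pose body (t : seq E * (S * X)) :=
  (behead t.1, (step t.2.2 t.2.1 (head e0 t.1), t.2.2)).
have pb : pt body.
  apply: pt_pair; first by apply: pt_behead; apply: pt_fst; exact: pt_id.
  apply: pt_pair; last by do 2! apply: pt_snd; exact: pt_id.
  apply: (pt_app3 ps).
  - by do 2! apply: pt_snd; exact: pt_id.
  - by apply: pt_fst; apply: pt_snd; exact: pt_id.
  - by apply: pt_head; [exact: pt_const|apply: pt_fst; exact: pt_id].
have iterE n t : n <= size t.1 -> iter n body t =
    (drop n t.1, (foldl (step t.2.2) t.2.1 (take n t.1), t.2.2)).
  move: t => [u [s x]] /=; elim: n => [|n IH] lt_n /=; first by rewrite drop0 take0.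
  rewrite IH 1?ltnW // /body /= (take_nth e0) // -cats1 foldl_cat /=.
  by rewrite -nth0 nth_drop addn0 -drop1 drop_drop addnC addn1.
have pw : pt (fun t => iter (size t.1) body t).
  apply: pt_while => //.
  - move=> t j lt_j; rewrite iterE 1?ltnW //.
    by rewrite (drop_nth e0).
  - by move=> t; rewrite iterE // drop_size.
  - apply: pbounded_le (pbounded_size _) => t; rewrite sz_pair.
    by apply: leq_trans (size_sz _) _; lia.
  - exists (fun t => sz t + ((sz t + sz t + sz t + 2) ^ k + sz t) + 2); first by pbd.
    move=> [u [s x]] j le_j; rewrite iterE //= !sz_pair /=.
    have := bd x s (take j u).
    have := sz_cat (take j u) (drop j u); rewrite cat_take_drop.
    have := sz_gt0 (take j u); have := sz_gt0 (drop j u).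
    move: (sz (take j u)) (sz (drop j u)) => c d d0 c0 cd bt.
    have := leq_trans bt (@leq_exp2rW (sz x + sz s + c + 2) ((sz u + (sz s + sz x).+1).+1 +
      (sz u + (sz s + sz x).+1).+1 + (sz u + (sz s + sz x).+1).+1 + 2) k
      ltac:(lia)).
    by move: (_ ^ k) => q; lia.
have := pt_fst (pt_snd (pt_comp pw (pt_pair pl (pt_pair pi pt_id)))).
by apply: pt_recode => x /=; rewrite iterE //= take_size.
Qed.

(** The increment of the measure may depend on the parameter and on the list element but not on the
    accumulator. This rules out repeated squaring and makes the final measure at most linear in the
    number of rounds. *)
Lemma pt_foldl (X E S : encType) (mu : X -> S -> nat)
    (l : X -> seq E) (i : X -> S) (step : X -> S -> E -> S) :
  pt l -> pt i -> pt (fun p : X * S * E => step p.1.1 p.1.2 p.2) ->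
  (exists k, forall x s, sz s <= (sz x + mu x s + 2) ^ k) ->
  (exists k, forall x s, mu x s <= (sz x + sz s + 2) ^ k) ->
  (exists k, forall x s e, mu x (step x s e) <= mu x s + (sz x + sz e + 2) ^ k) ->
  pt (fun x => foldl (step x) (i x) (l x)).
Proof.
move=> pl pi ps [a ha] [b hb] [c hc]; apply: pt_foldl_raw => //.
pose u (t : X * S * seq E) := sz t.1.1 + sz t.1.2 + sz t.2.
have [k hk] : pbounded u (fun t => (u t +
    ((u t + 2) ^ b + u t * (u t + 2) ^ c) + 2) ^ a).
  by pbd; exact: pbounded_size.
exists k => x s t; apply: leq_trans (hk (x, s, t)); apply: leq_trans (ha x _) _.
apply: leq_exp2rW; rewrite leq_add2r; apply: leq_add.
  by rewrite /u /=; lia.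
have le_t : size t <= u (x, s, t) by apply: leq_trans (size_sz _) _; rewrite /u /=; lia.
apply: (@leq_trans (mu x s + size t * (u (x, s, t) + 2) ^ c)); last first.
  apply: leq_add; last by rewrite leq_mul2r le_t orbT.
  by apply: leq_trans (hb _ _) _; apply: leq_exp2rW; rewrite /u /=; lia.
have : sz x + sz t <= u (x, s, t) by rewrite /u /=; lia.
move: (u _) => m {le_t}; elim: t s => [|e t IH] s le_m /=; first by rewrite mul0n; lia.
rewrite sz_cons in le_m; apply: leq_trans (IH _ _) _; first by lia.
rewrite mulSn addnA leq_add2r; apply: leq_trans (hc _ _ _) _.
by rewrite leq_add2l; apply: leq_exp2rW; lia.
Qed.

Lemma pt_foldl_sz (X E S : encType)
    (l : X -> seq E) (i : X -> S) (step : X -> S -> E -> S) :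
  pt l -> pt i -> pt (fun p : X * S * E => step p.1.1 p.1.2 p.2) ->
  (exists k, forall x s e, sz (step x s e) <= sz s + (sz x + sz e + 2) ^ k) ->
  pt (fun x => foldl (step x) (i x) (l x)).
Proof.
move=> pl pi ps H; apply: (pt_foldl (mu := fun _ => sz)) => //.
- by exists 1 => x s; rewrite expn1; lia.
- by exists 1 => x s; rewrite expn1; lia.
Qed.

Ltac pbk K := exists K => *; rewrite ?expn1; try lia.

Section Lists.
Context {X Y Z : encType}.

Lemma pt_rev (f : X -> seq Y) : pt f -> pt (fun x => rev (f x)).
Proof.
move=> pf; suff : pt (fun x => foldl (fun u a => a :: u) [::] (f x)).
  by apply: pt_recode => x; rewrite foldl_cons cats0.
apply: (pt_foldl_sz (step := fun _ u a => a :: u)) => //; first exact: pt_const.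
- by apply: pt_cons; [apply: pt_snd|apply: pt_snd; apply: pt_fst]; exact: pt_id.
- by pbk 1; rewrite sz_cons; lia.
Qed.

Lemma pt_cat (f g : X -> seq Y) : pt f -> pt g -> pt (fun x => f x ++ g x).
Proof.
move=> pf pg.
suff : pt (fun x => foldl (fun u a => a :: u) (g x) (rev (f x))).
  by apply: pt_recode => x; rewrite foldl_cons revK.
apply: (pt_foldl_sz (step := fun _ u a => a :: u)) => //; first exact: pt_rev.
- by apply: pt_cons; [apply: pt_snd|apply: pt_snd; apply: pt_fst]; exact: pt_id.
- by pbk 1; rewrite sz_cons; lia.
Qed.

Lemma pt_map (l : X -> seq Y) (g : X -> Y -> Z) :
  pt l -> pt (fun p : X * Y => g p.1 p.2) -> pt (fun x => map (g x) (l x)).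
Proof.
move=> pl pg.
suff : pt (fun x => foldl (fun u a => g x a :: u) [::] (rev (l x))).
  apply: pt_recode => x; congr enc; rewrite -[l x in RHS]revK.
  elim/last_ind: (rev (l x)) => //= s a IH.
  by rewrite rev_rcons /= -IH -cats1 foldl_cat.
apply: (pt_foldl_sz (step := fun x u a => g x a :: u)).
- exact: pt_rev.
- exact: pt_const.
- apply: pt_cons; last by apply: pt_snd; apply: pt_fst; exact: pt_id.
  by apply: (pt_app2 pg);
    [do 2! apply: pt_fst|apply: pt_snd]; exact: pt_id.
- have [k hk] : pbounded (fun p : X * Y => sz p.1 + sz p.2)
      (fun p => 1 + sz (g p.1 p.2)).
    pbd; apply: (pbounded_comp (pt_size pg)); exists 1 => p.
    by rewrite expn1 sz_pair; lia.
  exists k => x s a; rewrite sz_cons; have := hk (x, a); rewrite /=; lia.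
Qed.

Lemma pt_filter (l : X -> seq Y) (g : X -> Y -> bool) :
  pt l -> pt (fun p : X * Y => g p.1 p.2) -> pt (fun x => filter (g x) (l x)).
Proof.
move=> pl pg.
suff : pt (fun x => foldl (fun u a => if g x a then a :: u else u) [::] (rev (l x))).
  apply: pt_recode => x; congr enc; rewrite -[l x in RHS]revK.
  elim/last_ind: (rev (l x)) => //= s a IH.
  by rewrite rev_rcons /= -IH -cats1 foldl_cat.
have ps : pt (fun p : X * seq Y * Y => p.1.2).
  by apply: pt_snd; apply: pt_fst; exact: pt_id.
apply: (pt_foldl_sz (step := fun x u a => if g x a then a :: u else u)).
- exact: pt_rev.
- exact: pt_const.
- apply: pt_if => //; last by apply: pt_cons => //; apply: pt_snd; exact: pt_id.
  by apply: (pt_app2 pg);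
    [do 2! apply: pt_fst|apply: pt_snd]; exact: pt_id.
- by pbk 1; case: ifP; rewrite ?sz_cons; lia.
Qed.

End Lists.

Section Lists2.
Context {X Y Z : encType}.

Lemma pt_flatten (f : X -> seq (seq Y)) : pt f -> pt (fun x => flatten (f x)).
Proof.
move=> pf; suff : pt (fun x => foldl (fun u a => u ++ a) [::] (f x)).
  apply: pt_recode => x; congr enc; elim/last_ind: (f x) => //= s a IH.
  by rewrite flatten_rcons -IH -cats1 foldl_cat.
apply: (pt_foldl_sz (step := fun _ u a => u ++ a)) => //; first exact: pt_const.
- by apply: pt_cat; [apply: pt_snd; apply: pt_fst|apply: pt_snd]; exact: pt_id.
- by pbk 1; rewrite -ltnS sz_cat; lia.
Qed.

Lemma pt_size_seq (f : X -> seq Y) : pt f -> pt (fun x => size (f x)).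
Proof.
move=> pf; suff : pt (fun x => size (map (fun _ => tt) (f x))).
  by apply: pt_recode => x; rewrite size_map.
by apply: pt_size_unit; apply: pt_map => //; exact: pt_const.
Qed.

Lemma pt_all (l : X -> seq Y) (g : X -> Y -> bool) :
  pt l -> pt (fun p : X * Y => g p.1 p.2) -> pt (fun x => all (g x) (l x)).
Proof.
move=> pl pg; suff : pt (fun x => nilp (filter (fun a => ~~ g x a) (l x))).
  apply: pt_recode => x; congr enc.
  by rewrite /nilp size_filter eqn0Ngt -has_count has_predC negbK.
by apply: pt_nilb; apply: pt_filter => //; exact: pt_negb.
Qed.

Lemma pt_has (l : X -> seq Y) (g : X -> Y -> bool) :
  pt l -> pt (fun p : X * Y => g p.1 p.2) -> pt (fun x => has (g x) (l x)).
Proof.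
move=> pl pg; suff : pt (fun x => ~~ nilp (filter (g x) (l x))).
  apply: pt_recode => x; congr enc.
  by rewrite /nilp size_filter eqn0Ngt -has_count negbK.
by apply: pt_negb; apply: pt_nilb; apply: pt_filter.
Qed.

Lemma pt_addn (f g : X -> nat) : pt f -> pt g -> pt (fun x => f x + g x).
Proof.
move=> pf pg; suff : pt (fun x => size (nseq (f x) tt ++ nseq (g x) tt)).
  by apply: pt_recode => x; rewrite size_cat !size_nseq.
by apply: pt_size_unit; apply: pt_cat; exact: pt_nseq_tt.
Qed.

Lemma pt_nseq (n : X -> nat) (f : X -> Y) :
  pt n -> pt f -> pt (fun x => nseq (n x) (f x)).
Proof.
move=> pn pf; suff : pt (fun x => map (fun _ => f x) (nseq (n x) tt)).
  by apply: pt_recode => x; rewrite map_nseq.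
apply: pt_map; first exact: pt_nseq_tt.
by apply: (pt_comp pf); apply: pt_fst; exact: pt_id.
Qed.

Lemma pt_drop (n : X -> nat) (f : X -> seq Y) :
  pt n -> pt f -> pt (fun x => drop (n x) (f x)).
Proof.
move=> pn pf; suff : pt (fun x => foldl (fun u _ => behead u) (f x) (nseq (n x) tt)).
  apply: pt_recode => x; congr enc.
  by elim: (n x) (f x) => [|m IH] [|a l] //=; rewrite ?drop0 ?IH.
apply: (pt_foldl_sz (step := fun _ u _ => behead u)) => //; first exact: pt_nseq_tt.
- by apply: pt_behead; apply: pt_snd; apply: pt_fst; exact: pt_id.
- by exists 1 => x [|a s] e; rewrite expn1 /= ?sz_cons; lia.
Qed.

Lemma pt_nth (d : X -> Y) (n : X -> nat) (f : X -> seq Y) :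
  pt d -> pt n -> pt f -> pt (fun x => nth (d x) (f x) (n x)).
Proof.
move=> pd pn pf; suff : pt (fun x => head (d x) (drop (n x) (f x))).
  by apply: pt_recode => x; rewrite -nth0 nth_drop addn0.
by apply: pt_head => //; exact: pt_drop.
Qed.

Lemma pt_subn (f g : X -> nat) : pt f -> pt g -> pt (fun x => f x - g x).
Proof.
move=> pf pg; suff : pt (fun x => foldl (fun u _ => u.-1) (f x) (nseq (g x) tt)).
  apply: pt_recode => x; congr enc.
  by elim: (g x) (f x) => [|m IH] n /=; rewrite ?subn0 // IH subnS -subn1 subnAC subn1.
apply: (pt_foldl_sz (step := fun _ u _ => u.-1)) => //; first exact: pt_nseq_tt.
- by apply: pt_predn; apply: pt_snd; apply: pt_fst; exact: pt_id.
- by pbk 1; rewrite !sz_nat; lia.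
Qed.

Lemma pt_leq (f g : X -> nat) : pt f -> pt g -> pt (fun x => f x <= g x).
Proof. by move=> pf pg; apply: pt_eqn0; exact: pt_subn. Qed.

Lemma pt_eqn (f g : X -> nat) : pt f -> pt g -> pt (fun x => f x == g x).
Proof.
move=> pf pg; suff : pt (fun x => (f x <= g x) && (g x <= f x)).
  by apply: pt_recode => x; rewrite -eqn_leq.
by apply: pt_andb; exact: pt_leq.
Qed.

Lemma pt_eqb (f g : X -> bool) : pt f -> pt g -> pt (fun x => f x == g x).
Proof.
move=> pf pg; suff : pt (fun x => (f x : nat) == (g x : nat)).
  by apply: pt_recode => x; case: (f x); case: (g x).
by apply: pt_eqn; exact: pt_bool_nat.
Qed.

End Lists2.

Section Lists3.
Context {X : encType}.

Lemma pt_sumn (f : X -> seq nat) : pt f -> pt (fun x => sumn (f x)).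
Proof.
move=> pf; suff : pt (fun x => foldl (fun u a => u + a) 0 (f x)).
  apply: pt_recode => x; congr enc; rewrite -[RHS]add0n.
  by elim: (f x) 0 => [|a l IH] n /=; rewrite ?addn0 // IH addnA.
apply: (pt_foldl_sz (step := fun _ u a => u + a)) => //; first exact: pt_const.
- by apply: pt_addn; [apply: pt_snd; apply: pt_fst|apply: pt_snd]; exact: pt_id.
- by pbk 1; rewrite !sz_nat; lia.
Qed.

(** Each round stores a copy of the counter, which belongs to the accumulator, so the additive
    criterion does not fit; the growth is quadratic and is bounded directly. *)
Lemma pt_iota (m n : X -> nat) : pt m -> pt n -> pt (fun x => iota (m x) (n x)).
Proof.
move=> pm pn; suff : pt (fun x => (foldl
    (fun u _ => (u.1.+1, u.1 :: u.2)) (m x, [::]) (nseq (n x) tt)).2).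
  move/pt_rev; apply: pt_recode => x; congr enc.
  suff H k i s : foldl (fun u _ => (u.1.+1, u.1 :: u.2)) (i, s) (nseq k tt) =
      (i + k, rev (iota i k) ++ s) by rewrite H /= cats0 revK.
  elim: k i s => [|k IH] i s /=; first by rewrite addn0.
  by rewrite IH addSnnS rev_cons cat_rcons.
apply: pt_snd.
apply: (pt_foldl_raw (step := fun _ u _ => (u.1.+1, u.1 :: u.2))).
- exact: pt_nseq_tt.
- by apply: pt_pair => //; exact: pt_const.
- have p1 : pt (fun p : X * (nat * seq nat) * unit => p.1.2).
    by apply: pt_snd; apply: pt_fst; exact: pt_id.
  apply: pt_pair; first by apply: pt_succn; exact: pt_fst.
  by apply: pt_cons; [exact: pt_fst|exact: pt_snd].
- have H (l : seq unit) (i : nat) (s : seq nat) :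
      sz (foldl (fun u _ => (u.1.+1, u.1 :: u.2)) (i, s) l) <=
      sz s + (i + size l).*2.+2 + size l * ((i + size l).*2.+3).
    elim: l i s => [|a l IH] i s; first by rewrite sz_pair /= sz_nat; lia.
    apply: leq_trans (IH _ _) _; rewrite /= sz_cons sz_nat [i.+1 + _]addSnnS mulSn.
    by move: (size l * _) => q; lia.
  exists 3 => x [i s] l; apply: leq_trans (H l i s) _; rewrite sz_pair /= sz_nat.
  have := size_sz l; move: (sz x) (sz s) (sz l) (size l) => a b c d le_d.
  set q := _ + 2; have q4 : 4 <= q by rewrite /q; lia.
  have h1 : d * (i + d).*2.+3 <= q * (2 * q) by apply: leq_mul; rewrite /q; lia.
  have h2 : q * (4 * q) <= q ^ 3 by rewrite !expnS expn0 muln1 !leq_mul.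
  have h3 : q * (4 * q) = q * (2 * q) + q * (2 * q) by lia.
  have h4 : 8 * q <= q * (2 * q) by rewrite mulnC leq_mul2l; lia.
  by apply: leq_trans h2; rewrite h3 /q in h1 h4 *; lia.
Qed.

End Lists3.

Lemma pt_muln (X : encType) (f g : X -> nat) :
  pt f -> pt g -> pt (fun x => f x * g x).
Proof.
move=> pf pg; suff : pt (fun x => sumn (nseq (g x) (f x))).
  by apply: pt_recode => x; rewrite sumn_nseq.
by apply: pt_sumn; exact: pt_nseq.
Qed.

End PolytimeFunctions.
Import PolytimeFunctions.

(** * Input and output of words, binary arithmetic, and decoding *)

Module BinaryNumbers.
Import boolp.
Section InputOutput.
Variables (A B : finType) (ca : A -> nat) (bs : seq B) (b0 : B).
Local Notation chart := (chart A B).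
Local Notation bit b := (inr b : sym A B).

Definition push_word (l : seq (sym A B)) : chart :=
  foldr (fun a M => seq_chart M (push_chart s_main a)) (skip_chart A B) l.

Lemma exec_push_word l i m a a' c f o :
  exec (push_word l) [:: i; m; a; a'; c; f; o] [:: i; l ++ m; a; a'; c; f; o]
    (size l).
Proof.
elim: l => [|b l IH] /=; first exact: exec_skip.
by rewrite -addn1; apply: exec_seq IH (exec_push _ _ _ _).
Qed.

(** The code of a list ends with the code of the empty list, so it is built from the last letter
    backwards; hence the initial reversal of the input. *)
Definition read_chart : chart :=
  seq_chart (pour A B s_in s_aux) (seq_chart (push_chart s_main (bit false))
    (loop_chart s_aux (fun s => if s is inl (inl a) then
       push_word (bit true :: tcode A B (enc (ca a))) else skip_chart A B))).

Lemma exec_read : exists C, forall x,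
  exec read_chart (chart_input B x) (idle (tcode A B (enc (map ca x))))
    (C * size x + C).
Proof.
pose n := \max_a size (bit true :: tcode A B (enc (ca a))).
exists (n + 10) => x.
have E1 := @exec_loop_each A B _ s_in (fun a => push_chart s_aux a)
  (fun l t => [:: l; [::]; t; [::]; [::]; [::]; [::]]) (fun t a => a :: t) 1
  (fun _ _ => erefl) (fun _ _ _ => exec_push _ _ _ _)
  [seq inl (inl a) | a <- x] [::].
rewrite foldl_cons cats0 in E1.
pose g (t : seq (sym A B)) (s : sym A B) := if s is inl (inl a) then
  (bit true :: tcode A B (enc (ca a))) ++ t else t.
pose y : seq (sym A B) := rev [seq inl (inl a) | a <- x].
have E2 : exec (loop_chart s_aux (fun s => if s is inl (inl a) then
       push_word (bit true :: tcode A B (enc (ca a))) else skip_chart A B))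
     (work [:: bit false] y [::] [::] [::])
     (work (foldl g [:: bit false] y) [::] [::] [::] [::]) (n.+1 * size y + 1).
  apply: (exec_loop_each (C := fun l t => work t l [::] [::] [::])) => //.
  move=> s l t; case: s => [[a|b]|b] /=; try exact: exec_skip.
  apply: execW (@exec_push_word (bit true :: tcode A B (enc (ca a))) _ _ _ _ _ _ _).
  exact: (leq_bigmax (F := fun a => size (bit true :: tcode A B (enc (ca a))))).
have gE : foldl g [:: bit false] y = tcode A B (enc (map ca x)).
  rewrite foldl_rev; elim: x {E1 E2 y} => //= a x ->.
  by rewrite -[RHS]/(bit true :: [seq bit b | b <- _ ++ _]) map_cat.
rewrite gE in E2.
apply: execW (exec_seq E1 (exec_seq (exec_push s_main (bit false)
  (work [::] y [::] [::] [::]) 0) E2)).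
by rewrite size_rev size_map; lia.
Qed.

(** A unary index below the alphabet size is decoded by walking through the alphabet. The recursion
    unfolds when the chart is built, so the running time is a constant. The flag pushed at the end
    keeps the loop of [emit_chart] alive. *)
Fixpoint decode_chart (fuel i : nat) : chart :=
  if fuel is fuel'.+1 then
    switch_chart s_main (fun x => match x with
      | Some (inr true) => switch_chart s_main (fun _ => decode_chart fuel' i.+1)
      | _ => seq_chart (push_chart s_aux (inl (inr (nth b0 bs i))))
               (push_chart s_fl (bit true))
      end)
  else skip_chart A B.

Lemma exec_decode fuel i n r a : n < fuel ->
  exec (decode_chart fuel i) (work (tcode A B (enc n) ++ r) a [::] [::] [::])
    (work r (inl (inr (nth b0 bs (i + n))) :: a) [::] [::] [:: bit true])
    (fuel.*2 + 1).
Proof.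
elim: fuel i n => // fuel IH i [|n] lt_n.
  have -> : fuel.+1.*2 + 1 = (fuel.*2 + 1 + 1).+1 by lia.
  apply: exec_switch => /=; rewrite addn0.
  by apply: (@exec_seq _ _ _ _ _ _ _ (fuel.*2 + 1) 1); rewrite ?addn1; exact: exec_push.
have -> : fuel.+1.*2 + 1 = (fuel.*2 + 1).+2 by lia.
apply: exec_switch; apply: exec_switch => /=.
by rewrite -addSnnS; apply: IH.
Qed.

Definition emit_chart : chart :=
  loop_chart s_fl (fun _ => switch_chart s_main (fun x =>
    if x is Some (inr true) then decode_chart (size bs) 0 else skip_chart A B)).

Lemma exec_emit (l : seq nat) r a : all (fun i => i < size bs) l ->
  exec emit_chart (work (tcode A B (enc l) ++ r) a [::] [::] [:: bit true])
    (work r (rev [seq inl (inr (nth b0 bs i)) | i <- l] ++ a) [::] [::] [::])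
    ((size l).+1 * ((size bs).*2 + 3) + 2).
Proof.
elim: l a => [|i l IH] a /=.
  move=> _; have -> : 1 * ((size bs).*2 + 3) + 2 = (((size bs).*2 + 3) + 1).+1 by lia.
  apply: (@exec_loopS _ _ _ _ _ _ _ _ _ _ 1); [by []| |exact: exec_loop0].
  by rewrite addnS; apply: exec_switch; exact: exec_skip.
move=> /andP[lt_i /IH{}IH].
have -> : (size l).+2 * ((size bs).*2 + 3) + 2 = ((size bs).*2 + 1).+1 +
  ((size l).+1 * ((size bs).*2 + 3) + 2).+1 by lia.
rewrite addnS; apply: exec_loopS => //=.
  apply: exec_switch => /=; rewrite map_cat -catA.
  by apply: (@exec_decode _ 0); exact: lt_i.
have := IH (inl (inr (nth b0 bs (0 + i))) :: a); rewrite rev_cons cat_rcons add0n.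
by apply: execW; lia.
Qed.

(** The letters are numbered by [ca] and [bs], so that all work between reading and writing takes
    place on lists of numbers, whatever the alphabets. *)
Lemma polytime_of_pt (g : seq nat -> seq nat) (f : seq A -> seq B) :
  pt g -> (forall x, f x = map (nth b0 bs) (g (map ca x))) ->
  (forall x, all (fun i => i < size bs) (g (map ca x))) -> polytime f.
Proof.
move=> [sg H] fE gb; have [M [t [ptt Mg]]] := H A B.
have [C rd] := exec_read.
pose time (x : seq A) := (C * size x + C) + (t (map ca x) + (1 +
  (((size (g (map ca x)) + 1) * ((size bs).*2 + 3) + 2) +
   (2 * size (g (map ca x)) + 1)))).
have [k kP] : pbounded size time.
  have pin : pbounded size (fun x : seq A => sz (map ca x)).
    apply: (@pbounded_le _ _ _ (fun x => (sz (\max_a ca a) + 1) * size x + 1)); last by pbd.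
    move=> x; apply: leq_trans (@sz_seq_le _ _ (sz (\max_a ca a)) _) _; last by rewrite size_map.
    apply/allP => _ /mapP[a _ ->]; rewrite !sz_nat ltnS leq_double.
    exact: leq_bigmax.
  have pg : pbounded size (fun x : seq A => size (g (map ca x))).
    apply: (@pbounded_le _ _ _ (fun x => sz (g (map ca x)))).
      by move=> x; exact: size_sz.
    exact: (pbounded_comp sg).
  rewrite /time; pbd.
  exact: (pbounded_comp ptt).
apply: (@polytime_of_chart _ _ (seq_chart read_chart (seq_chart M (seq_chart
  (push_chart s_fl (bit true)) (seq_chart emit_chart
  (pour A B s_aux s_out))))) _ k) => x.
set l := g (map ca x) in time kP *.
have E3 := @exec_emit l [::] [::] (gb x).
have E4 := @exec_loop_each A B _ s_aux (fun a => push_chart s_out a)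
  (fun l t => [:: [::]; [::]; l; [::]; [::]; [::]; t]) (fun t a => a :: t) 1
  (fun _ _ => erefl) (fun _ _ _ => exec_push _ _ _ _)
  (rev [seq inl (inr (nth b0 bs i)) | i <- l]) [::].
rewrite foldl_cons revK cats0 in E4; rewrite cats0 in E3.
have E2 := Mg (map ca x) [::]; rewrite !cats0 in E2 E3.
exists [:: [::]; [::]; [::]; [::]; [::]; [::];
    [seq inl (inr (nth b0 bs i)) | i <- l]]; last first.
  by rewrite fE -map_comp.
apply: execW (exec_seq (rd x) (exec_seq E2 (exec_seq
  (exec_push s_fl (bit true) (idle (tcode A B (enc l))) 0) (exec_seq E3 E4)))).
by apply: leq_trans (kP x); rewrite /time size_rev size_map -/l; lia.
Qed.

End InputOutput.

Lemma pt_branch (X : encType) (f g : X -> tree) :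
  pt f -> pt g -> pt (fun x => Branch (f x) (g x)).
Proof. exact: pt_tcons. Qed.

(** A hook for [pt_solve], redefined whenever further operations have been shown to be
    polynomial-time. *)
Ltac pt_ext := fail.

Ltac pt1 := lazymatch goal with
  | |- pt (fun x => x) => exact: pt_id
  | |- pt (fun x => (@?f x, @?g x)) => apply: pt_pair
  | |- pt (fun x => fst (@?f x)) => apply: pt_fst
  | |- pt (fun x => snd (@?f x)) => apply: pt_snd
  | |- pt (fun x => andb (@?f x) (@?g x)) => apply: pt_andb
  | |- pt (fun x => orb (@?f x) (@?g x)) => apply: pt_orb
  | |- pt (fun x => implb (@?f x) (@?g x)) => apply: pt_implyb
  | |- pt (fun x => negb (@?f x)) => apply: pt_negb
  | |- pt (fun x => cons (@?f x) (@?g x)) => apply: pt_cons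
  | |- pt (fun x => cat (@?f x) (@?g x)) => apply: pt_cat
  | |- pt (fun x => rev (@?f x)) => apply: pt_rev
  | |- pt (fun x => behead (@?f x)) => apply: pt_behead
  | |- pt (fun x => head (@?d x) (@?f x)) => apply: pt_head
  | |- pt (fun x => nilp (@?f x)) => apply: pt_nilb
  | |- pt (fun x => map (@?g x) (@?f x)) => apply: pt_map
  | |- pt (fun x => filter (@?g x) (@?f x)) => apply: pt_filter
  | |- pt (fun x => all (@?g x) (@?f x)) => apply: pt_all
  | |- pt (fun x => has (@?g x) (@?f x)) => apply: pt_has
  | |- pt (fun x => flatten (@?f x)) => apply: pt_flatten
  | |- pt (fun x => size (@?f x)) => apply: pt_size_seq
  | |- pt (fun x => nseq (@?f x) (@?g x)) => apply: pt_nseq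
  | |- pt (fun x => iota (@?f x) (@?g x)) => apply: pt_iota
  | |- pt (fun x => nth (@?d x) (@?f x) (@?g x)) => apply: pt_nth
  | |- pt (fun x => drop (@?f x) (@?g x)) => apply: pt_drop
  | |- pt (fun x => sumn (@?f x)) => apply: pt_sumn
  | |- pt (fun x => addn (@?f x) (@?g x)) => apply: pt_addn
  | |- pt (fun x => subn (@?f x) (@?g x)) => apply: pt_subn
  | |- pt (fun x => muln (@?f x) (@?g x)) => apply: pt_muln
  | |- pt (fun x => leq (@?f x) (@?g x)) => apply: pt_leq
  | |- pt (fun x => S (@?f x)) => apply: pt_succn
  | |- pt (fun x => predn (@?f x)) => apply: pt_predn
  | |- pt (fun x => nat_of_bool (@?f x)) => apply: pt_bool_nat
  | |- pt (fun x => eq_op (@?f x) (@?g x)) => first [apply: pt_eqn | apply: pt_eqb]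
  | |- pt (fun x => Branch (@?f x) (@?g x)) => apply: pt_branch
  end.

Ltac pt_eta := lazymatch goal with |- @pt ?X ?Y ?f =>
  lazymatch f with
  | (fun _ => _) => fail
  | _ => change (@pt X Y (fun x => f x))
  end end.

Ltac pt_solve := repeat (cbv beta zeta; first
  [ assumption | exact: pt_const | pt_ext | pt1 | apply: pt_if | pt_eta ]).

(** * Binary numbers *)

Definition bitval (l : seq bool) : nat := foldr (fun (b : bool) n => b + n.*2) 0 l.
Definition bitlen (n : nat) : nat := up_log 2 n.+1.

Lemma size_binary n : size (binary n) = bitlen n.
Proof. by rewrite size_map size_iota. Qed.

Lemma ltn_bitlen n : n < 2 ^ bitlen n.
Proof. exact: up_logP. Qed.

Lemma bitlen_leq n k : n < 2 ^ k -> bitlen n <= k.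
Proof. exact: up_log_min. Qed.

Lemma leq_bitlen m n : m <= n -> bitlen m <= bitlen n.
Proof. by move=> le_mn; apply: bitlen_leq; apply: leq_ltn_trans (ltn_bitlen n). Qed.

Lemma bitlenD m n : bitlen (m + n) <= (maxn (bitlen m) (bitlen n)).+1.
Proof.
apply: bitlen_leq; rewrite expnS mul2n -addnn -addnS leq_add //.
  by apply: ltnW; apply: leq_trans (ltn_bitlen m) _; rewrite leq_exp2l // leq_maxl.
by apply: leq_trans (ltn_bitlen n) _; rewrite leq_exp2l // leq_maxr.
Qed.

Lemma bitlenM m n : bitlen (m * n) <= bitlen m + bitlen n.
Proof.
apply: bitlen_leq; rewrite expnD.
have [->|n0] := posnP n; first by rewrite muln0 muln_gt0 !expn_gt0.
by apply: ltn_mul; exact: ltn_bitlen.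
Qed.

Lemma bitlen_le n : bitlen n <= n.
Proof. by apply: bitlen_leq; exact: ltn_expl. Qed.

Lemma binaryS n : 0 < n -> binary n = odd n :: binary n./2.
Proof.
move=> n0; rewrite /binary up_log2S //= expn0 divn1; congr cons.
rewrite -[1]/(1 + 0) iotaDl -map_comp; apply: eq_map => i /=.
by rewrite expnS divnMA divn2.
Qed.

Lemma nilp_binary n : nilp (binary n) = (n == 0).
Proof. by case: n => // n; rewrite binaryS. Qed.

Lemma bitval_binary n : bitval (binary n) = n.
Proof.
elim/ltn_ind: n => -[|n] IH //; rewrite binaryS //.
by rewrite -[LHS]/(odd n.+1 + (bitval (binary n.+1./2)).*2) IH ?odd_double_half //; lia.
Qed.

Lemma nth_binary n i : nth false (binary n) i = odd (n %/ 2 ^ i).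
Proof.
have [lt_i|le_i] := ltnP i (bitlen n).
  by rewrite (nth_map 0) ?size_iota // nth_iota.
rewrite nth_default ?size_binary // divn_small //.
by apply: leq_trans (ltn_bitlen n) _; rewrite leq_exp2l.
Qed.

(** [binary] admits no leading zeros, so bit lists produced by arithmetic must be normalised: read
    from the most significant end, zeros are skipped until the first one appears. *)
Definition strip_step (u : seq bool) (b : bool) :=
  if b || ~~ nilp u then b :: u else u.

Lemma binary_bitval l : binary (bitval l) = foldl strip_step [::] (rev l).
Proof.
rewrite foldl_rev; elim: l => //= b l <-.
rewrite /strip_step nilp_binary; case: b => /=.
  by rewrite binaryS //= odd_double /= uphalf_double.
rewrite add0n; case: eqP => [-> //|/eqP n0] /=.
by rewrite binaryS ?double_gt0 ?lt0n // odd_double doubleK.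
Qed.

(** A wrapper that gives natural numbers a second, binary code next to the unary one that is
    canonical for [nat]. *)
Record bnat := Bn { nb : nat }.
Canonical bnat_encType := @EncType bnat (fun n => enc (binary (nb n))).

Lemma sz_bits (l : seq bool) : sz l <= 4 * size l + 1.
Proof.
apply: leq_trans (@sz_seq_le _ _ 3 _) _ => //.
by apply/allP => b _; exact: sz_bool.
Qed.

Lemma sz_bnat n : sz n <= 4 * bitlen (nb n) + 1.
Proof. by rewrite -size_binary; exact: sz_bits. Qed.

Lemma bitlen_sz (n : bnat) : bitlen (nb n) <= sz n.
Proof. by rewrite -size_binary; exact: (@size_sz bool_encType). Qed.

Definition badd m n := Bn (nb m + nb n).
Definition bmul m n := Bn (nb m * nb n).
Definition bleq m n := nb m <= nb n.
Definition beq m n := nb m == nb n.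

Section BinaryArithmetic.
Context {X : encType}.

Lemma pt_nbinary (f : X -> bnat) : pt f -> pt (fun x => binary (nb (f x))).
Proof. exact: pt_recode. Qed.

Lemma pt_bitval (l : X -> seq bool) : pt l -> pt (fun x => Bn (bitval (l x))).
Proof.
move=> pl; suff : pt (fun x => foldl strip_step [::] (rev (l x))).
  by apply: pt_recode => x; rewrite -binary_bitval.
apply: (pt_foldl_sz (step := fun _ => strip_step)); rewrite /strip_step.
- by pt_solve.
- by pt_solve.
- by pt_solve.
- by exists 1 => x s e; rewrite expn1; case: ifP => _; rewrite ?sz_cons; lia.
Qed.

End BinaryArithmetic.

Ltac pt_ext ::= lazymatch goal with
  | |- pt (fun x => binary (nb (@?f x))) => apply: pt_nbinary
  | |- pt (fun x => Bn (bitval (@?f x))) => apply: pt_bitval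
  end.

(** A full adder: the boolean is the carry, the list collects the sum bits with the latest, most
    significant one in front. *)
Definition add_step (m n : bnat) (s : bool * seq bool) (i : nat) :=
  let x := nth false (binary (nb m)) i in
  let y := nth false (binary (nb n)) i in
  ((x && y) || (s.1 && (x || y)), ((x != y) != s.1) :: s.2).

Lemma exp2_gt0 i : 0 < 2 ^ i.
Proof. by rewrite expn_gt0. Qed.

Lemma modn_exp2S n i : n %% 2 ^ i.+1 = n %% 2 ^ i + 2 ^ i * odd (n %/ 2 ^ i).
Proof.
rewrite {1}(divn_eq n (2 ^ i)) {1}(divn_eq (n %/ 2 ^ i) 2) modn2 expnS.
rewrite mulnDl -mulnA -addnA modnMDl [_ * 2 ^ i]mulnC addnC modn_small //.
have := ltn_pmod n (exp2_gt0 i).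
by case: (odd _); lia.
Qed.

Lemma bitval_rcons l b : bitval (rcons l b) = bitval l + 2 ^ size l * b.
Proof.
elim: l => [|a l IH] /=; first by rewrite mul1n addn0.
by rewrite IH expnS; lia.
Qed.

Definition add_fold m n k := foldl (add_step m n) (false, [::]) (iota 0 k).

Lemma add_foldP m n k : size (add_fold m n k).2 = k /\
  bitval (rev (add_fold m n k).2) + 2 ^ k * (add_fold m n k).1 =
  nb m %% 2 ^ k + nb n %% 2 ^ k.
Proof.
rewrite /add_fold; elim: k => [|k [sk IH]]; first by rewrite /= !modn1.
rewrite -[k.+1]addn1 iotaD foldl_cat add0n /=.
move: (foldl _ _ _) sk IH => -[c o] /= sk IH.
rewrite rev_cons bitval_rcons size_rev sk addn1 !modn_exp2S !nth_binary; split=> //.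
rewrite expnS.
by case: (odd (nb m %/ _)); case: (odd (nb n %/ _)); case: c IH => /=; lia.
Qed.

Lemma baddE m n : badd m n = Bn (bitval (rev
  (foldl (add_step m n) (false, [::])
    (iota 0 (size (binary (nb m)) + size (binary (nb n))).+1)).2)).
Proof.
congr Bn; rewrite !size_binary; set k := _.+1.
(* Both summands are below half of [2 ^ k], so the reductions modulo [2 ^ k] change nothing and the
   last carry is 0. *)
have [_] := add_foldP m n k; rewrite /add_fold; move: (foldl _ _ _) => -[c o] /=.
have hm : nb m < 2 ^ (bitlen (nb m) + bitlen (nb n)).
  by apply: leq_trans (ltn_bitlen _) _; rewrite leq_exp2l // leq_addr.
have hn : nb n < 2 ^ (bitlen (nb m) + bitlen (nb n)).
  by apply: leq_trans (ltn_bitlen _) _; rewrite leq_exp2l // leq_addl.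
have E : 2 ^ k = 2 * 2 ^ (bitlen (nb m) + bitlen (nb n)) by rewrite expnS.
by rewrite !modn_small; case: c; lia.
Qed.

(** Bits are read from the least significant one, so the last difference seen is the decisive one;
    there the comparison holds exactly if the second number has the 1. *)
Definition leq_step (m n : bnat) (r : bool) (i : nat) :=
  let x := nth false (binary (nb m)) i in
  let y := nth false (binary (nb n)) i in
  if x == y then r else y.

Lemma bleqE m n : bleq m n = foldl (leq_step m n) true
  (iota 0 (size (binary (nb m)) + size (binary (nb n)))).
Proof.
have H k : foldl (leq_step m n) true (iota 0 k) = (nb m %% 2 ^ k <= nb n %% 2 ^ k).
  elim: k => [|k IH]; first by rewrite /= !modn1.
  rewrite -[k.+1]addn1 iotaD foldl_cat add0n /= IH addn1 !modn_exp2S.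
  rewrite /leq_step !nth_binary.
  have := ltn_pmod (nb m) (exp2_gt0 k).
  have := ltn_pmod (nb n) (exp2_gt0 k).
  by case: (odd (nb m %/ _)); case: (odd (nb n %/ _)); rewrite /=; lia.
rewrite H !size_binary !modn_small //.
  by apply: leq_trans (ltn_bitlen _) _; rewrite leq_exp2l // leq_addl.
by apply: leq_trans (ltn_bitlen _) _; rewrite leq_exp2l // leq_addr.
Qed.

Section BinaryArithmetic2.
Context {X : encType}.

Lemma pt_badd (f g : X -> bnat) : pt f -> pt g -> pt (fun x => badd (f x) (g x)).
Proof.
move=> pf pg; apply: (@pt_recode _ _ _ _ _ (fun x => congr1 enc (esym (baddE (f x) (g x))))).
apply: pt_bitval; apply: pt_rev; apply: pt_snd.
apply: (pt_foldl_sz (step := fun x => add_step (f x) (g x))); rewrite /add_step.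
- by pt_solve.
- by pt_solve.
- have pf' : pt (fun p : X * (bool * seq bool) * nat => f p.1.1) by apply: (pt_comp pf); pt_solve.
  have pg' : pt (fun p : X * (bool * seq bool) * nat => g p.1.1) by apply: (pt_comp pg); pt_solve.
  by pt_solve.
- exists 3 => x [c o] i; rewrite sz_pair /= sz_cons sz_pair /=.
  set u := sz (_ || _); set v := sz (_ != _).
  have : u <= 3 := sz_bool _; have : v <= 3 := sz_bool _.
  suff : 8 <= (sz x + sz i + 2) ^ 3 by have := sz_gt0 c; lia.
  by apply: (@leq_trans (2 ^ 3)) => //; apply: leq_exp2rW; lia.
Qed.

Lemma pt_bleq (f g : X -> bnat) : pt f -> pt g -> pt (fun x => bleq (f x) (g x)).
Proof.
move=> pf pg; apply: (@pt_recode _ _ _ _ _ (fun x => congr1 enc (esym (bleqE (f x) (g x))))).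
apply: (pt_foldl_sz (step := fun x => leq_step (f x) (g x))); rewrite /leq_step.
- by pt_solve.
- by pt_solve.
- have pf' : pt (fun p : X * bool * nat => f p.1.1) by apply: (pt_comp pf); pt_solve.
  have pg' : pt (fun p : X * bool * nat => g p.1.1) by apply: (pt_comp pg); pt_solve.
  by pt_solve.
- exists 2 => x c i; apply: leq_trans (sz_bool _) _.
  apply: (@leq_trans (2 ^ 2)) => //; apply: leq_trans (leq_addl _ _).
  by apply: leq_exp2rW; lia.
Qed.

End BinaryArithmetic2.

Lemma pt_beq (X : encType) (f g : X -> bnat) :
  pt f -> pt g -> pt (fun x => beq (f x) (g x)).
Proof.
move=> pf pg; suff : pt (fun x => bleq (f x) (g x) && bleq (g x) (f x)).
  by apply: pt_recode => x; rewrite /bleq -eqn_leq.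
by apply: pt_andb; exact: pt_bleq.
Qed.

(** Horner's scheme from the most significant bit: double, then add. The value of the accumulator
    grows exponentially, but its bit length, taken as the measure, grows by a bounded amount per
    round. *)
Lemma pt_bmul (X : encType) (f g : X -> bnat) :
  pt f -> pt g -> pt (fun x => bmul (f x) (g x)).
Proof.
move=> pf pg; pose step (m : bnat) (s : bnat) (b : bool) :=
  badd (badd s s) (if b then m else Bn 0).
suff : pt (fun x => foldl (step (g x)) (Bn 0) (rev (binary (nb (f x))))).
  apply: pt_recode => x; congr enc; rewrite foldl_rev.
  rewrite /bmul -[nb (f x) in RHS]bitval_binary.
  elim: (binary _) => //= b l ->; rewrite /step /badd /=.
  by congr Bn; case: b => /=; lia.
have hb m s b : bitlen (nb (step m s b)) <= bitlen (nb s) + (bitlen (nb m) + 2).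
  have h1 := bitlenD (nb s + nb s) (nb (if b then m else Bn 0)).
  have h2 := bitlenD (nb s) (nb s).
  have h3 : bitlen (nb (if b then m else Bn 0)) <= bitlen (nb m) by case: (b).
  by rewrite /step /=; move: h1 h2 h3; rewrite maxnn; lia.
apply: (pt_foldl (mu := fun x s => bitlen (nb s)) (step := fun x => step (g x))).
- by pt_solve.
- by pt_solve.
- have pg' : pt (fun p : X * bnat * bool => g p.1.1) by apply: (pt_comp pg); pt_solve.
  by apply: pt_badd; first apply: pt_badd; pt_solve.
- exists 3 => x s; apply: leq_trans (sz_bnat _) _.
  rewrite !expnS expn0 muln1; set m := _ + 2.
  apply: (@leq_trans (4 * m)); first by rewrite /m; lia.
  by rewrite mulnA leq_mul2r (_ : 4 <= m * m) ?orbT //; apply: (@leq_mul 2 2); rewrite /m; lia.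
- by exists 1 => x s; rewrite expn1; have := bitlen_sz s; lia.
- have [k hk] : pbounded sz (fun x => sz (g x) + 2).
    by apply: pbounded_add; [exact: pt_size|exact: pbounded_const].
  exists k => x s b; apply: leq_trans (hb _ _ _) _; rewrite leq_add2l.
  apply: (@leq_trans (sz (g x) + 2)); first by rewrite leq_add2r bitlen_sz.
  by apply: leq_trans (hk x) _; apply: leq_exp2rW; lia.
Qed.

Lemma pt_Bn (X : encType) (f : X -> nat) : pt f -> pt (fun x => Bn (f x)).
Proof.
move=> pf; suff : pt (fun x => foldl (fun s (_ : unit) => badd s (Bn 1)) (Bn 0) (nseq (f x) tt)).
  have H n m : foldl (fun s (_ : unit) => badd s (Bn 1)) (Bn m) (nseq n tt) =
      Bn (m + n).
    elim: n m => [|n IH] m /=; first by rewrite addn0.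
    by rewrite IH /= addn1 addSnnS.
  by apply: pt_recode => x; rewrite H.
apply: (pt_foldl (mu := fun x s => bitlen (nb s)) (step := fun x s _ => badd s (Bn 1))).
- exact: pt_nseq_tt.
- exact: pt_const.
- by apply: pt_badd; pt_solve.
- exists 3 => x s; apply: leq_trans (sz_bnat _) _.
  rewrite !expnS expn0 muln1; set m := _ + 2.
  apply: (@leq_trans (4 * m)); first by rewrite /m; lia.
  by rewrite mulnA leq_mul2r (_ : 4 <= m * m) ?orbT //; apply: (@leq_mul 2 2); rewrite /m; lia.
- by exists 1 => x s; rewrite expn1; have := bitlen_sz s; lia.
- exists 1 => x s b; rewrite expn1; apply: leq_trans (bitlenD _ _) _.
  by rewrite /=; have := bitlen_le 1; lia.
Qed.

Lemma pt_binary (X : encType) (f : X -> nat) : pt f -> pt (fun x => binary (f x)).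
Proof. by move=> /pt_Bn/pt_nbinary. Qed.

Ltac pt_ext ::= lazymatch goal with
  | |- pt (fun x => binary (nb (@?f x))) => apply: pt_nbinary
  | |- pt (fun x => binary (@?f x)) => apply: pt_binary
  | |- pt (fun x => Bn (bitval (@?f x))) => apply: pt_bitval
  | |- pt (fun x => Bn (@?f x)) => apply: pt_Bn
  | |- pt (fun x => badd (@?f x) (@?g x)) => apply: pt_badd
  | |- pt (fun x => bmul (@?f x) (@?g x)) => apply: pt_bmul
  | |- pt (fun x => bleq (@?f x) (@?g x)) => apply: pt_bleq
  | |- pt (fun x => beq (@?f x) (@?g x)) => apply: pt_beq
  end.

(** * Decoding of certificates *)

(** Read backwards, the prefix code is a postfix program for a stack of trees: a branch bit joins
    the two topmost trees. Missing trees count as leaves, so every bit string decodes to a tree. *)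
Definition parse_step (s : seq tree) (b : bool) : seq tree :=
  if b then Branch (head Leaf s) (head Leaf (behead s)) :: behead (behead s)
  else Leaf :: s.

Definition parse_tree (l : seq bool) : tree :=
  head Leaf (foldl parse_step [::] (rev l)).

Lemma parse_tree_code t : parse_tree (code t) = t.
Proof.
suff H u s : foldr (fun b s => parse_step s b) s (code u) = u :: s.
  by rewrite /parse_tree foldl_rev H.
elim: u s => //= a IHa b IHb s.
by rewrite foldr_cat IHb IHa.
Qed.

Lemma pt_parse (X : encType) (l : X -> seq bool) : pt l -> pt (fun x => parse_tree (l x)).
Proof.
move=> pl; apply: pt_head; first exact: pt_const.
apply: (pt_foldl_sz (step := fun _ => parse_step)); rewrite /parse_step.
- by pt_solve.
- by pt_solve.
- by pt_solve.
- exists 2 => x s b.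
  suff h : sz (parse_step s b) <= sz s + 4.
    apply: leq_trans h _; rewrite leq_add2l.
    by apply: (@leq_trans (2 ^ 2)) => //; apply: leq_exp2rW; lia.
  case: b => /=; last by rewrite sz_cons /sz /=; lia.
  by case: s => [|t [|u s]] //=; rewrite /sz /=; lia.
Qed.

Fixpoint tlist (t : tree) : seq tree :=
  if t is Branch a b then a :: tlist b else [::].

(** A tree and the list of left subtrees along its right spine have the same code, so nothing is
    computed. *)
Lemma pt_tlist (X : encType) (f : X -> tree) : pt f -> pt (fun x => tlist (f x)).
Proof.
apply: pt_recode => x; elim: (f x) => //= a _ b {1}->.
by [].
Qed.

(** The decoders are total: an arbitrary string yields some certificate, and only the checks decide
    whether it is a good one. *)
Definition dec_bool (t : tree) : bool := ~~ nilp (tlist t).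
Definition dec_nat (t : tree) : nat := size (tlist t).
Definition dec_seq (T : Type) (d : tree -> T) (t : tree) : seq T := map d (tlist t).
Definition dec_prod (T U : Type) (d : tree -> T) (d' : tree -> U) (t : tree) :=
  (d (thd t), d' (ttl t)).
Definition dec_bnat (t : tree) : bnat := Bn (bitval (dec_seq dec_bool t)).

Lemma pt_dec_bool : pt dec_bool.
Proof. by rewrite /dec_bool; apply: pt_negb; apply: pt_nilb; apply: pt_tlist; exact: pt_id. Qed.

Lemma pt_dec_nat : pt dec_nat.
Proof. by apply: pt_size_seq; apply: pt_tlist; exact: pt_id. Qed.

Lemma pt_dec_seq (X : encType) (d : tree -> X) : pt d -> pt (dec_seq d).
Proof.
move=> pd; apply: (pt_map (g := fun=> d)); first by apply: pt_tlist; exact: pt_id.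
by apply: (pt_comp pd); apply: pt_snd; exact: pt_id.
Qed.

Lemma pt_dec_prod (X Y : encType) (d : tree -> X) (d' : tree -> Y) :
  pt d -> pt d' -> pt (dec_prod d d').
Proof.
move=> pd pd'; apply: pt_pair.
  by apply: (pt_comp pd); exact: pt_thd.
by apply: (pt_comp pd'); exact: pt_ttl.
Qed.

Lemma pt_dec_bnat : pt dec_bnat.
Proof. by apply: pt_bitval; apply: pt_dec_seq; exact: pt_dec_bool. Qed.

Lemma dec_boolK b : dec_bool (enc b) = b.
Proof. by case: b. Qed.

Lemma dec_natK (n : nat) : dec_nat (enc n) = n.
Proof. by rewrite /dec_nat; elim: n => //= n ->. Qed.

Lemma dec_seqK (X : encType) (d : tree -> X) : (forall x, d (enc x) = x) ->
  forall l : seq X, dec_seq d (enc l) = l.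
Proof. by move=> dK; rewrite /dec_seq; elim=> //= a l ->; rewrite dK. Qed.

Lemma dec_prodK (X Y : encType) (d : tree -> X) (d' : tree -> Y) :
  (forall x, d (enc x) = x) -> (forall x, d' (enc x) = x) ->
  forall p : X * Y, dec_prod d d' (enc p) = p.
Proof. by move=> dK dK' [x y]; rewrite /dec_prod /= dK dK'. Qed.

Lemma dec_bnatK n : dec_bnat (enc n) = n.
Proof.
case: n => n; rewrite /dec_bnat [dec_seq _ _](dec_seqK dec_boolK (binary n)).
by rewrite bitval_binary.
Qed.

End BinaryNumbers.
Import BinaryNumbers.

(** * Buechi probabilities of finite Markov chains *)

Module MarkovChains.
Import all_classical all_reals all_analysis.
Import Order.TTheory GRing.Theory Num.Theory.
Local Open Scope classical_set_scope.
Local Open Scope ring_scope.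

(** At a point where a positive maximum is attained, [g] is at most the average of its successors,
    so all of these attain the maximum too. Following a transition of decreasing rank would never
    stop. *)
Lemma max_principle (F : realFieldType) (S : finType) (P : S -> S -> F)
    (C : pred S) (rk : S -> nat) (g : S -> F) :
  (forall s t, 0 <= P s t) -> (forall s, \sum_t P s t = 1) ->
  (forall s t, C s -> P s t != 0 -> C t) ->
  (forall s, C s -> g s <= 0 \/
     g s <= \sum_t P s t * g t /\ exists2 t, P s t != 0 & (rk t < rk s)%N) ->
  forall s, C s -> g s <= 0.
Proof.
move=> P0 P1 Cc H s0 Cs0; rewrite leNgt; apply/negP => g0.
have [m Cm mmax] : exists2 m, C m & forall s, C s -> g s <= g m.
  case: (@arg_maxP _ _ S s0 C g Cs0) => m Cm mx.
  by exists m => // s Cs; apply: mx.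
have gm0 : 0 < g m by apply: lt_le_trans (mmax _ Cs0).
suff no k : forall s, (rk s <= k)%N -> C s -> g s = g m -> False.
  exact: (no (rk m) m).
elim: k => [|k IH] s rks Cs gs; case: (H s Cs) => [|[gle [t Pst rkt]]];
  try (by rewrite gs leNgt gm0).
  by rewrite ltnNge (leq_trans rks) in rkt.
have Ct := Cc _ _ Cs Pst.
apply: (IH t) => //; first by rewrite -ltnS (leq_trans rkt).
apply/eqP; rewrite eq_le mmax //=.
have Ptgt : 0 < P s t by rewrite lt_neqAle eq_sym Pst P0.
(* The other successors contribute at most [g m] each, so the inequality at [s] leaves [t] no
   smaller value. *)
rewrite -(ler_pM2l Ptgt) -(lerD2r (\sum_(u | u != t) P s u * g m)).
rewrite [leLHS](_ : _ = g m); last first.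
  have E : P s t + \sum_(u | u != t) P s u = 1 by rewrite -(P1 s) [RHS](bigD1 t).
  by rewrite -mulr_suml -mulrDl E mul1r.
rewrite -{1}gs; apply: le_trans gle _; rewrite (bigD1 t) //= lerD2l.
apply: ler_sum => u ut; have [->|Psu] := eqVneq (P s u) 0; first by rewrite !mul0r.
by apply: ler_wpM2l; rewrite ?P0 ?mmax ?(Cc _ _ Cs Psu).
Qed.

Definition shift (M : mdp) (p : paths M) : paths M := fun n => p n.+1.

Section Chain.
Variables (R : realType) (M : mdp) (sigma : scheduler R M).
Variable (d : state M -> action M).
Hypothesis sd : forall h s a, decision sigma h s a = (a == d s)%:R.
Implicit Types (s t : state M) (w : seq (state M)) (T : {set state M}).

Definition chain_prob s t : R := ratr (trans s (d s) t).
Local Notation P := chain_prob.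
Local Notation mu := (path_measure sigma).

Lemma md_enabled s : enabled s (d s).
Proof.
apply/contraT => /(decision_enabled sigma [::]); rewrite sd eqxx => /eqP.
by rewrite oner_eq0.
Qed.

Lemma chain_prob_ge0 s t : 0 <= P s t.
Proof. by rewrite ler0q; case/andP: (trans_bounds s (d s) t). Qed.

Lemma chain_prob_sum s : \sum_t P s t = 1.
Proof. by rewrite -rmorph_sum /= (eqP (md_enabled s)) rmorph1. Qed.

Lemma step_prob_md h s t : step_prob sigma h s t = P s t.
Proof.
rewrite /step_prob (bigD1 (d s)) //= sd eqxx mul1r big1 ?addr0 // => a ne.
by rewrite sd (negPf ne) mul0r.
Qed.

Lemma path_prob_md h h' s w : path_prob sigma h s w = path_prob sigma h' s w.
Proof.
by elim: w s h h' => //= t w IH s h h'; rewrite !step_prob_md (IH t _ (rcons h' s)).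
Qed.

Lemma measurable_cylinder w : measurable (cylinder w : set (paths M)).
Proof. by apply: sub_sigma_algebra; exists w. Qed.

Lemma mu_start s (A : set (paths M)) : measurable A ->
  (forall p, A p -> p 0%N <> s) -> mu s A = 0%E.
Proof.
move=> mA As; apply/eqP; rewrite eq_le measure_ge0 andbT.
have c1 := path_measure_cylinder sigma s [::].
have := probability_setC (mu s) (measurable_cylinder [:: s]).
rewrite c1 /= subee // => <-; apply: le_measure; rewrite ?inE //.
  by apply: measurableC; exact: measurable_cylinder.
by move=> p Ap /= /(_ 0%N isT) /= ps; exact: As ps.
Qed.


Lemma measurable_shift (A : set (paths M)) : measurable A ->
  measurable (@shift M @^-1` A).
Proof.
move=> mA; rewrite -[X in measurable X]setTI.
have H : measurable_fun [set: paths M] (@shift M).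
  apply: measurability => // _ [_ [w _ <-] <-]; rewrite setTI.
  have -> : @shift M @^-1` cylinder w = \bigcup_(s : state M) cylinder (s :: w).
    apply/seteqP; split=> p /=.
      by move=> H; exists (p 0%N) => // -[|i] // /H.
    by move=> [s _ H] i iw; have := H i.+1 iw.
  apply: fin_bigcup_measurable => //.
  by move=> s _; exact: measurable_cylinder.
exact: H.
Qed.

(** Two cylinders are nested or disjoint; with the empty set added they form a generating class
    closed under intersection, as Dynkin induction requires. *)
Definition cyl0 : set (set (paths M)) :=
  [set A | A = set0 \/ exists w, A = cylinder w].

Lemma cyl0_measurable : @measurable _ (paths M) = <<s cyl0 >>.
Proof.
apply/seteqP; split.
  apply: smallest_sub; first exact: smallest_sigma_algebra.
  by move=> _ [w _ <-]; apply: sub_sigma_algebra; right; exists w.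
apply: smallest_sub; first exact: sigma_algebra_measurable.
move=> _ [->|[w ->]]; first exact: measurable0.
exact: measurable_cylinder.
Qed.

Lemma cylinder_setI w w' : (size w <= size w')%N ->
  cyl0 (cylinder w `&` cylinder w').
Proof.
move=> le_w; have [eq|ne] := eqVneq (take (size w) w') w.
  right; exists w'; apply/seteqP; split=> [p []//|p pw']; split=> // i iw.
  by rewrite pw' ?(leq_trans iw) // -eq nth_take.
left; apply/seteqP; split=> // p [pw pw']; case/eqP: ne.
have sw : size (take (size w) w') = size w by rewrite size_takel.
apply: (@eq_from_nth _ ord0) => //; rewrite sw => i iw.
by rewrite nth_take // -pw' ?(leq_trans iw) // pw.
Qed.

Lemma cyl0_setI : setI_closed cyl0.
Proof.
move=> A B [->|[w ->]]; first by rewrite set0I; left.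
case=> [->|[w' ->]]; first by rewrite setI0; left.
have [le_w|le_w] := leqP (size w) (size w'); first exact: cylinder_setI.
by rewrite setIC; apply: cylinder_setI; exact: ltnW.
Qed.


(** The Markov property. Both sides are measures in [A], so it suffices to compare them on
    cylinders, where they are products of transition probabilities. *)
Lemma mu_shift s (A : set (paths M)) : measurable A ->
  mu s (@shift M @^-1` A) = (\sum_t (P s t)%:E * mu t A)%E.
Proof.
rewrite cyl0_measurable; move: A.
apply: dynkin_induction; [exact: cyl0_measurable|exact: cyl0_setI| | | | ].
- rewrite preimage_setT probability_setT.
  under eq_bigr do rewrite probability_setT mule1.
  by rewrite sumEFin chain_prob_sum.
- move=> _ [->|[w ->]].
    rewrite preimage_set0 measure0 big1 // => t _.
    by rewrite measure0 mule0.
  case: w => [|t w].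
    have -> : cylinder [::] = [set: paths M] by apply/seteqP; split.
    rewrite preimage_setT probability_setT.
    under eq_bigr do rewrite probability_setT mule1.
    by rewrite sumEFin chain_prob_sum.
  (* The event is cut according to its first state; the paths that do not start in [s] form a null
     set. *)
  have -> : mu s (@shift M @^-1` cylinder (t :: w)) = mu s (cylinder [:: s, t & w]).
    rewrite -[in LHS](setIT (_ @^-1` _)) -(setUv (cylinder [:: s])) setIUr.
    have m1 := measurable_shift (measurable_cylinder (t :: w)).
    have m2 := measurable_cylinder [:: s].
    have m3 : measurable (@shift M @^-1` cylinder (t :: w) `&` ~` cylinder [:: s]).
      by apply: measurableI => //; exact: measurableC.
    have -> : mu s (@shift M @^-1` cylinder (t :: w) `&` cylinder [:: s] `|`
        @shift M @^-1` cylinder (t :: w) `&` ~` cylinder [:: s]) =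
      (mu s (@shift M @^-1` cylinder (t :: w) `&` cylinder [:: s]) +
       mu s (@shift M @^-1` cylinder (t :: w) `&` ~` cylinder [:: s]))%E.
      apply: measureU => //; first exact: measurableI.
      by rewrite setIACA setICr setI0.
    rewrite [X in (_ + X)%E]mu_start //; last first.
      by move=> p [_ nps] ps; apply: nps => -[].
    rewrite adde0; congr (mu s _); apply/seteqP; split => p /=.
      by move=> [H1 H2] [|i] iw; [exact: (H2 0%N)|exact: (H1 i)].
    by move=> H; split=> [i iw|[|//] iw]; [exact: (H i.+1)|exact: (H 0%N)].
  rewrite path_measure_cylinder /= step_prob_md (path_prob_md _ [::]).
  rewrite (bigD1 t) //= path_measure_cylinder big1 ?adde0 ?EFinM //.
  move=> u ut; rewrite mu_start ?mule0 //; first exact: measurable_cylinder.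
  by move=> p /(_ 0%N isT) /= -> tu; rewrite tu eqxx in ut.
- move=> A mA IH; rewrite preimage_setC probability_setC ?IH; last exact: measurable_shift.
  have E t : mu t A = (fine (mu t A))%:E by rewrite fineK ?fin_num_measure.
  under eq_bigr do rewrite E -EFinM.
  rewrite sumEFin -EFinB -(chain_prob_sum s) -sumrB -sumEFin.
  apply: eq_bigr => t _; rewrite probability_setC // E -EFinB -EFinM.
  by rewrite mulrBr mulr1.
- move=> F mF tF IH; rewrite preimage_bigcup measure_semi_bigcup //; last 3 first.
    by move=> i; exact: measurable_shift.
    apply/trivIsetP => i j _ _ ij; rewrite -preimage_setI.
    by move/trivIsetP : tF => /(_ _ _ _ _ ij) ->//; rewrite preimage_set0.
    by apply: bigcup_measurable => i _; exact: measurable_shift.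
  rewrite (eq_eseriesr (g := fun i => \sum_t (P s t)%:E * mu t (F i)))%E; last by move=> i _; exact: IH.
  rewrite nneseries_sum; last first.
    by move=> t i _; apply: mule_ge0; rewrite ?lee_fin ?chain_prob_ge0.
  apply: eq_bigr => t _; rewrite nneseriesZl //; congr (_ * _)%E.
  by rewrite measure_semi_bigcup //; exact: bigcup_measurable.
Qed.

Definition pr s (A : set (paths M)) : R := fine (mu s A).

Lemma prE s A : measurable A -> mu s A = (pr s A)%:E.
Proof. by move=> mA; rewrite /pr fineK ?fin_num_measure. Qed.

Lemma pr_shift s A : measurable A ->
  pr s (@shift M @^-1` A) = \sum_t P s t * pr t A.
Proof.
move=> mA; rewrite /pr mu_shift //.
under eq_bigr do rewrite prE // -EFinM.
by rewrite sumEFin.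
Qed.

Lemma pr_ge0 s A : 0 <= pr s A.
Proof. by rewrite fine_ge0. Qed.

Lemma pr_le1 s A : measurable A -> pr s A <= 1.
Proof. by move=> mA; rewrite -lee_fin -prE //; exact: probability_le1. Qed.

Lemma le_pr s A B : measurable A -> measurable B -> A `<=` B -> pr s A <= pr s B.
Proof.
by move=> mA mB AB; rewrite -lee_fin -!prE //; apply: le_measure; rewrite ?inE.
Qed.

Lemma pr_setC s A : measurable A -> pr s (~` A) = 1 - pr s A.
Proof. by move=> mA; rewrite {1}/pr probability_setC // prE // -EFinB. Qed.

Lemma pr_bigcup0 s (F : nat -> set (paths M)) : (forall i, measurable (F i)) ->
  (forall i, pr s (F i) = 0) -> pr s (\bigcup_i F i) = 0.
Proof.
move=> mF F0; have : (mu s).-negligible (\bigcup_i F i).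
  apply: negligible_bigcup => i; exists (F i); split=> //.
  by have := prE s (mF i); rewrite F0; apply.
by move/measure_negligible; rewrite /pr => ->//; exact: bigcup_measurable.
Qed.

Definition visits T : set (paths M) := [set p | p 0%N \in T].

Lemma measurable_visits T : measurable (visits T).
Proof.
have -> : visits T = \bigcup_(s in [set s | s \in T]) cylinder [:: s].
  apply/seteqP; split=> p /=.
    by move=> pT; exists (p 0%N) => // -[].
  by move=> [s /= sT /(_ 0%N isT) /= ps]; rewrite /visits /= ps.
apply: fin_bigcup_measurable => // s _; exact: measurable_cylinder.
Qed.

Definition shiftn n (A : set (paths M)) := iter n (fun A => @shift M @^-1` A) A.

Lemma shiftnE n A p : shiftn n A p <-> A (fun i => p (i + n)%N).
Proof.
elim: n p => [|n IH] p /=.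
  by rewrite /shiftn /=; have -> : (fun i => p (i + 0)%N) = p by apply/funext => i; rewrite addn0.
rewrite [shiftn _ _ _]/= -/(shiftn n A (shift p)) IH /shift.
by have -> : (fun i => p (i + n.+1)%N) = (fun i => p (i + n).+1) by apply/funext => i; rewrite addnS.
Qed.

Lemma measurable_shiftn n A : measurable A -> measurable (shiftn n A).
Proof. by move=> mA; elim: n => //= n; exact: measurable_shift. Qed.

Lemma gfE T : visits_infinitely_often T =
  \bigcap_i \bigcup_j shiftn (i + j) (visits T).
Proof.
apply/seteqP; split=> p /= H.
  move=> i _; have [j [le_ij pj]] := H i; exists (j - i)%N => //.
  by apply/shiftnE; rewrite /visits /= add0n subnKC.
move=> i; have [j _ /shiftnE] := H i I; rewrite /visits /= add0n => pj.
by exists (i + j)%N; rewrite leq_addr.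
Qed.

Lemma measurable_gf T : measurable (visits_infinitely_often T).
Proof.
rewrite gfE; apply: bigcap_measurable => // i _; apply: bigcup_measurable => j _.
by apply: measurable_shiftn; exact: measurable_visits.
Qed.

Lemma buechi_probE s T : buechi_prob sigma s T = pr s (visits_infinitely_often T).
Proof. by []. Qed.

Lemma buechi_ge0 s T : 0 <= buechi_prob sigma s T.
Proof. exact: pr_ge0. Qed.

Lemma buechi_le1 s T : buechi_prob sigma s T <= 1.
Proof. by apply: pr_le1; exact: measurable_gf. Qed.

(** Visiting a set infinitely often is insensitive to the first step, so the event is its own
    preimage under the shift. *)
Lemma buechi_harmonic s T :
  buechi_prob sigma s T = \sum_t P s t * buechi_prob sigma t T.
Proof.
rewrite buechi_probE -pr_shift; last exact: measurable_gf.
congr pr; apply/seteqP; split=> p H i.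
  by have [j [le_ij pj]] := H i.+1; exists j.-1; case: j le_ij pj => // j.
by have [j [le_ij pj]] := H i; exists j.+1; split=> //; exact: leqW.
Qed.

Section Closed.
Variables (T : {set state M}) (C : pred (state M)).
Hypothesis Cc : forall s t, C s -> P s t != 0 -> C t.

Lemma pr_shiftn0 A n : measurable A -> (forall s, C s -> pr s A = 0) ->
  forall s, C s -> pr s (shiftn n A) = 0.
Proof.
move=> mA A0; elim: n => [|n IH] s Cs; first exact: A0.
rewrite [shiftn _ _]/= pr_shift; last exact: measurable_shiftn.
apply: big1 => t _; have [->|/Cc Ct] := eqVneq (P s t) 0; first by rewrite mul0r.
by rewrite -/(shiftn n A) IH ?mulr0 // Ct.
Qed.

Lemma buechi_zero : (forall s, C s -> s \notin T) ->
  forall s, C s -> buechi_prob sigma s T = 0.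
Proof.
move=> CT s Cs; apply/eqP; rewrite eq_le buechi_ge0 andbT buechi_probE.
rewrite -(@pr_bigcup0 s (fun j => shiftn j (visits T))).
- apply: le_pr; first exact: measurable_gf.
    by apply: bigcup_measurable => j _; apply: measurable_shiftn; exact: measurable_visits.
  by move=> p; rewrite gfE => /(_ 0%N I) [j _]; rewrite add0n => pj; exists j.
- by move=> i; apply: measurable_shiftn; exact: measurable_visits.
- move=> i; apply: pr_shiftn0 Cs; first exact: measurable_visits.
  move=> t Ct; rewrite /pr mu_start //; first exact: measurable_visits.
  by rewrite /visits => p /= pT pt; rewrite pt (negPf (CT t Ct)) in pT.
Qed.

(** Let [N] be the event that the target is never visited. It is contained in its shift, so its
    probability is at most the average over the successors, and it is 0 on the target; by the
    maximum principle it vanishes on [C]. The paths with finitely many visits are the union of the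
    shifts of [N]. *)
Lemma buechi_one (rk : state M -> nat) :
  (forall s, C s -> s \in T \/ exists2 t, P s t != 0 & (rk t < rk s)%N) ->
  forall s, C s -> buechi_prob sigma s T = 1.
Proof.
move=> H s Cs; pose N : set (paths M) := ~` \bigcup_j shiftn j (visits T).
have mN : measurable N.
  apply: measurableC; apply: bigcup_measurable => j _.
  by apply: measurable_shiftn; exact: measurable_visits.
have N0 t : C t -> pr t N = 0.
  move=> Ct; apply/eqP; rewrite eq_le pr_ge0 andbT.
  apply: (max_principle (rk := rk) (C := C) (g := fun t => pr t N) chain_prob_ge0
    chain_prob_sum Cc _ Ct) => u Cu; case: (H u Cu) => [uT|ex]; [left|right].
    rewrite /pr mu_start // => p Np pu; apply: Np; exists 0%N => //.
    by rewrite /shiftn /visits /= pu.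
  split=> //; rewrite -pr_shift //; apply: le_pr => //; first exact: measurable_shift.
  by move=> p Np [j _ pj]; apply: Np; exists j.+1.
have : pr s (~` visits_infinitely_often T) = 0.
  have -> : ~` visits_infinitely_often T = \bigcup_i shiftn i N.
    rewrite gfE setC_bigcap; apply: eq_bigcup => // i _.
    apply/seteqP; split=> p /=.
      move=> Np; apply/shiftnE => -[j _ /shiftnE pj]; apply: Np; exists j => //.
      by apply/shiftnE; rewrite /visits /= add0n addnC in pj *.
    move=> /shiftnE Np [j _ /shiftnE pj]; apply: Np; exists j => //.
    by apply/shiftnE; rewrite /visits /= add0n addnC in pj *.
  apply: pr_bigcup0 => i; first exact: measurable_shiftn.
  exact: pr_shiftn0.
rewrite pr_setC; last exact: measurable_gf.
by rewrite buechi_probE => /eqP; rewrite subr_eq0 => /eqP <-.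
Qed.

End Closed.

End Chain.

Lemma md_scheduler (R : realType) (M : mdp) (d : state M -> action M) :
  (forall s, enabled s (d s)) ->
  exists2 sigma : scheduler R M, memoryless_deterministic sigma &
    forall h s a, decision sigma h s a = (a == d s)%:R.
Proof.
move=> en.
have h0 (h : seq (state M)) s a : 0 <= (a == d s)%:R :> R by rewrite ler0n.
have h1 (h : seq (state M)) s : \sum_a (a == d s)%:R = 1 :> R.
  rewrite (bigD1 (d s)) //= eqxx big1 ?addr0 // => a /negPf ->.
  by [].
have h2 (h : seq (state M)) s a : ~~ enabled s a -> (a == d s)%:R = 0 :> R.
  by case: eqP => // ->; rewrite en.
exists (@Scheduler R M (fun h s a => (a == d s)%:R) h0 h1 h2) => //.
by exists d.
Qed.

End MarkovChains.
Import MarkovChains.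

(** * Constraint satisfaction as an equality of Buechi probabilities *)

Module ConstraintGadgets.
Import all_classical all_reals all_analysis.
Import Order.TTheory GRing.Theory Num.Theory.
Local Open Scope ring_scope.

(* A nonzero integer defect in some row cannot be cancelled by the later rows,
   as the tail of the chain contributes less than one unit. *)
Lemma chain_gap (F : realFieldType) (X D n : nat) (e : nat -> F) (z : nat -> int) :
  (0 < X)%N -> (0 < D)%N -> e n = 0 ->
  (forall k, (k < n)%N -> e k = ((z k)%:~R + e k.+1) / D%:R) ->
  (forall k, `|e k| <= 1 - X%:R^-1) ->
  (forall k, (k < n)%N -> z k = 0) /\ e 0%N = 0 \/
  (X%:R * D%:R ^+ n)^-1 <= `|e 0%N|.
Proof.
move=> X0 D0; elim: n e z => [|n IH] e z en eS eb; first by left; split.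
have X0' : 0 < X%:R :> F by rewrite ltr0n.
have D0' : 0 < D%:R :> F by rewrite ltr0n.
have D1' : 1 <= D%:R :> F by rewrite ler1n.
have e0 := eS 0%N isT.
have [z0|z0] := eqVneq (z 0%N) 0; last first.
  right; have z1 : 1 <= `|(z 0%N)%:~R + e 0%N.+1| + (1 - X%:R^-1).
    have h1 : 1 <= `|(z 0%N)%:~R| :> F.
      by rewrite -intr_norm -[1]/(1%:~R) ler_int -gtz0_ge1 normr_gt0.
    apply: le_trans h1 _; apply: le_trans (lerD (lexx _) (eb 1%N)).
    by have := ler_normB ((z 0%N)%:~R + e 1%N) (e 1%N); rewrite addrK.
  have z2 : X%:R^-1 <= `|(z 0%N)%:~R + e 1%N| by lra.
  rewrite e0 normrM [`|_^-1|]gtr0_norm ?invr_gt0 // invfM.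
  apply: ler_pM => //; rewrite ?invr_ge0 ?exprn_ge0 ?(ltW X0') ?(ltW D0') //.
  by rewrite lef_pV2 ?posrE ?exprn_gt0 // exprS ler_peMr ?exprn_ege1 // ltW.
case: (IH (fun k => e k.+1) (fun k => z k.+1)) => //.
- by move=> k kn; exact: eS.
- move=> [zk e1]; left; split; first by case=> // k; exact: zk.
  by rewrite e0 z0 e1 addr0 mul0r.
- move=> h; right; rewrite e0 z0 add0r normrM [`|_^-1|]gtr0_norm ?invr_gt0 //.
  by rewrite exprSr mulrA invfM; apply: ler_pM.
Qed.

Lemma chain_zero (F : realFieldType) (D n : nat) (e : nat -> F) (z : nat -> int) :
  e n = 0 -> (forall k, (k < n)%N -> e k = ((z k)%:~R + e k.+1) / D%:R) ->
  (forall k, (k < n)%N -> z k = 0) -> e 0%N = 0.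
Proof.
elim: n e z => [|n IH] e z en eS z0 //.
rewrite eS // z0 // (IH (fun k => e k.+1) (fun k => z k.+1)) ?addr0 ?mul0r //.
  by move=> k kn; exact: eS.
by move=> k kn; exact: z0.
Qed.

Lemma iota0E n : iota 0 n = index_iota 0 n.
Proof. by rewrite /index_iota subn0. Qed.

Section FieldIdentities.
Variables (F : numFieldType) (g x D : F).
Hypotheses (g0 : g != 0) (x0 : x != 0) (D0 : D != 0).

Lemma reference_weight : 2 * g * D / (2 * g * x * D) = x^-1.
Proof. by field; rewrite x0 g0 D0. Qed.

Lemma coin_weight u : g * x * D * u / (2 * g * x * D) = u / 2.
Proof. by field; rewrite x0 g0 D0. Qed.

Lemma cell_weight v : 2 * x * D * v / (2 * g * x * D) = v / g.
Proof. by field; rewrite x0 g0 D0. Qed.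

(** The relation between [D], [x] and [K] makes [x^-1] the fixed point of the map sending [w] to
    [(K + w) / D]. Deviations from [x^-1] therefore obey a recursion whose only inhomogeneity is the
    defect [u - p]. *)
Lemma row_weight K u p w : D = x * K + 1 ->
  2 * g * x * (u + (K - p) + w) / (2 * g * x * D) - x^-1 =
  (u - p + (w - x^-1)) / D.
Proof.
move=> DE; have -> : K = (D - 1) / x by rewrite DE addrK mulrC mulKf.
by field; rewrite x0 g0 D0.
Qed.

End FieldIdentities.

Section ConstraintMDP.
(* Variables take values below [G], every constraint has [r] slots, and the
   constraints of kind [kd] allow the tuples with base-[G] codes in [tb kd]. *)
Variables (G r Na : nat) (tb : nat -> seq nat).

Definition csp := (nat * seq (nat * seq nat))%type.
Variable (I : csp).
Local Notation nv := I.1.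
Local Notation C := I.2.
Local Notation nc := (size C).

Definition tuple_code (l : seq nat) : nat := foldr (fun a n => a + n * G)%N 0%N l.

Definition csp_wf : Prop := forall c, c \in C ->
  [/\ size c.2 = r, all (fun j => j < nv)%N c.2, (0 < size (tb c.1) <= Na)%N &
      all (fun k => k <= G ^ r)%N (tb c.1)].

Definition csp_sat : Prop := exists2 v : nat -> nat, (forall j, (v j < G)%N) &
  forall c, c \in C -> tuple_code (map v c.2) \in tb c.1.

(** In units of [1 / cD] a row sends at most [r * cK] to variables, at most [cK] to sink 0 and 1
    along the chain, which [cD] accommodates. [cX] is at least 2 for every [r], so deviations of a
    probability from [1 / cX] stay within [1 - 1 / cX]. [cDD] is a common denominator that also
    covers the coin and the values in units of [1 / G]. *)
Definition cK := (G ^ r)%N.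
Definition cX := r.+2.
Definition cD := (cX * cK + 1)%N.
Definition cDD := (2 * G * cX * cD)%N.
(** A variable of value [v] reaches sink 0 with probability [v / G], so the weight of the digit at
    position [i] carries one more factor [G]. *)
Definition slot_weights := [seq (2 * G * cX * G ^ i.+1)%N | i <- iota 0 r].

(** Action numbers beyond the table fall back to its first entry, so every action of the process
    denotes an allowed tuple and may be enabled everywhere. *)
Definition picked (kd a : nat) : nat := nth (head 0%N (tb kd)) (tb kd) a.

(* States: 0 and 2 are the two accepting sinks, 1 the rejecting sink, 3 reaches 2
   with the reference probability, 4 flips a coin between 3 and 5; then come the
   constraints, the end of their chain, and the variables. All probabilities
   have denominator [cDD], and state 1 takes what remains. *)
Definition row_num (s a t : nat) : nat :=
  let c := nth (0%N, [::]) C (s - 5) in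
  (sumn [seq (nth 0%N c.2 i + (6 + nc) == t) * nth 0%N slot_weights i
        | i <- iota 0 r] +
   (t == 0) * (2 * G * cX * (cK - picked c.1 a)) + (t == s.+1) * (2 * G * cX))%N.

Definition num0 (s a t : nat) : nat :=
  (if s == 0 then (t == 0) * cDD
   else if s == 1 then 0
   else if s == 2 then (t == 2) * cDD
   else if s == 3 then (t == 2) * (2 * G * cD)
   else if s == 4 then (t == 5) * (G * cX * cD) + (t == 3) * (G * cX * cD)
   else if s < 5 + nc then row_num s a t
   else if s == 5 + nc then (t == 0) * (2 * G * cD)
   else (t == 0) * (2 * cX * cD * (if a < G then a else 0)))%N.

Definition trans_num (s a t : nat) : nat :=
  (if t == 1 then cDD - sumn [seq num0 s a u | u <- iota 0 (6 + nc + nv)]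
   else num0 s a t)%N.

Definition nstates := (5 + nc + nv)%N.

Hypothesis (G0 : (0 < G)%N) (GNa : (G <= Na)%N) (wf : csp_wf).

Lemma cDD_gt0 : (0 < cDD)%N.
Proof. by rewrite /cDD /cX /cD; lia. Qed.

Lemma sum_delta (F : nzRingType) (x : nat) (c : F) (h : 'I_nstates.+1 -> F) :
  (x < nstates.+1)%N ->
  \sum_(t < nstates.+1) ((nat_of_ord t == x)%:R * c) * h t = c * h (inord x).
Proof.
move=> xN; rewrite (bigD1 (inord x)) //= inordK // eqxx mul1r big1 ?addr0 // => t ne.
rewrite (_ : (_ == x) = false) ?mul0r //; apply: contraNF ne => /eqP <-.
by rewrite inord_val.
Qed.

Lemma sum_row (F : comNzRingType) s a (h : 'I_nstates.+1 -> F) : (s - 5 < nc)%N ->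
  (s < nstates)%N ->
  let c := nth (0%N, [::]) C (s - 5) in
  \sum_(t < nstates.+1) (row_num s a t)%:R * h t =
  (2 * G * cX)%:R * (\sum_(i < r) (G ^ i.+1)%:R * h (inord (6 + nc + nth 0%N c.2 i)%N) +
     (cK - picked c.1 a)%:R * h (inord 0) + h (inord s.+1)).
Proof.
move=> sn sN c; have [cr cv _ _] := wf (mem_nth (0%N, [::]) sn).
under eq_bigr => t _ do rewrite /row_num -/c 2!natrD 2!mulrDl.
rewrite 2!big_split /= !mulrDr; congr (_ + _ + _); last first.
- rewrite -[RHS](@sum_delta _ s.+1 _ h) //.
  by apply: eq_bigr => t _; rewrite natrM.
- rewrite mulrA -natrM -[RHS](@sum_delta _ 0%N _ h) //.
  by apply: eq_bigr => t _; rewrite natrM.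
under eq_bigr => t _ do rewrite sumnE big_map natr_sum mulr_suml.
rewrite exchange_big /= iota0E big_mkord mulr_sumr.
apply: eq_bigr => i _; rewrite mulrA -natrM -[RHS](@sum_delta _ _ _ h); last first.
  have ir : (i < size c.2)%N by rewrite cr.
  have jv : (nth 0%N c.2 i < nv)%N := allP cv _ (mem_nth 0%N ir).
  by rewrite /nstates; lia.
apply: eq_bigr => t _; rewrite natrM eq_sym addnC.
by rewrite (nth_map 0%N) ?size_iota // nth_iota.
Qed.

Lemma sum_row_num (s a : nat) : (s - 5 < nc)%N -> (s < nstates)%N ->
  (\sum_(t < nstates.+1) row_num s a t <= cDD)%N.
Proof.
(* The weights of a row are added up by applying [sum_row] to the constant function 1, over the
   integers because a ring is asked for. *)
move=> sn sN; have := @sum_row int s a (fun _ => 1) sn sN => /=.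
set c := nth _ _ _ => E.
have : (\sum_(t < nstates.+1) row_num s a t)%:R =
    ((2 * G * cX) * (\sum_(i < r) G ^ i.+1 + (cK - picked c.1 a) + 1))%:R :> int.
  rewrite natrM !natrD !natr_sum; under eq_bigr do rewrite -[_%:R]mulr1.
  rewrite E; congr (_ * (_ + _ + _)); rewrite ?mulr1 //.
  by apply: eq_bigr => i _; rewrite mulr1.
rewrite !natz => -[->]; rewrite /cDD leq_pmul2l; last by rewrite /cX; lia.
have le1 : (\sum_(i < r) G ^ i.+1 <= r * cK)%N.
  rewrite -[X in (_ <= X * _)%N]card_ord -sum_nat_const; apply: leq_sum => i _.
  by rewrite /cK leq_pexp2l.
apply: (@leq_trans (r * cK + cK + 1)%N); last by rewrite /cD /cX; lia.
by rewrite leq_add2r leq_add // leq_subr.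
Qed.

Lemma sum_num0 s a : (s < nstates.+1)%N ->
  (sumn [seq num0 s a u | u <- iota 0 (6 + nc + nv)] <= cDD)%N.
Proof.
move=> sN; rewrite sumnE big_map (_ : (6 + nc + nv)%N = nstates.+1) // iota0E big_mkord.
have H x c : (x < nstates.+1)%N ->
    (\sum_(t < nstates.+1) (nat_of_ord t == x) * c = c)%N.
  move=> xN; rewrite (bigD1 (inord x)) //= inordK // eqxx mul1n big1 ?addn0 // => t ne.
  rewrite (_ : (_ == x) = false) ?mul0n //; apply: contraNF ne => /eqP <-.
  by rewrite inord_val.
have D0 : (0 < cD)%N by rewrite /cD addn1.
rewrite /num0; case: eqP => [_|s0]; first by rewrite H.
case: eqP => [_|s1]; first by rewrite big1.
case: eqP => [_|s2]; first by rewrite H.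
case: eqP => [_|s3]; first by rewrite H // /cDD leq_mul2r leq_pmulr ?orbT.
case: eqP => [_|s4].
  by rewrite big_split /= !H ?/nstates // /cDD; lia.
case: ltnP => [s5|s5].
  by apply: sum_row_num; rewrite ?/nstates; lia.
have aG : ((if a < G then a else 0) <= G)%N by case: ltnP => //; exact: ltnW.
case: eqP => [_|s6]; first by rewrite H // /cDD leq_mul2r leq_pmulr ?orbT.
rewrite H // /cDD.
apply: (@leq_trans (2 * cX * cD * G)%N); last by lia.
by rewrite leq_mul2l aG orbT.
Qed.

Lemma num0_1 s a : num0 s a 1 = 0%N.
Proof.
rewrite /num0; do 5! (case: eqP => // ?).
case: ltnP => s5; last by case: ifP.
rewrite /row_num (_ : (1 == s.+1)%N = false); last by lia.
rewrite !mul0n !addn0; apply/eqP; rewrite sumnE big_map big1_seq // => i _.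
by rewrite (_ : (_ == 1)%N = false) //; lia.
Qed.

Lemma num0_row s a t : (5 <= s < 5 + nc)%N -> num0 s a t = row_num s a t.
Proof.
move=> /andP[s5 sn]; rewrite /num0; do 5! (case: eqP => [?|_]; first by lia).
by rewrite sn.
Qed.

Lemma num0_end a t : num0 (5 + nc) a t = ((t == 0) * (2 * G * cD))%N.
Proof.
rewrite /num0; do 5! (case: eqP => [?|_]; first by lia).
by rewrite ltnn eqxx.
Qed.

Lemma num0_cell j a t : num0 (6 + nc + j) a t =
  ((t == 0) * (2 * cX * cD * (if a < G then a else 0)))%N.
Proof.
rewrite /num0; do 5! (case: eqP => [?|_]; first by lia).
case: ltnP => [?|_]; first by lia.
by case: eqP => [?|//]; lia.
Qed.

Lemma sum_num s a : (s < nstates.+1)%N ->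
  (\sum_(t < nstates.+1) trans_num s a t = cDD)%N.
Proof.
move=> sN; have le := sum_num0 a sN; rewrite sumnE big_map in le.
rewrite (_ : (6 + nc + nv)%N = nstates.+1) // iota0E big_mkord in le.
have i1 : nat_of_ord (inord 1 : 'I_nstates.+1) = 1%N by rewrite inordK.
rewrite (bigD1 (inord 1)) //= i1 /trans_num eqxx sumnE big_map.
rewrite (_ : (6 + nc + nv)%N = nstates.+1) // iota0E big_mkord.
rewrite (eq_bigr (fun t : 'I_nstates.+1 => num0 s a t)); last first.
  move=> t ne; case: eqP => // t1; case/eqP: ne; apply: val_inj; exact: etrans t1 (esym i1).
have E : (\sum_(t < nstates.+1) num0 s a t =
    \sum_(t < nstates.+1 | t != inord 1) num0 s a t)%N.
  by rewrite (bigD1 (inord 1)) //= i1 num0_1.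
by rewrite -E subnK.
Qed.

Definition csp_trans (s : 'I_nstates.+1) (a : 'I_Na.-1.+1) (t : 'I_nstates.+1) : rat :=
  (trans_num s a t)%:R / cDD%:R.

Lemma csp_trans_sum s a : \sum_t csp_trans s a t = 1.
Proof.
rewrite -mulr_suml -natr_sum sum_num // divff // pnatr_eq0 -lt0n.
exact: cDD_gt0.
Qed.

Lemma csp_trans_bounds s a t : 0 <= csp_trans s a t <= 1.
Proof.
have pos u : 0 <= csp_trans s a u by rewrite divr_ge0 ?ler0n.
rewrite pos -(csp_trans_sum s a) (bigD1 t) //= lerDl sumr_ge0 //.
Qed.

Definition csp_mdp : mdp := @MDP nstates Na.-1 csp_trans csp_trans_bounds
  (fun s => ex_intro _ ord0 (csp_trans_sum s ord0))
  (fun s a ne => False_ind _ (ne (csp_trans_sum s a))).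

Lemma csp_enabled (s : state csp_mdp) a : enabled s a.
Proof. by apply/eqP; exact: csp_trans_sum. Qed.

(** State 4 has no incoming transitions, so its membership changes no Buechi probability; as it is
    not absorbing, the boolean decides whether the target is. *)
Definition target (sink : nat) (b : bool) : {set state csp_mdp} :=
  [set s : 'I_nstates.+1 | (s == sink :> nat) || ~~ b && (s == 4 :> nat)].

(** From the common start 4 a fair coin leads to 5, where sink 2 is out of reach, or to 3, where
    sink 0 is out of reach. Both probabilities, and so their difference, are just halved. *)
Definition csp_pair (same abs1 abs2 : bool) : buechi_pair :=
  @BuechiPair csp_mdp (inord (if same then 4%N else 5%N))
    (inord (if same then 4%N else 3%N)) (target 0 abs1) (target 2 abs2).

Lemma csp_pair_shape same abs1 abs2 :
  pair_shape same abs1 abs2 (csp_pair same abs1 abs2).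
Proof.
have abs sink b : sink \in [:: 0%N; 2%N] -> absorbing (target sink b) = b.
  move=> sk; apply/forallP/idP => [H|->].
    apply: contraT => nb; have := H (inord 4); rewrite inE inordK // nb /= orbT /=.
    move=> /forallP/(_ ord0); rewrite csp_enabled /= /csp_trans /trans_num inordK //=.
    by rewrite /num0 /= mul0r eq_sym oner_eq0.
  move=> s; apply/implyP; rewrite inE /= orbF => /eqP sE; apply/forallP => a.
  rewrite csp_enabled /= /csp_trans /trans_num sE.
  have -> : (if sink == 1 then _ else num0 sink a sink) = cDD.
    by move: sk; rewrite !inE => /orP[]/eqP->; rewrite /num0 /= mul1n.
  by rewrite divff // pnatr_eq0 -lt0n cDD_gt0.
split; rewrite /= ?abs //.
by case: same; rewrite ?eqxx // -val_eqE /= !inordK.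
Qed.

Lemma picked_in kd a : (0 < size (tb kd))%N -> picked kd a \in tb kd.
Proof.
rewrite /picked; case: (tb kd) => //= b l _; have [ab|ab] := ltnP a (size (b :: l)).
  exact: mem_nth.
by rewrite nth_default // mem_head.
Qed.

Lemma tuple_codeE (l : seq nat) :
  tuple_code l = (\sum_(i < size l) nth 0 l i * G ^ i)%N.
Proof.
elim: l => [|a l IH] /=; first by rewrite big_ord0.
rewrite big_ord_recl /= muln1 IH big_distrl /=; congr addn.
by apply: eq_bigr => i _; rewrite expnSr mulnA.
Qed.

Section Values.
Variables (R : realType) (sigma : scheduler R csp_mdp).
Variable (d : state csp_mdp -> action csp_mdp).
Hypothesis sd : forall h s a, decision sigma h s a = (a == d s)%:R.
Local Notation P := (chain_prob R d).
Local Notation st x := (inord x%N : 'I_nstates.+1).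
Local Notation hp T x := (buechi_prob sigma (st x) T).

Lemma chain_probE s t : P s t = (trans_num s (d s) t)%:R / cDD%:R.
Proof. by rewrite /chain_prob /= /csp_trans fmorph_div /= !ratr_nat. Qed.

Lemma chain_prob_neq0 (s t : state csp_mdp) : P s t != 0 ->
  t = 1%N :> nat \/ num0 s (d s) t <> 0%N.
Proof.
rewrite chain_probE /trans_num; case: (nat_of_ord t =P 1%N) => [|_ H]; first by left.
by right=> E; rewrite E mul0r eqxx in H.
Qed.

(** The rejecting sink takes the remaining probability and contributes nothing, so only the explicit
    weights appear. *)
Lemma hp_num0 T x : (x < nstates.+1)%N -> hp T 1 = 0 ->
  hp T x = (\sum_(t < nstates.+1) (num0 x (d (st x)) t)%:R *
             buechi_prob sigma t T) / cDD%:R.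
Proof.
move=> xN h1; rewrite (buechi_harmonic sd) mulr_suml; apply: eq_bigr => t _.
rewrite chain_probE inordK // /trans_num; case: eqP => [t1|_]; last by rewrite mulrAC.
have -> : t = st 1 by apply: val_inj; rewrite /= inordK.
by rewrite h1 !(mulr0, mul0r).
Qed.

Let cDD_neq0 : cDD%:R != 0 :> R.
Proof. by rewrite pnatr_eq0 -lt0n cDD_gt0. Qed.

Lemma chain_prob_loop s t : P s s = 1 -> P s t != 0 -> t = s.
Proof.
move=> Pss Pst; apply/eqP; apply: contraT => ts.
have := chain_prob_sum sd s; rewrite (bigD1 s) //= Pss => /eqP.
rewrite -subr_eq0 addrAC subrr add0r psumr_eq0; last by move=> u _; exact: chain_prob_ge0.
by move=> /allP/(_ t (mem_index_enum _)); rewrite ts /= (negPf Pst).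
Qed.

Lemma sink_one sink b : sink \in [:: 0%N; 2%N] -> hp (target sink b) sink = 1.
Proof.
move=> sk; have sN : (sink < nstates.+1)%N.
  by move: sk; rewrite !inE => /orP[]/eqP->.
apply: (@buechi_one R csp_mdp sigma d sd _ (fun s => s == st sink) _ (fun=> 0%N)) => //.
  move=> s t /eqP-> Pst; apply/eqP; apply: chain_prob_loop Pst.
  rewrite chain_probE inordK // /trans_num.
  by move: sk; rewrite !inE => /orP[]/eqP->; rewrite /num0 /= mul1n divff.
by move=> s /eqP->; left; rewrite inE inordK // eqxx.
Qed.

Lemma hp_zero (T : {set state csp_mdp}) (C' : pred nat) : C' 1%N ->
  (forall s a t, C' s -> (s < nstates.+1)%N -> num0 s a t <> 0%N -> C' t) ->
  (forall s : 'I_nstates.+1, C' s -> s \notin T) ->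
  forall x, (x < nstates.+1)%N -> C' x -> hp T x = 0.
Proof.
move=> C1 Cc CT x xN Cx.
apply: (buechi_zero sd (C := fun s : 'I_nstates.+1 => C' s)) => //; last by rewrite inordK.
by move=> s t Cs /chain_prob_neq0[->//|]; apply: Cc.
Qed.

(** No choice of the scheduler enters, which is why a second, independent scheduler gains
    nothing. *)
Lemma reference_value b : hp (target 2 b) 3 = cX%:R^-1 /\
  hp (target 2 b) 4 = cX%:R^-1 / 2.
Proof.
(* All states except 2, 3 and 4 form a closed set that avoids the target. *)
have Z x : (x < nstates.+1)%N -> x \notin [:: 2%N; 3%N; 4%N] -> hp (target 2 b) x = 0.
  move=> xN xn; apply: (@hp_zero _ (fun x => x \notin [:: 2%N; 3%N; 4%N])) => //.
    move=> s a t; rewrite !inE => sn sN.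
    rewrite /num0; case: eqP => [_|s0]; first by case: eqP => [->|].
    case: eqP => [//|s1]; case: eqP => [s2|s2]; first by rewrite s2 in sn.
    case: eqP => [s3|s3]; first by rewrite s3 in sn.
    case: eqP => [s4|s4]; first by rewrite s4 in sn.
    case: ltnP => [s5|s5]; last first.
      by case: eqP => _; case: eqP => [->|].
    rewrite /row_num; case: (t =P 0%N) => [->//|t0].
    case: (t =P s.+1) => [->|ts]; first by lia.
    rewrite !mul0n !addn0 => H; have : has (fun i => nth 0%N
        (nth (0%N, [::]) C (s - 5)).2 i + (6 + nc) == t)%N (iota 0 r).
      apply: contra_notT H => /hasPn H; apply/eqP; rewrite sumnE big_map big1_seq //.
      by move=> i /andP[_ /H /negPf ->].
    by move=> /hasP[i _ /eqP <-]; lia.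
  move=> s; rewrite !inE => sn; apply: contra sn => /orP[->//|/andP[_ ->]].
  by rewrite !orbT.
have nz := cDD_neq0; rewrite /cDD !natrM !mulf_eq0 !negb_or in nz.
case/andP: nz => /andP[/andP[n2 nG] nX] nD.
have h1 := Z 1%N isT isT; have h2 : hp (target 2 b) 2 = 1 by exact: sink_one.
have h5 : hp (target 2 b) 5 = 0 by apply: Z; rewrite // /nstates; lia.
have h3 : hp (target 2 b) 3 = cX%:R^-1.
  rewrite hp_num0 // /num0 /=.
  under eq_bigr do rewrite natrM.
  rewrite (@sum_delta R 2 _ (fun t => buechi_prob sigma t (target 2 b))) // h2 mulr1.
  by rewrite /cDD !natrM reference_weight.
split=> //; rewrite hp_num0 // /num0 /=.
under eq_bigr do rewrite natrD mulrDl.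
rewrite big_split /=.
under eq_bigr do rewrite natrM.
rewrite (@sum_delta R 5 _ (fun t => buechi_prob sigma t (target 2 b))) ?h5 ?mulr0 ?add0r //.
under eq_bigr do rewrite natrM.
rewrite (@sum_delta R 3 _ (fun t => buechi_prob sigma t (target 2 b))) // h3.
by rewrite /cDD !natrM coin_weight.
Qed.

Definition csp_value (j : nat) : nat :=
  let a := nat_of_ord (d (st (6 + nc + j))) in if (a < G)%N then a else 0%N.

Lemma csp_value_lt j : (csp_value j < G)%N.
Proof. by rewrite /csp_value; case: ifP => [//|_]; exact: G0. Qed.

Definition csp_defect (k : nat) : int :=
  let c := nth (0%N, [::]) C k in
  (tuple_code (map csp_value c.2))%:Z - (picked c.1 (d (st (5 + k))))%:Z.

(** [e k] is the deviation of the value of row [k] from the reference [1 / cX]. The end of the chain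
    has exactly the reference value, and each row divides defect plus next deviation by [cD]. *)
Lemma chain_values b :
  hp (target 0 b) 4 = hp (target 0 b) 5 / 2 /\
  exists e : nat -> R, [/\ e 0%N = hp (target 0 b) 5 - cX%:R^-1, e nc = 0,
    (forall k, (k < nc)%N -> e k = ((csp_defect k)%:~R + e k.+1) / cD%:R) &
    forall k, `|e k| <= 1 - cX%:R^-1].
Proof.
have Z x : (x < nstates.+1)%N -> x \in [:: 1%N; 2%N; 3%N] -> hp (target 0 b) x = 0.
  move=> xN xn; apply: (@hp_zero _ (fun x => x \in [:: 1%N; 2%N; 3%N])) => //.
    move=> s a t; rewrite !inE => sn sN; rewrite /num0.
    by case/or3P: sn => /eqP-> /=; case: eqP => [->|].
  move=> s; rewrite !inE => /or3P[]/eqP->; by rewrite /= andbF.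
have h1 := Z 1%N isT isT; have h3 := Z 3%N isT isT.
have h0 : hp (target 0 b) 0 = 1 by exact: sink_one.
have nz := cDD_neq0; rewrite /cDD !natrM !mulf_eq0 !negb_or in nz.
case/andP: nz => /andP[/andP[n2 nG] nX] nD.
pose h t := buechi_prob sigma t (target 0 b).
split.
  rewrite hp_num0 // /num0 /=.
  under eq_bigr do rewrite natrD mulrDl.
  rewrite big_split /=.
  under eq_bigr do rewrite natrM.
  rewrite (@sum_delta R 5 _ h); last by rewrite /nstates; lia.
  under eq_bigr do rewrite natrM.
  rewrite (@sum_delta R 3 _ h) // [h (st 3)]h3 mulr0 addr0 -/(h (st 5)) /cDD !natrM.
  by rewrite coin_weight.
have hend : h (st (5 + nc)) = cX%:R^-1.
  rewrite /h hp_num0 ?/nstates; [|by lia|by []].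
  under eq_bigr do rewrite num0_end natrM.
  rewrite (@sum_delta R 0 _ h) // [h (st 0)]h0 mulr1 /cDD !natrM.
  by rewrite reference_weight.
have hcell j : (j < nv)%N -> h (st (6 + nc + j)) = (csp_value j)%:R / G%:R.
  move=> jv; rewrite /h hp_num0 ?/nstates; [|by lia|by []].
  under eq_bigr do rewrite num0_cell natrM.
  rewrite (@sum_delta R 0 _ h) // [h (st 0)]h0 mulr1 /cDD -/(csp_value j) !natrM.
  by rewrite cell_weight.
have hrow k : (k < nc)%N -> h (st (5 + k)) - cX%:R^-1 =
    ((csp_defect k)%:~R + (h (st (5 + k.+1)) - cX%:R^-1)) / cD%:R.
  move=> kn; rewrite {1}/h hp_num0 ?/nstates; [|by lia|by []].
  have En t : num0 (5 + k) (d (st (5 + k))) t = row_num (5 + k) (d (st (5 + k))) t.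
    by apply: num0_row; rewrite leq_addr ltn_add2l.
  under eq_bigr do rewrite En.
  have [cr cv /andP[c0 _] ca] := wf (mem_nth (0%N, [::]) kn).
  have := @sum_row R (5 + k) (d (st (5 + k))) h; rewrite addKn /nstates.
  move=> /(_ kn ltac:(lia)) /= ->; rewrite -/nstates.
  rewrite /csp_defect; set c := nth _ _ _ in cr cv c0 ca *.
  have -> : \sum_(i < r) (G ^ i.+1)%:R * h (inord (6 + nc + nth 0%N c.2 i)%N) =
      (tuple_code (map csp_value c.2))%:R.
    rewrite tuple_codeE size_map cr natr_sum; apply: eq_bigr => i _.
    have ir : (i < size c.2)%N by rewrite cr.
    rewrite hcell ?(allP cv) ?mem_nth // (nth_map 0%N) // expnSr !natrM.
    by rewrite -mulrA [G%:R * _]mulrC divfK // mulrC.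
  rewrite [h (st 0)]h0 mulr1 natrB; last exact: (allP ca _ (picked_in _ c0)).
  rewrite [(5 + k.+1)%N]addnS intrB -!pmulrn.
  by rewrite /cDD !natrM row_weight // /cD natrD natrM.
(* Beyond the end of the chain the deviation is set to 0, since the bound is claimed for every
   [k]. *)
exists (fun k => if (k <= nc)%N then h (st (5 + k)) - cX%:R^-1 else 0); split.
- by rewrite addn0.
- by rewrite leqnn hend subrr.
- by move=> k kn; rewrite kn (ltnW kn) hrow.
- have X2 : cX%:R^-1 <= 2^-1 :> R by rewrite lef_pV2 ?posrE ?ltr0n ?ler_nat.
  have X0 : 0 <= cX%:R^-1 :> R by rewrite invr_ge0 ler0n.
  move=> k; case: ifP => _; last by rewrite normr0; lra.
  have := buechi_ge0 sigma (st (5 + k)) (target 0 b).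
  have := buechi_le1 sigma (st (5 + k)) (target 0 b).
  rewrite -/(h _) ler_norml; move: (h _) (cX%:R^-1) X2 X0 => u v *.
  by apply/andP; split; lra.
Qed.

End Values.

Section Equivalence.
Variables (R : realType) (same abs1 abs2 : bool).
Local Notation Ip := (csp_pair same abs1 abs2).

(** A strict bound on the difference serves the exact problems and the approximate ones alike. The
    factor 2 pays for the coin at a common start. *)
Lemma csp_sat_of_values (s1 s2 : scheduler R (bp_mdp Ip)) :
  memoryless_deterministic s1 -> memoryless_deterministic s2 ->
  `|buechi_diff s1 s2| < (2 * (cX%:R * cD%:R ^+ nc))^-1 -> csp_sat.
Proof.
move=> [d1 sd1] [d2 sd2]; rewrite /buechi_diff /=.
have [h4 [e [e0 en eS eb]]] := chain_values sd1 abs1.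
have [k3 k4] := reference_value sd2 abs2.
have [X0 D0] : (0 < cX)%N /\ (0 < cD)%N by rewrite /cX /cD addn1.
have q0 : 0 < (cX%:R * cD%:R ^+ nc)^-1 :> R.
  by rewrite invr_gt0 mulr_gt0 ?exprn_gt0 ?ltr0n.
have -> : buechi_prob s1 (inord (if same then 4%N else 5%N)) (target 0 abs1) -
    buechi_prob s2 (inord (if same then 4%N else 3%N)) (target 2 abs2) =
    if same then e 0%N / 2 else e 0%N.
  by case: (same); rewrite e0 ?h4 ?k4 ?k3 // mulrBl.
move=> lt_e; have {}lt_e : `|e 0%N| < (cX%:R * cD%:R ^+ nc)^-1.
  move: lt_e; rewrite invfM; case: (same); last by move: q0; lra.
  by rewrite normrM [`|2^-1|]gtr0_norm ?invr_gt0 ?ltr0n // mulrC ltr_pM2l ?invr_gt0 ?ltr0n.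
case: (chain_gap X0 D0 en eS eb) => [[z0 _]|]; last by rewrite leNgt lt_e.
exists (csp_value d1); first exact: csp_value_lt.
move=> c cC; have := cC; rewrite -index_mem => kn.
have [_ _ /andP[c0 _] _] := wf cC.
have := z0 _ kn; rewrite /csp_defect nth_index // => /eqP.
by rewrite subr_eq0 eqz_nat => /eqP ->; exact: picked_in.
Qed.

Lemma csp_sat_values : csp_sat ->
  exists2 s1 : scheduler R (bp_mdp Ip),
    memoryless_deterministic s1 & buechi_diff s1 s1 = 0.
Proof.
move=> [v vG vC].
have NaE : Na.-1.+1 = Na by rewrite prednK // (leq_trans G0).
(* A variable state plays its value, a constraint state the position of its tuple in the table. At
   the remaining states, where truncated subtraction and default entries occur, all actions have the
   same effect. *)
pose d (s : state csp_mdp) : action csp_mdp := inord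
  (if (s < 6 + nc)%N then
     let c := nth (0%N, [::]) C (s - 5) in index (tuple_code (map v c.2)) (tb c.1)
   else v (s - (6 + nc)))%N.
have [s1 md sd] := @md_scheduler R csp_mdp d (fun s => csp_enabled s _).
exists s1 => //; rewrite /buechi_diff /=.
have [h4 [e [e0 en eS eb]]] := chain_values sd abs1.
have [k3 k4] := reference_value sd abs2.
suff e00 : e 0%N = 0.
  move: e0; rewrite e00 => /esym/eqP; rewrite subr_eq0 => /eqP h5.
  by case: (same); rewrite ?h4 ?h5 ?k3 ?k4 subrr.
apply: (chain_zero en eS) => k kn.
have cC := mem_nth (0%N, [::]) kn; have [cr cv /andP[c0 cNa] _] := wf cC.
rewrite /csp_defect; have := vC _ cC; set c := nth _ _ _ in cr cv c0 cNa cC * => vc.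
have -> : map (csp_value d) c.2 = map v c.2.
  apply/eq_in_map => j jc; have jv : (j < nv)%N := allP cv _ jc.
  have Es : nat_of_ord (inord (6 + nc + j) : 'I_nstates.+1) = (6 + nc + j)%N.
    by rewrite inordK // /nstates; lia.
  have dE : nat_of_ord (d (inord (6 + nc + j)%N)) = v j.
    rewrite /d Es ifF; last by lia.
    by rewrite addKn inordK ?NaE // (leq_trans (vG j)).
  by rewrite /csp_value dE vG.
have Es : nat_of_ord (inord (5 + k) : 'I_nstates.+1) = (5 + k)%N.
  by rewrite inordK // /nstates; lia.
rewrite /d Es ifT; last by lia.
rewrite addKn -/c inordK; last by rewrite NaE (leq_trans _ cNa) // index_mem.
by rewrite /picked nth_index // subrr.
Qed.

End Equivalence.
End ConstraintMDP.

End ConstraintGadgets.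
Import ConstraintGadgets.

(** * The tableau of a polynomial-time verifier as a constraint satisfaction problem *)

Module Tableaux.
Import all_classical all_reals all_analysis.
Section TupleCodes.
Variable G : nat.

Lemma tuple_code_lt (l : seq nat) : all (fun a => a < G) l ->
  tuple_code G l < G ^ size l.
Proof.
elim: l => //= a l IH /andP[aG /IH lG]; rewrite expnS.
have : tuple_code G l * G + G <= G ^ size l * G.
  by rewrite -mulSnr leq_mul2r lG orbT.
by rewrite [G * _]mulnC; lia.
Qed.

Lemma tuple_code_inj (l l' : seq nat) : size l = size l' ->
  all (fun a => a < G) l -> all (fun a => a < G) l' ->
  tuple_code G l = tuple_code G l' -> l = l'.
Proof.
elim: l l' => [|a l IH] [|b l'] //= [sl] /andP[aG lG] /andP[bG lG'] E.
have ab : a = b.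
  have := congr1 (modn ^~ G) E => /=.
  by rewrite ![_ + _ * G]addnC !modnMDl !modn_small.
move: E; rewrite ab => /addnI/eqP; rewrite eqn_pmul2r; last by case: G aG.
by move=> /eqP /IH ->.
Qed.

End TupleCodes.

Lemma horner_nat_mono (p : {poly nat}) m n : m <= n -> p.[m]%R <= p.[n]%R.
Proof.
move=> le_mn; rewrite !horner_coef; apply: leq_sum => i _.
by rewrite leq_mul // leq_exp2rW.
Qed.

Lemma pt_horner (X : encType) (p : {poly nat}) (f : X -> nat) :
  pt f -> pt (fun x => (p.[f x])%R : nat).
Proof.
move=> pf; rewrite /horner; elim: (polyseq p) => [|a l IH] /=; first exact: pt_const.
by apply: (@pt_addn _ (fun x => horner_rec l (f x) * f x) (fun=> a));
  [exact: pt_muln|exact: pt_const].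
Qed.

Lemma odd_bit (b : bool) m : odd (b + 2 * m) = b.
Proof. by rewrite mul2n oddD odd_double addbF; case: b. Qed.

Lemma half_bit (b : bool) m : (b + 2 * m)./2 = m.
Proof. by case: b; rewrite mul2n /= ?add1n /= ?uphalf_double ?doubleK. Qed.

Lemma pt_double (X : encType) (f : X -> nat) : pt f -> pt (fun x => (f x).*2).
Proof. by move=> pf; apply: (pt_recode _ (pt_addn pf pf)) => x; rewrite addnn. Qed.

Section Tableau.
Variables (A : finType) (M : tm (A + bool)%type bool).
Local Notation ntapes := (tm_extra M).+1.

(** Coordinates are relative to the head, which always stands at [W]; a move shifts the tape
    instead. Several tapes thus need no record of their head positions. *)
Definition tape_at (W : nat) (t : tm_tape M) (j : nat) : tm_symbol M :=
  if W <= j then nth None t.2 (j - W) else nth None t.1 (W - j).-1.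

(* A tableau cell: the control state, whether the heads are here, and the symbols
   of all tapes at a given offset from their heads. *)
Definition cell_type : finType :=
  (tm_state M * bool * {ffun 'I_ntapes -> tm_symbol M})%type.

Definition cell (W : nat) (c : tm_config M) (j : nat) : cell_type :=
  (c.1, j == W, [ffun i => tape_at W (c.2 i) j]).

(** The new cell depends on the head cell [h], which determines the action, and on three neighbours,
    of which a move selects one; the head cell is first overwritten. New cell and these four
    arguments give arity 5. *)
Definition next_cell (h a b c : cell_type) : cell_type :=
  if tm_delta h.1.1 h.2 is Some (q, act) then
    (q, b.1.2, [ffun i =>
      let written (x : cell_type) := if x.1.2 then (act i).1 else x.2 i in
      match (act i).2 with
      | MoveLeft => written a | Stay => written b | MoveRight => written c
      end])
  else b.

Definition tm_next_config (c : tm_config M) := odflt c (tm_next c).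

Lemma cell_next W c j : 0 < j -> cell W (tm_next_config c) j =
  next_cell (cell W c W) (cell W c j.-1) (cell W c j) (cell W c j.+1).
Proof.
move=> j0; rewrite /next_cell /tm_next_config /tm_next /=.
have -> : [ffun i => tape_at W (c.2 i) W] = [ffun i => tape_read (c.2 i)].
  by apply/ffunP => i; rewrite !ffunE /tape_at leqnn subnn /tape_read nth0.
case: (tm_delta _ _) => [[q act]|] //=; rewrite /cell /=; congr (_, _, _).
apply/ffunP => i; rewrite !ffunE; case: (c.2 i) => l r; case: (act i) => s mv.
rewrite /tape_at /tape_act; case: mv => /=.
- case: (ltngtP W j) => [Wj|jW|E].
  + rewrite [RHS](_ : _ = if j == W.+1 then s else nth None r (j.-1 - W)); last first.
      case: (j =P W.+1) => [->|ne]; first by rewrite /= eqxx.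
      by rewrite (_ : (j.-1 == W) = false) ?ifT //; lia.
    case: eqP => [->|ne]; first by rewrite subSn // subnn.
    have -> : j - W = (j.-1 - W).-1.+2 by lia.
    rewrite /= nth_behead; congr nth; lia.
  + rewrite (_ : (_ == W) = false) ?ifF; try lia.
    rewrite nth_behead; congr nth; lia.
  + rewrite -E subnn /= (_ : (_ == W) = false) ?ifF; try lia.
    by rewrite -nth0; congr nth; lia.
- case: (ltngtP W j) => [Wj|jW|E] //.
    have -> : j - W = (j - W).-1.+1 by lia.
    by rewrite /= nth_behead.
  by rewrite E subnn.
- case: (ltngtP W j) => [Wj|jW|E].
  + rewrite (_ : (_ == W) = false) ?ifT; try lia.
    by rewrite nth_behead; congr nth; lia.
  + case: eqP => [E|ne]; first by rewrite (_ : (W - j).-1 = 0) //; lia.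
    rewrite ifF; last by lia.
    have -> : (W - j).-1 = (W - j.+1).-1.+1 by lia.
    by [].
  + rewrite -E (_ : (_ == W) = false) ?ifT; try lia.
    by rewrite nth_behead; congr nth; lia.
Qed.

Definition symbol0 (a : cell_type) : tm_symbol M := a.2 ord0.

(* [k./2] is the class of the symbol on the input tape: blank, certificate, or
   the input symbol with a given index; the parity of [k] is the head flag. *)
Definition init_ok (k : nat) (a : cell_type) : bool :=
  [&& a.1.1 == tm_start M, a.1.2 == odd k,
      [forall i, (i != ord0) ==> (a.2 i == None)] &
      match k./2 with
      | 0 => symbol0 a == None
      | 1 => match symbol0 a with
             | None | Some (inl (inl (inr _))) => true | _ => false end
      | n.+2 => if symbol0 a is Some (inl (inl (inl b)))
                then enum_rank b == n :> nat else false
      end].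

(** Kind 0 is a computation step, kind 2 acceptance on the output tape, and kinds from 3 on describe
    initial cells. Kind 1 forbids a nonblank symbol right after a blank: the certificate is guessed
    cell by cell and must form a word. *)
Definition kind_ok (kd : nat) (w : 5.-tuple cell_type) : bool :=
  let a i := tnth w (inord i) in
  match kd with
  | 0 => a 0 == next_cell (a 1) (a 2) (a 3) (a 4)
  | 1 => ~~ ((symbol0 (a 0) == None) && (symbol0 (a 1) != None))
  | 2 => (a 0).2 ord_max == Some (inl (inr true))
  | k.+3 => init_ok k (a 0)
  end.

Definition G := #|cell_type|.
Definition rk (a : cell_type) : nat := enum_rank a.
Definition nkinds := 3 + 2 * (2 + #|A|).

(* The extra code [G ^ 5] matches no tuple and keeps the tables nonempty. *)
Definition tables : seq (seq nat) :=
  [seq G ^ 5 :: [seq tuple_code G (map rk w)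
                 | w : 5.-tuple cell_type <- [seq w <- enum {: 5.-tuple cell_type} | kind_ok kd w]]
  | kd <- iota 0 nkinds].

Lemma rk_lt a : rk a < G.
Proof. exact: ltn_ord. Qed.

Lemma all_rk (w : seq cell_type) : all (fun a => a < G) (map rk w).
Proof. by apply/allP => _ /mapP[a _ ->]; exact: rk_lt. Qed.

Lemma mem_tables kd (w : 5.-tuple cell_type) : kd < nkinds ->
  (tuple_code G (map rk w) \in nth [::] tables kd) = kind_ok kd w.
Proof.
move=> kdn; rewrite (nth_map 0) ?size_iota // nth_iota // inE.
have := tuple_code_lt (all_rk w); rewrite size_map size_tuple => lt.
rewrite (ltn_eqF lt) /=; apply/mapP/idP => [[w' w'k E]|wk].
  suff <- : w' = w by move: w'k; rewrite mem_filter => /andP[].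
  apply: val_inj; apply: (inj_map (f := rk)).
    by move=> a b /val_inj/enum_rank_inj.
  by apply/esym; apply: tuple_code_inj E; rewrite ?all_rk // !size_map !size_tuple.
by exists w => //; rewrite mem_filter wk mem_enum.
Qed.

Lemma size_tables kd : size (nth [::] tables kd) <= (#|{: 5.-tuple cell_type}|).+1.
Proof.
have [kdn|kdn] := ltnP kd nkinds; last first.
  by rewrite nth_default // size_map size_iota.
rewrite (nth_map 0) ?size_iota // [size _]/= ltnS size_map size_filter.
by apply: leq_trans (count_size _ _) _; rewrite -cardE.
Qed.

Lemma leq_tables kd : all (fun k => k <= G ^ 5) (nth [::] tables kd).
Proof.
have [kdn|kdn] := ltnP kd nkinds; last first.
  by rewrite nth_default // size_map size_iota.
rewrite (nth_map 0) ?size_iota // /= leqnn /=; apply/allP => _ /mapP[w _ ->].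
by have := tuple_code_lt (all_rk w); rewrite size_map size_tuple => /ltnW.
Qed.

Variables (p q : {poly nat}).

Section Instance.
Variable (xs : seq nat).
Let n := size xs.
Definition cert_len := (p.[size xs])%R : nat.
Definition run_len := (q.[size xs + cert_len])%R : nat.
(** The head column keeps more than [run_len] columns on either side, so disturbances from the
    border cannot reach it in time, and enough columns to its right for input and certificate. *)
Definition mid := (run_len + size xs + cert_len).+1.
Definition width := mid.*2.+1.
Definition idx t j := t * width + j.

Definition init_class (j : nat) : nat :=
  ((j == mid) : nat) + 2 *
    (if j < mid then 0
     else if j < mid + size xs then 2 + nth 0 xs (j - mid)
     else if j < mid + size xs + cert_len then 1 else 0).
Definition init_kind (j : nat) : nat := (init_class j).+3.

(** The two border columns lack a neighbour and get no step constraint; errors that enter there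
    advance by one column per step. *)
Definition step_constraints := flatten [seq [seq (0, [:: idx t.+1 j; idx t mid; idx t j.-1;
  idx t j; idx t j.+1]) | j <- iota 1 mid.*2.-1] | t <- iota 0 run_len].
Definition init_constraints := [seq (init_kind j, nseq 5 (idx 0 j)) | j <- iota 0 width].
Definition adj_constraints := [seq (1, [:: idx 0 j; idx 0 j.+1; idx 0 j.+1; idx 0 j.+1;
  idx 0 j.+1]) | j <- iota (mid + size xs) cert_len].
Definition tableau : csp :=
  (run_len.+1 * width,
   step_constraints ++ init_constraints ++ adj_constraints ++
   [:: (2, nseq 5 (idx run_len mid))]).

Lemma idx_lt t j : t <= run_len -> j < width -> idx t j < run_len.+1 * width.
Proof.
move=> tT jw; rewrite /idx mulSnr; apply: (@leq_trans (t * width + width)).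
  by rewrite ltn_add2l.
by rewrite leq_add2r leq_mul2r tT orbT.
Qed.

Lemma mem_tableau c : c \in tableau.2 ->
  [\/ exists t j, [/\ t < run_len, 0 < j < mid.*2 & c = (0, [:: idx t.+1 j; idx t mid;
        idx t j.-1; idx t j; idx t j.+1])],
      exists2 j, j < width & c = (init_kind j, nseq 5 (idx 0 j)),
      exists2 j, mid + size xs <= j < mid + size xs + cert_len &
        c = (1, [:: idx 0 j; idx 0 j.+1; idx 0 j.+1; idx 0 j.+1; idx 0 j.+1]) |
      c = (2, nseq 5 (idx run_len mid))].
Proof.
rewrite -[tableau.2]/(step_constraints ++ init_constraints ++ adj_constraints ++
  [:: (2, nseq 5 (idx run_len mid))]) !mem_cat mem_seq1.
move=> /or4P[|||/eqP ->]; last by constructor 4.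
- move=> /flattenP[_ /mapP[t tT ->] /mapP[j jw ->]]; constructor 1; exists t, j.
  move: tT jw; rewrite !mem_iota => tT jw; split=> //.
- by move=> /mapP[j jw ->]; constructor 2; exists j => //; rewrite mem_iota in jw.
- by move=> /mapP[j jw ->]; constructor 3; exists j => //; rewrite mem_iota in jw.
Qed.

Lemma tableau_mem c :
  [\/ exists t j, [/\ t < run_len, 0 < j < mid.*2 & c = (0, [:: idx t.+1 j; idx t mid;
        idx t j.-1; idx t j; idx t j.+1])],
      exists2 j, j < width & c = (init_kind j, nseq 5 (idx 0 j)),
      exists2 j, mid + size xs <= j < mid + size xs + cert_len &
        c = (1, [:: idx 0 j; idx 0 j.+1; idx 0 j.+1; idx 0 j.+1; idx 0 j.+1]) |
      c = (2, nseq 5 (idx run_len mid))] -> c \in tableau.2.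
Proof.
rewrite -[tableau.2]/(step_constraints ++ init_constraints ++ adj_constraints ++
  [:: (2, nseq 5 (idx run_len mid))]) !mem_cat mem_seq1.
move=> [[t [j [tT jw ->]]]|[j jw ->]|[j jw ->]|->]; last by rewrite eqxx !orbT.
- apply/orP; left; apply/flattenP.
  exists [seq (0, [:: idx t.+1 j; idx t mid; idx t j.-1; idx t j; idx t j.+1])
         | j <- iota 1 mid.*2.-1].
    by apply/mapP; exists t => //; rewrite mem_iota.
  by apply/mapP; exists j => //; rewrite mem_iota; lia.
- apply/orP; right; apply/orP; left.
  by apply/mapP; exists j => //; rewrite mem_iota.
- apply/orP; right; apply/orP; right; apply/orP; left.
  by apply/mapP; exists j => //; rewrite mem_iota.
Qed.

Hypothesis xsA : all (fun k => k < #|A|) xs.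

Lemma init_kind_lt j : init_kind j < nkinds.
Proof.
rewrite /init_kind /init_class /nkinds; have [jm|jm] := ltnP j mid; first by case: eqP; lia.
have [jn|jn] := ltnP j (mid + size xs); last by case: ifP; case: eqP; lia.
have jx : j - mid < size xs by lia.
have : nth 0 xs (j - mid) < #|A| := allP xsA _ (mem_nth 0 jx).
by case: eqP; lia.
Qed.

Lemma tableau_wf : csp_wf G 5 (G + (#|{: 5.-tuple cell_type}|).+1) (nth [::] tables) tableau.
Proof.
move=> c cT; have ok kd l : kd < nkinds -> size l = 5 ->
    all (fun j => j < tableau.1) l -> c = (kd, l) ->
    [/\ size c.2 = 5, all (fun j => j < tableau.1) c.2,
      0 < size (nth [::] tables c.1) <= G + (#|{: 5.-tuple cell_type}|).+1 &
      all (fun k => k <= G ^ 5) (nth [::] tables c.1)].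
  move=> kdn l5 lv ->; split=> //=; last exact: leq_tables.
  apply/andP; split; last exact: leq_trans (size_tables kd) (leq_addl _ _).
  by rewrite (nth_map 0) ?size_iota.
have mw : mid < width by rewrite /width; lia.
case: (mem_tableau cT) => [[t [j [tT jw]]]|[j jw]|[j jw]|] cE; apply: ok cE => //.
- by rewrite /= !idx_lt //; rewrite /width; lia.
- exact: init_kind_lt.
- by rewrite /= !idx_lt.
- by rewrite /= !idx_lt //; rewrite /width /mid in jw *; lia.
- by rewrite /= !idx_lt.
Qed.

End Instance.

Section Correctness.
Variable (x : seq A).
Let xs := [seq enum_rank a : nat | a <- x].
Local Notation T := (run_len xs).
Local Notation W := (mid xs).
Local Notation L := (cert_len xs).
Local Notation wd := (width xs).
Local Notation word c := (map inl x ++ map inr c : seq (A + bool)).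
Local Notation conf c t := (tm_run t (tm_init M (word c))).

Lemma size_xs : size xs = size x.
Proof. exact: size_map. Qed.

Lemma xs_lt : all (fun k => k < #|A|) xs.
Proof. by apply/allP => _ /mapP[a _ ->]; exact: ltn_ord. Qed.

Definition input_symbol (c : seq bool) (j : nat) : tm_symbol M :=
  nth None [seq Some (inl (inl a)) | a <- word c] j.

Lemma cell_init c j : cell W (tm_init M (word c)) j =
  (tm_start M, j == W, [ffun i => if (i == ord0) && (W <= j)
     then input_symbol c (j - W) else None]).
Proof.
rewrite /cell /=; congr (_, _, _); apply/ffunP => i; rewrite !ffunE /tape_at.
by case: eqP => _ /=; case: leqP => _; rewrite ?nth_nil.
Qed.

Lemma input_symbol_word c i (b : A) : i < size x -> 
  input_symbol c i = Some (inl (inl (inl (nth b x i)))).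
Proof.
move=> ix; rewrite /input_symbol map_cat nth_cat !size_map ix -map_comp.
by rewrite (nth_map b).
Qed.

Lemma input_symbol_cert c i : size x <= i ->
  input_symbol c i = nth None [seq Some (inl (inl (inr b))) | b <- c] (i - size x).
Proof.
move=> ix; rewrite /input_symbol map_cat nth_cat !size_map ltnNge ix /=.
by rewrite -map_comp.
Qed.

Lemma init_okP (c : seq bool) (a : cell_type) j : j < wd -> size c <= L ->
  (forall i, i < L -> symbol0 a = input_symbol c (size x + i) \/ j <> W + size x + i) ->
  init_ok (init_class xs j) a -> a = cell W (tm_init M (word c)) j.
Proof.
move=> jw cL H; rewrite cell_init /init_class size_xs.
case: a H => [[st fl] sy] H /and4P[/=]; rewrite odd_bit half_bit.
move=> /eqP -> /eqP -> /forallP sn; rewrite /symbol0 /= => kok.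
congr (_, _, _); apply/ffunP => i; rewrite ffunE; case: eqP => [->|/eqP ne] /=; last first.
  by have := sn i; rewrite ne => /eqP.
have [jW|jW] := ltnP j W; first by rewrite jW in kok; exact/eqP.
rewrite ltnNge jW /= in kok.
have [jn|jn] := ltnP j (W + size x).
  rewrite jn /= in kok; case E: (sy ord0) kok => [[[[b|]|]|]|] //= /eqP bE.
  have jx : j - W < size x by lia.
  rewrite (input_symbol_word c b jx); congr (Some (inl (inl (inl _)))).
  apply: enum_rank_inj; apply: val_inj; rewrite /= bE.
  by rewrite (nth_map b).
rewrite ltnNge jn /= in kok.
have [jL|jL] := ltnP j (W + size x + L).
  case: (H (j - W - size x)); [by lia| |by lia].
  by rewrite /symbol0 /= => ->; congr input_symbol; lia.
rewrite ltnNge jL /= in kok; rewrite (eqP kok) input_symbol_cert; last by lia.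
by rewrite nth_default // size_map; lia.
Qed.

Lemma init_ok_init c j : size c <= L ->
  init_ok (init_class xs j) (cell W (tm_init M (word c)) j).
Proof.
move=> cL; rewrite cell_init /init_class size_xs /init_ok odd_bit half_bit.
rewrite /symbol0 /= !eqxx !ffunE /=.
apply/andP; split.
  by apply/forallP => i; apply/implyP => /negPf ne; rewrite ffunE ne.
have [jW|jW] := ltnP j W; first by [].
have [jn|jn] := ltnP j (W + size x).
  have jx : j - W < size x by lia.
  have [b _] : exists b : A, true by case: (x) jx => // b *; exists b.
  by rewrite (input_symbol_word c b jx) /= (nth_map b).
rewrite input_symbol_cert; last by lia.
have [jc|jc] := ltnP (j - W - size x) (size c); last first.
  by rewrite nth_default ?size_map //; case: ifP.
rewrite ifT; last by lia.
by rewrite (nth_map true).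
Qed.

Lemma kind_ok_nseq kd a : 1 < kd ->
  kind_ok kd [tuple a; a; a; a; a] =
  if kd is k.+3 then init_ok k a else a.2 ord_max == Some (inl (inr true)).
Proof. by case: kd => [|[|[|k]]] //= _; rewrite (tnth_nth a) /= inordK. Qed.

Lemma tableau_complete c : size c <= L ->
  tape_read ((conf c T).2 ord_max) = Some (inl (inr true)) ->
  csp_sat G (nth [::] tables) (tableau xs).
Proof.
move=> cL acc.
pose g t j := cell W (conf c t) j.
exists (fun m => rk (g (m %/ wd) (m %% wd))); first by move=> m; exact: rk_lt.
have gE t j : j < wd -> rk (g (idx xs t j %/ wd) (idx xs t j %% wd)) = rk (g t j).
  by move=> jw; rewrite /idx divnMDl // modnMDl divn_small // modn_small // addn0.
have Ww : W < wd by rewrite /width; lia.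
move=> e /mem_tableau[[t [j [tT jw ->]]]|[j jw ->]|[j jw ->]|->].
- have h : kind_ok 0 [tuple g t.+1 j; g t W; g t j.-1; g t j; g t j.+1].
    rewrite /kind_ok !(tnth_nth (g t W)) !inordK //=.
    by rewrite /g /= -cell_next //; lia.
  have := mem_tables (kd := 0) [tuple g t.+1 j; g t W; g t j.-1; g t j; g t j.+1] isT.
  by rewrite h /= !gE //; rewrite /width; lia.
- have := mem_tables [tuple g 0 j; g 0 j; g 0 j; g 0 j; g 0 j] (init_kind_lt xs_lt j).
  rewrite kind_ok_nseq // [RHS](_ : _ = true) /= ?gE //.
  exact: (init_ok_init j cL).
- have jw' : j < wd /\ j.+1 < wd by rewrite /width /mid in jw *; lia.
  have := mem_tables (kd := 1) [tuple g 0 j; g 0 j.+1; g 0 j.+1; g 0 j.+1; g 0 j.+1] isT.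
  rewrite [RHS](_ : _ = true) /= ?gE //; try (by case: jw').
  rewrite /kind_ok !(tnth_nth (g 0 j)) !inordK //= /g /= !cell_init /symbol0 /= !ffunE.
  rewrite size_xs in jw; rewrite eqxx /= !ifT; try lia.
  rewrite !input_symbol_cert; try lia.
  have -> : j.+1 - W - size x = (j - W - size x).+1 by lia.
  have [jc|jc] := ltnP (j - W - size x) (size c).
    by rewrite (nth_map true).
  by rewrite !nth_default // size_map // leqW.
- have := mem_tables (kd := 2) [tuple g T W; g T W; g T W; g T W; g T W] isT.
  rewrite kind_ok_nseq // [RHS](_ : _ = true) /= ?gE //.
  rewrite /g /cell /= ffunE /tape_at leqnn subnn nth0; exact/eqP.
Qed.

Lemma certificate_of (f : nat -> tm_symbol M) N :
  (forall i, i < N -> f i = None \/ exists b, f i = Some (inl (inl (inr b)))) ->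
  (forall i, i.+1 < N -> f i = None -> f i.+1 = None) ->
  exists2 c : seq bool, size c <= N &
    forall i, i < N -> f i = nth None [seq Some (inl (inl (inr b))) | b <- c] i.
Proof.
elim: N => [|N IH] Hf Hn; first by exists [::].
have [c cN cE] : exists2 c : seq bool, size c <= N &
    forall i, i < N -> f i = nth None [seq Some (inl (inl (inr b))) | b <- c] i.
  by apply: IH => i iN; [apply: Hf|apply: Hn]; exact: ltnW.
have [fN|[b fN]] := Hf N (ltnSn N).
  exists c; first exact: leqW.
  move=> i; rewrite ltnS leq_eqVlt => /orP[/eqP ->|/cE//].
  by rewrite fN nth_default // size_map.
(* A shorter word would leave a blank just before position [N], and a blank may not be followed by a
   bit. *)
have cNE : size c = N.
  apply/eqP; rewrite eqn_leq cN leqNgt; apply/negP => lt.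
  case: N lt fN Hn cE {IH Hf cN} => // N lt fN Hn cE.
  have := cE N (ltnSn N); rewrite nth_default ?size_map // => /Hn.
  by rewrite fN => /(_ (ltnSn _)).
exists (rcons c b); first by rewrite size_rcons cNE.
move=> i; rewrite map_rcons nth_rcons size_map cNE ltnS leq_eqVlt.
case/orP => [/eqP ->|iN]; first by rewrite ltnn eqxx.
by rewrite iN; exact: cE.
Qed.

(** The certificate is read off the initial row. The later rows are forced to be the configurations
    of the run, but only within a window that shrinks with time. *)
Lemma tableau_sound : csp_sat G (nth [::] tables) (tableau xs) ->
  exists2 c, size c <= L &
    tape_read ((conf c T).2 ord_max) = Some (inl (inr true)).
Proof.
move=> [v vG vC]; pose g t j : cell_type := enum_val (Ordinal (vG (idx xs t j))).
have gE t j : v (idx xs t j) = rk (g t j) by rewrite /rk /g enum_valK.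
have Ww : W < wd by rewrite /width; lia.
have Hstep t j : t < T -> 0 < j < W.*2 ->
    g t.+1 j = next_cell (g t W) (g t j.-1) (g t j) (g t j.+1).
  move=> tT jw; have := vC _ (tableau_mem (Or41 _ _ _ (ex_intro _ t (ex_intro _ j
    (And3 tT jw erefl))))).
  have := mem_tables (kd := 0) [tuple g t.+1 j; g t W; g t j.-1; g t j; g t j.+1] isT.
  rewrite /= !gE => -> ; rewrite /kind_ok !(tnth_nth (g t W)) !inordK //=.
  by move/eqP.
have Hinit j : j < wd -> init_ok (init_class xs j) (g 0 j).
  move=> jw; have := vC _ (tableau_mem (Or42 _ _ _ (ex_intro2 _ _ j jw erefl))).
  have := mem_tables [tuple g 0 j; g 0 j; g 0 j; g 0 j; g 0 j] (init_kind_lt xs_lt j).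
  by rewrite kind_ok_nseq //= !gE => ->.
have Hadj j : W + size xs <= j < W + size xs + L ->
    symbol0 (g 0 j) = None -> symbol0 (g 0 j.+1) = None.
  move=> jw; have := vC _ (tableau_mem (Or43 _ _ _ (ex_intro2 _ _ j jw erefl))).
  have := mem_tables (kd := 1) [tuple g 0 j; g 0 j.+1; g 0 j.+1; g 0 j.+1; g 0 j.+1] isT.
  rewrite /= !gE => ->; rewrite /kind_ok !(tnth_nth (g 0 j)) !inordK //=.
  by move=> H E; move: H; rewrite E eqxx /= negbK => /eqP.
have Hacc : (g T W).2 ord_max = Some (inl (inr true)).
  have := vC _ (tableau_mem (Or44 _ _ _ erefl)).
  have := mem_tables (kd := 2) [tuple g T W; g T W; g T W; g T W; g T W] isT.
  by rewrite kind_ok_nseq //= !gE => -> /eqP.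
have [c cL cE] : exists2 c : seq bool, size c <= L & forall i, i < L ->
    symbol0 (g 0 (W + size x + i)) = nth None [seq Some (inl (inl (inr b))) | b <- c] i.
  apply: certificate_of => i iL.
    have jw : W + size x + i < wd by rewrite /width /mid size_xs in iL *; lia.
    have /and4P[_ _ _] := Hinit _ jw; rewrite /init_class size_xs half_bit.
    rewrite ifF; last by lia.
    rewrite ifF; last by lia.
    rewrite ifT; last by lia.
    by case: (symbol0 _) => [[[[]|]|]|] //; [right; eexists|left].
  by rewrite addnS; apply: Hadj; rewrite size_xs; lia.
exists c => //.
(* Row [t] is correct in the columns at distance at most [W - t] from the head; the head column
   survives all [run_len] steps. *)
have H t : t <= T -> forall j, t <= j <= W.*2 - t -> g t j = cell W (conf c t) j.
  elim: t => [|t IH] tT j jw.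
    have jwd : j < wd by rewrite /width; lia.
    apply: (init_okP jwd cL); last exact: Hinit.
    move=> i iL; case: (j =P W + size x + i) => [->|]; [left|by right].
    by rewrite cE // input_symbol_cert ?leq_addr // addKn.
  have tW : t < W by move: tT; rewrite /mid; lia.
  rewrite Hstep //; last by lia.
  rewrite !IH; try lia.
  by rewrite -[conf c t.+1]/(tm_next_config (conf c t)) cell_next //; lia.
have TW : T <= W <= W.*2 - T by rewrite /mid; lia.
move: Hacc; rewrite (H T (leqnn _) W TW) /cell /= ffunE /tape_at leqnn subnn.
by rewrite nth0.
Qed.

End Correctness.

Lemma pt_cert_len : pt cert_len.
Proof. by rewrite /cert_len; apply: (@pt_horner _ p (fun xs : seq nat => size xs)); pt_solve. Qed.

Lemma pt_run_len : pt run_len.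
Proof.
rewrite /run_len; apply: (@pt_horner _ q (fun xs => size xs + cert_len xs)).
by have h := pt_cert_len; pt_solve.
Qed.

Lemma pt_mid : pt mid.
Proof. by have h1 := pt_cert_len; have h2 := pt_run_len; rewrite /mid; pt_solve. Qed.

Lemma pt_width : pt width.
Proof. by have h1 := pt_mid; rewrite /width; apply: pt_succn; exact: pt_double. Qed.

Ltac pt_ext ::= lazymatch goal with
  | |- pt (fun x => binary (nb (@?f x))) => apply: pt_nbinary
  | |- pt (fun x => binary (@?f x)) => apply: pt_binary
  | |- pt (fun x => Bn (@?f x)) => apply: pt_Bn
  | |- pt (fun x => double (@?f x)) => apply: pt_double
  | |- pt (fun x => cert_len (@?f x)) => apply: (pt_comp pt_cert_len)
  | |- pt (fun x => run_len (@?f x)) => apply: (pt_comp pt_run_len)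
  | |- pt (fun x => mid (@?f x)) => apply: (pt_comp pt_mid)
  | |- pt (fun x => width (@?f x)) => apply: (pt_comp pt_width)
  end.

Lemma pt_tableau : pt tableau.
Proof.
rewrite /tableau /step_constraints /init_constraints /adj_constraints /init_kind
  /init_class /idx.
by pt_solve.
Qed.

End Tableau.

(** Alphabet size, action bound and tables are chosen before the word: they depend on the language
    only, and only the list of constraints varies. *)
Lemma NP_reduces_to_csp (A : finType) (K : language A) : NP K ->
  exists (G Na : nat) (tbl : seq (seq nat)) (inst : seq nat -> csp),
    [/\ 0 < G, G <= Na, pt inst &
      forall x : seq A, let xs := [seq enum_rank a : nat | a <- x] in
        csp_wf G 5 Na (nth [::] tbl) (inst xs) /\ (K x <-> csp_sat G (nth [::] tbl) (inst xs))].
Proof.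
move=> [V [p [[M [q Mq]] KV]]].
exists (G M), (G M + (#|{: 5.-tuple (cell_type M)}|).+1), (tables M), (tableau p q).
have G0 : 0 < G M.
  by apply/card_gt0P; exists (tm_start M, true, [ffun=> None]).
split=> //; [exact: leq_addr|exact: pt_tableau|move=> x xs].
split; first by apply: tableau_wf; exact: xs_lt.
have run c : size c <= cert_len p xs ->
    tm_output (tm_run (run_len p q xs) (tm_init M (map inl x ++ map inr c))) =
    [:: V (map inl x ++ map inr c)].
  move=> cL; have [n [nq halt out]] := Mq (map inl x ++ map inr c).
  have nT : n <= run_len p q xs.
    apply: leq_trans nq _; rewrite /run_len size_cat !size_map.
    by apply: horner_nat_mono; rewrite leq_add2l.
  (* The verifier may halt early; a halted configuration repeats, so its output is still there after
     exactly [run_len] steps. *)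
  rewrite -out -(subnK nT) /tm_run iterD; congr tm_output.
  elim: (_ - n) => //= k ->; move: halt; rewrite /tm_halted /tm_run.
  by move: (iter n _ _) => cf ->.
split=> [/KV[c [cL Vc]]|].
  apply: (@tableau_complete _ M p q x c); first by rewrite /cert_len size_map.
  have := run c; rewrite Vc /tm_output /tape_read /cert_len size_map => /(_ cL).
  case: ((tm_run _ _).2 ord_max) => l [|[[[]|]|] r] //=.
  by move=> b [-> _].
move=> /tableau_sound[c cL acc]; apply/KV; exists c.
split; first by move: cL; rewrite /cert_len size_map.
have := run c cL; move: acc; rewrite /tm_output /tape_read.
by case: ((tm_run _ _).2 ord_max) => l [|a r] //= -> [].
Qed.

End Tableaux.
Import Tableaux.

(** * From constraint problems to encoded instances *)

Module Reductions.
Import all_classical all_reals all_analysis.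
Import Order.TTheory GRing.Theory Num.Theory.

Lemma unary_inj : injective unary.
Proof. by move=> m n /(congr1 size); rewrite !size_nseq. Qed.

Lemma binary_inj : injective binary.
Proof. exact: can_inj bitval_binary. Qed.

Lemma write_inj digits : injective digits -> injective (write digits).
Proof.
move=> dI; have split (l l' : seq bool) u u' :
    rcons (map Some l) None ++ u = rcons (map Some l') None ++ u' ->
    l = l' /\ u = u'.
  elim: l l' => [|a l IH] [|b l'] //=; first by case.
  by case=> -> /IH[-> ->].
elim=> [|n ns IH] [|n' ns'] //; rewrite /write /=; try by case: (digits _).
by move=> /split[/dI -> /IH ->].
Qed.

(** The encoding with letters replaced by their indices in [letters], the form in which
    [polytime_of_pt] expects an output. *)
Definition wcode (digits : nat -> seq bool) (ns : seq nat) : seq nat :=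
  flatten [seq [seq (nat_of_bool b).+1 | b <- digits n] ++ [:: 0] | n <- ns].

Definition letters : seq (option bool) := [:: None; Some false; Some true].

Lemma wcodeE digits ns : map (nth None letters) (wcode digits ns) = write digits ns.
Proof.
rewrite /wcode /write map_flatten -map_comp; congr flatten.
apply: eq_map => n /=; rewrite map_cat -map_comp cats1; congr rcons.
by apply: eq_map => -[].
Qed.

Lemma wcode_lt digits ns : all (fun i => i < size letters) (wcode digits ns).
Proof.
apply/allP => i /flattenP[_ /mapP[n _ ->]]; rewrite mem_cat inE.
by move=> /orP[/mapP[b _ ->]|/eqP->//]; case: b.
Qed.

Lemma wcode_cat digits ns ns' :
  wcode digits (ns ++ ns') = wcode digits ns ++ wcode digits ns'.
Proof. by rewrite /wcode map_cat flatten_cat. Qed.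

Lemma pt_wcode_unary (X : encType) (f : X -> seq nat) :
  pt f -> pt (fun x => wcode unary (f x)).
Proof. by move=> pf; rewrite /wcode /unary; pt_solve. Qed.

Lemma pt_wcode_binary (X : encType) (f : X -> seq nat) :
  pt f -> pt (fun x => wcode binary (f x)).
Proof. by move=> pf; rewrite /wcode; pt_solve. Qed.

(** A word is in the language as soon as some yes-instance has these numbers. The second hypothesis
    excludes that a no-instance is mistaken for another instance with the same numbers. *)
Lemma NP_hard_of_pt (P : problem) (digits : nat -> seq bool) :
  injective digits ->
  (forall I I' : instance P, numbers I = numbers I' -> is_yes I -> is_yes I') ->
  (forall (A : finType) (K : language A), NP K ->
    exists (I : seq A -> instance P) (g : seq nat -> seq nat),
    [/\ pt g, (forall x, g [seq enum_rank a : nat | a <- x] =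
                 wcode digits (numbers (I x))) &
        forall x, K x <-> is_yes (I x)]) ->
  NP_hard (language_of digits P).
Proof.
move=> dI PI H A K /H[I [g [pg gE KI]]].
exists (fun x => write digits (numbers (I x))); split.
  apply: (polytime_of_pt (ca := fun a => enum_rank a : nat) (bs := letters)
    (b0 := None) pg) => x; first by rewrite gE wcodeE.
  by rewrite gE; exact: wcode_lt.
move=> x; split=> [/KI yes|[J [yes E]]]; first by exists (I x).
by apply/KI; apply: PI yes; apply: (write_inj dI).
Qed.

(** * Instances are determined by their numbers *)

Lemma rat_numbers_inj : injective rat_numbers.
Proof.
move=> q q' [sE nE dE]; rewrite -(divq_num_den q) -(divq_num_den q').
have -> : numq q = numq q'.
  rewrite (intEsign (numq q)) (intEsign (numq q')) !numq_lt0 nE; congr (_ ^+ _ * _)%R.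
  by case: (q < 0)%R sE; case: (q' < 0)%R.
by rewrite -(absz_denq q) -(absz_denq q') dE.
Qed.

Lemma list_all_inj (T : finType) (f g : T -> seq nat) u u' :
  (forall x, size (f x) = size (g x)) ->
  list_all f ++ u = list_all g ++ u' -> f =1 g /\ u = u'.
Proof.
move=> sz; suff H (l : seq T) :
    flatten (map f l) ++ u = flatten (map g l) ++ u' -> {in l, f =1 g} /\ u = u'.
  by move/H => [fg ->]; split=> // x; apply: fg; rewrite mem_enum.
elim: l => //= x l IH; rewrite -!catA => /eqP; rewrite eqseq_cat // => /andP[/eqP fx /eqP].
by move=> /IH[fg ->]; split=> // y; rewrite inE => /orP[/eqP->//|/fg].
Qed.

Lemma size_list_all (T : finType) (f g : T -> seq nat) :
  (forall x, size (f x) = size (g x)) -> size (list_all f) = size (list_all g).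
Proof.
by move=> sz; rewrite /list_all; elim: (enum T) => //= x l IH; rewrite !size_cat sz IH.
Qed.

(** The two sizes come first, so the types of the transition functions agree before the tables are
    compared; the proof fields agree by proof irrelevance. *)
Lemma mdp_numbers_inj (M M' : mdp) u u' :
  mdp_numbers M ++ u = mdp_numbers M' ++ u' -> M = M' /\ u = u'.
Proof.
case: M => ns na tr tb te td; case: M' => ns' na' tr' tb' te' td'.
rewrite /mdp_numbers /= => -[E1 E2]; case: _ / E1 tr' tb' te' td'.
case: _ / E2 => tr' tb' te' td'; rewrite /= => /list_all_inj[].
  by move=> s; apply: size_list_all => a; apply: size_list_all.
move=> H ->; split=> //.
have E : tr = tr'.
  apply/funext => s; apply/funext => a; apply/funext => t.
  have := H s; rewrite -[LHS]cats0 -[RHS]cats0 => /list_all_inj[|H' _].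
    by move=> b; apply: size_list_all.
  have := H' a; rewrite -[LHS]cats0 -[RHS]cats0 => /list_all_inj[|H'' _] //.
  exact: rat_numbers_inj (H'' t).
case: _ / E tb' te' td' {H} => tb' te' td'.
by rewrite (Prop_irrelevance tb tb') (Prop_irrelevance te te') (Prop_irrelevance td td').
Qed.

Lemma set_numbers_inj (M : mdp) (T T' : {set state M}) u u' :
  set_numbers T ++ u = set_numbers T' ++ u' -> T = T' /\ u = u'.
Proof.
move=> /eqP; rewrite eqseq_cat ?size_map // => /andP[/eqP E /eqP ->]; split=> //.
apply/setP => s; have /eq_in_map/(_ s) := E; rewrite mem_enum => /(_ isT).
by case: (s \in T); case: (s \in T').
Qed.

Lemma buechi_pair_numbers_inj (I I' : buechi_pair) u u' :
  buechi_pair_numbers I ++ u = buechi_pair_numbers I' ++ u' -> I = I' /\ u = u'.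
Proof.
case: I => M s1 s2 T1 T2; case: I' => M' s1' s2' T1' T2'.
rewrite /buechi_pair_numbers /= -!catA => /mdp_numbers_inj[] E.
case: _ / E s1' s2' T1' T2' => s1' s2' T1' T2' /= [/val_inj -> /val_inj ->].
by rewrite -!catA => /set_numbers_inj[-> /set_numbers_inj[-> ->]].
Qed.

Lemma relop_numbers_inj : injective relop_numbers.
Proof.
move=> [||e e0|e e0] [||e' e0'|e' e0'] //= /(congr1 behead) /= /rat_numbers_inj E;
  case: _ / E e0' => e0'; by rewrite (Prop_irrelevance e0 e0').
Qed.

Lemma rel_buechi_numbers_inj : injective rel_buechi_numbers.
Proof.
case=> M m n co bo ini ix su ta op; case=> M' m' n' co' bo' ini' ix' su' ta' op'.
rewrite /rel_buechi_numbers /= => /mdp_numbers_inj[] E.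
case: _ / E ini' ta' => ini' ta' /= [E1 E2].
case: _ / E1 co' ini' ix' su' ta' => co' ini' ix' su' ta'.
case: _ / E2 ix' su' => ix' su' /list_all_inj[].
  by move=> i; rewrite /= !size_map.
move=> H [b1 b2 b3 /relop_numbers_inj ->].
have -> : bo = bo' by apply: rat_numbers_inj; rewrite /rat_numbers b1 b2 b3.
have {}H i : [/\ co i = co' i, ini i = ini' i, ix i = ix' i & ta i = ta' i].
  have [c1 c2 c3 /val_inj -> /val_inj -> E] := H i; split=> //.
    by apply: rat_numbers_inj; rewrite /rat_numbers c1 c2 c3.
  by have := @set_numbers_inj M (ta i) (ta' i) [::] [::]; rewrite !cats0 => /(_ E)[].
have H0 := H; have -> : co = co' by apply/funext => i; case: (H i).
have -> : ini = ini' by apply/funext => i; case: (H i).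
have E : ix = ix' by apply/funext => i; case: (H i).
case: _ / E su' {H} => su'; rewrite (Prop_irrelevance su su').
by have -> : ta = ta' by apply/funext => i; case: (H0 i).
Qed.

(** * Numbers of the constraint process *)

Lemma eq_list_all (T : finType) (f g : T -> seq nat) :
  f =1 g -> list_all f = list_all g.
Proof. by move=> fg; rewrite /list_all (eq_map fg). Qed.

Lemma list_all_ord n (f : nat -> seq nat) :
  list_all (fun s : 'I_n => f s) = flatten [seq f s | s <- iota 0 n].
Proof. by rewrite /list_all -val_enum_ord -map_comp. Qed.

Lemma set_numbersE (M : mdp) (T : {set state M}) (f : nat -> bool) :
  (forall s : state M, (s \in T) = f s) ->
  set_numbers T = [seq nat_of_bool (f s) | s <- iota 0 (mdp_ns M).+1].
Proof.
move=> H; rewrite /set_numbers -val_enum_ord -map_comp.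
by apply: eq_map => s /=; rewrite H.
Qed.

Section Numbers.
Variables (G Na : nat) (tbl : seq (seq nat)).
Local Notation tb := (nth [::] tbl).

(** The lowest terms of all fractions over [cDD] are tabulated. The table is a constant of the
    reduction, which thereby never computes a greatest common divisor. *)
Definition rat_table : seq (seq nat) :=
  [seq rat_numbers (n%:R / (cDD G 5)%:R)%R | n <- iota 0 (cDD G 5).+1].

Definition mdp_list (I : csp) : seq nat :=
  [:: (nstates I).+1; Na] ++
  flatten [seq flatten [seq flatten [seq nth [::] rat_table (trans_num G 5 tb I s a t)
    | t <- iota 0 (nstates I).+1] | a <- iota 0 Na] | s <- iota 0 (nstates I).+1].

Definition target_list (sink : nat) (b : bool) (I : csp) : seq nat :=
  [seq nat_of_bool ((s == sink) || ~~ b && (s == 4)) | s <- iota 0 (nstates I).+1].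

Lemma pt_nstates : pt nstates.
Proof. by rewrite /nstates; pt_solve. Qed.

Lemma pt_num0 : pt (fun p : csp * nat * nat * nat => num0 G 5 tb p.1.1.1 p.1.1.2 p.1.2 p.2).
Proof. by rewrite /num0 /row_num /picked; pt_solve. Qed.

Lemma pt_num : pt (fun p : csp * nat * nat * nat => trans_num G 5 tb p.1.1.1 p.1.1.2 p.1.2 p.2).
Proof.
rewrite /trans_num; apply: pt_if; [by pt_solve| |exact: pt_num0].
apply: pt_subn; first by pt_solve.
apply: pt_sumn; apply: pt_map; first by pt_solve.
by apply: (pt_comp (g := fun p : csp * nat * nat * nat * nat =>
  (p.1.1.1.1, p.1.1.1.2, p.1.1.2, p.2)) pt_num0); pt_solve.
Qed.

Lemma pt_mdp_list : pt mdp_list.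
Proof.
have h := pt_nstates.
rewrite /mdp_list; apply: pt_cat.
  by apply: pt_cons; [apply: pt_succn|pt_solve].
apply: pt_flatten; apply: pt_map; first by apply: pt_iota; [pt_solve|exact: pt_succn].
apply: pt_flatten; apply: pt_map; first by pt_solve.
apply: pt_flatten; apply: pt_map.
  apply: pt_iota; first by pt_solve.
  by apply: pt_succn; apply: (pt_comp pt_nstates); pt_solve.
apply: pt_nth; [by pt_solve| |by pt_solve].
by apply: (pt_comp (g := fun p : csp * nat * nat * nat =>
  (p.1.1.1, p.1.1.2, p.1.2, p.2)) pt_num); pt_solve.
Qed.

Lemma pt_target_list sink b : pt (target_list sink b).
Proof.
rewrite /target_list; apply: pt_map; last by pt_solve.
by apply: pt_iota; [pt_solve|apply: pt_succn; exact: pt_nstates].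
Qed.

Variables (I : csp) (G0 : 0 < G) (GNa : G <= Na) (wf : csp_wf G 5 Na tb I).

Lemma mdp_numbersE : mdp_numbers (csp_mdp G0 GNa wf) = mdp_list I.
Proof.
have NaE : Na.-1.+1 = Na by rewrite prednK // (leq_trans G0).
rewrite /mdp_numbers /mdp_list.
rewrite -[(mdp_ns _).+1]/(nstates I).+1 -[(mdp_na _).+1]/Na.-1.+1; congr (_ ++ _).
  by rewrite NaE.
rewrite (@eq_list_all _ _ (fun s : 'I_(nstates I).+1 => flatten [seq flatten
  [seq nth [::] rat_table (trans_num G 5 tb I s a t) | t <- iota 0 (nstates I).+1]
  | a <- iota 0 Na])); last first.
  move=> s; rewrite (@eq_list_all _ _ (fun a : 'I_Na.-1.+1 => flatten
    [seq nth [::] rat_table (trans_num G 5 tb I s a t) | t <- iota 0 (nstates I).+1])); last first.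
    move=> a; rewrite (@eq_list_all _ _ (fun t : 'I_(nstates I).+1 =>
      nth [::] rat_table (trans_num G 5 tb I s a t))); last first.
      move=> t; rewrite (nth_map 0) ?size_iota ?nth_iota ?add0n //.
        rewrite ltnS -(sum_num G0 GNa wf a (ltn_ord s)) (bigD1 t) //=.
        exact: leq_addr.
      rewrite ltnS -(sum_num G0 GNa wf a (ltn_ord s)) (bigD1 t) //=.
      exact: leq_addr.
    exact: (@list_all_ord _ (fun t => nth [::] rat_table (trans_num G 5 tb I s a t))).
  rewrite (@list_all_ord _ (fun a => flatten
    [seq nth [::] rat_table (trans_num G 5 tb I s a t) | t <- iota 0 (nstates I).+1])).
  by rewrite NaE.
exact: (@list_all_ord _ (fun s => flatten [seq flatten
  [seq nth [::] rat_table (trans_num G 5 tb I s a t) | t <- iota 0 (nstates I).+1]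
  | a <- iota 0 Na])).
Qed.

Lemma target_numbersE sink b :
  set_numbers (target G0 GNa wf sink b) = target_list sink b I.
Proof.
have H (s : state (csp_mdp G0 GNa wf)) : (s \in target G0 GNa wf sink b) =
    ((nat_of_ord s == sink) || ~~ b && (nat_of_ord s == 4)) by rewrite inE.
exact: (@set_numbersE (csp_mdp G0 GNa wf) _
  (fun s => (s == sink) || ~~ b && (s == 4)) H).
Qed.

Lemma pair_numbersE same abs1 abs2 :
  buechi_pair_numbers (csp_pair G0 GNa wf same abs1 abs2) =
  mdp_list I ++ [:: if same then 4 else 5; if same then 4 else 3] ++
  target_list 0 abs1 I ++ target_list 2 abs2 I.
Proof.
rewrite /buechi_pair_numbers; congr (_ ++ (_ ++ (_ ++ _))).
- exact: mdp_numbersE.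
- have H x : x < 6 -> nat_of_ord (inord x : 'I_(nstates I).+1) = x.
    by move=> x6; rewrite inordK // /nstates; lia.
  by case: same => /=; rewrite !H.
- exact: target_numbersE.
- exact: target_numbersE.
Qed.

End Numbers.

Lemma list_all_ord2 (f : 'I_2 -> seq nat) :
  list_all f = f ord0 ++ f (lift ord0 ord0).
Proof.
rewrite /list_all enum_ordSl /= (_ : enum 'I_1 = [:: ord0]) /= ?cats0 //.
by rewrite enum_ordSl; congr cons; apply/nilP; rewrite /nilp size_map size_enum_ord.
Qed.

Lemma csp_pair_reduction (A : finType) (K : language A) : NP K ->
  exists (G Na : nat) (tbl : seq (seq nat)) (inst : seq nat -> csp),
  exists G0 : 0 < G, exists GNa : G <= Na,
  exists wf : forall x : seq A,
    csp_wf G 5 Na (nth [::] tbl) (inst [seq enum_rank a : nat | a <- x]),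
  pt inst /\ forall x, K x <->
    csp_sat G (nth [::] tbl) (inst [seq enum_rank a : nat | a <- x]).
Proof.
move=> /NP_reduces_to_csp[G [Na [tbl [inst [G0 GNa pinst H]]]]].
exists G, Na, tbl, inst, G0, GNa, (fun x => (H x).1); split=> // x.
exact: (H x).2.
Qed.

Lemma rat_numbers_inv m : 0 < m -> rat_numbers (m%:R^-1)%R = [:: 0; 1; m].
Proof.
move=> m0; have d0 : (0 < m%:Z)%R by rewrite ltz_nat.
have c : coprime `|(1%:Z)%R|%N `|(m%:Z)%R|%N by exact: coprime1n.
have E : (m%:R^-1 = (1%:Z)%:~R / (m%:Z)%:~R :> rat)%R by rewrite div1r -pmulrn.
have nE : numq (m%:R^-1)%R = 1%R by rewrite E coprimeq_num // ?gtr0_sgz ?gtr0_sg // mul1r.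
have dE : denq (m%:R^-1)%R = (m%:Z)%R by rewrite E coprimeq_den // (gt_eqF d0).
rewrite /rat_numbers nE dE (_ : (_ < 0)%R = false) //.
by apply/negbTE; rewrite -leNgt invr_ge0 ler0n.
Qed.

(** * Hardness of the equality problems, the general problem and the approximate variants *)

Section Hardness.
Variable R : realType.

Section FixedCSP.
Variables (G Na : nat) (tbl : seq (seq nat)) (I : csp).
Hypotheses (G0 : 0 < G) (GNa : G <= Na) (wf : csp_wf G 5 Na (nth [::] tbl) I).
Variables (same abs1 abs2 : bool).
Let Ip := csp_pair G0 GNa wf same abs1 abs2.

Lemma gap_gt0 : (0 < (2 * ((cX 5)%:R * (cD G 5)%:R ^+ size I.2))^-1 :> R)%R.
Proof.
rewrite invr_gt0 !mulr_gt0 // ?ltr0n //; apply: exprn_gt0.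
by rewrite ltr0n /cD addn1.
Qed.

Lemma csp_one_yes :
  csp_sat G (nth [::] tbl) I <-> @is_yes (BuechiEq_one_scheduler R) Ip.
Proof.
split=> [sat|[s [md E]]].
  by have [s md E] := @csp_sat_values G 5 Na _ I G0 GNa wf R same abs1 abs2 sat; exists s.
by apply: (csp_sat_of_values md md); rewrite E normr0; exact: gap_gt0.
Qed.

Lemma csp_two_yes :
  csp_sat G (nth [::] tbl) I <-> @is_yes (BuechiEq_two_schedulers R) Ip.
Proof.
split=> [sat|[s [s' [md md' E]]]].
  have [s md E] := @csp_sat_values G 5 Na _ I G0 GNa wf R same abs1 abs2 sat.
  by exists s, s.
by apply: (csp_sat_of_values md md'); rewrite E normr0; exact: gap_gt0.
Qed.

(** A power of two is taken because its binary digits can be written down at once. The exponent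
    comes from applying [n < 2 ^ n] to each factor of the inverse gap. *)
Definition eps_exp := 2 * cX 5 + cD G 5 * size I.2.
Definition eps : rat := ((2 ^ eps_exp)%:R)^-1%R.

Lemma eps_gt0 : (0 < eps)%R.
Proof. by rewrite invr_gt0 ltr0n expn_gt0. Qed.

Lemma eps_gap : (ratr eps < (2 * ((cX 5)%:R * (cD G 5)%:R ^+ size I.2))^-1 :> R)%R.
Proof.
rewrite /eps fmorphV /= ratr_nat ltf_pV2 ?posrE ?ltr0n ?expn_gt0 //; last first.
  by rewrite -invr_gt0; exact: gap_gt0.
rewrite -natrX -!natrM ltr_nat /eps_exp expnD mulnA.
have D0 : 0 < cD G 5 by rewrite /cD addn1.
apply: (@leq_trans (2 ^ (2 * cX 5) * cD G 5 ^ size I.2)).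
  by rewrite ltn_pmul2r ?expn_gt0 ?D0 // ltn_expl.
rewrite leq_mul2l; apply/orP; right; rewrite expnM; apply: leq_exp2rW.
exact: ltnW (ltn_expl _ _).
Qed.

Definition csp_eps : buechi_pair_eps := BuechiPairEps Ip eps_gt0.

Lemma csp_eps_one_yes :
  csp_sat G (nth [::] tbl) I <-> @is_yes (BuechiApprox_one_scheduler R) csp_eps.
Proof.
have e0 : (0 <= ratr eps :> R)%R by rewrite ler0q ltW ?eps_gt0.
split=> [/csp_one_yes[s [md E]]|[s [md E]]].
  by exists s; split=> //; rewrite /approx_eq E subr0 normr0.
apply: (csp_sat_of_values md md); apply: le_lt_trans eps_gap.
by move: E; rewrite /approx_eq subr0.
Qed.

Lemma csp_eps_two_yes :
  csp_sat G (nth [::] tbl) I <-> @is_yes (BuechiApprox_two_schedulers R) csp_eps.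
Proof.
have e0 : (0 <= ratr eps :> R)%R by rewrite ler0q ltW ?eps_gt0.
split=> [/csp_two_yes[s [s' [md md' E]]]|[s [s' [md md' E]]]].
  by exists s, s'; split=> //; rewrite /approx_eq E subr0 normr0.
apply: (csp_sat_of_values md md'); apply: le_lt_trans eps_gap.
by move: E; rewrite /approx_eq subr0.
Qed.

Lemma binary_exp2 n : binary (2 ^ n) = nseq n false ++ [:: true].
Proof.
elim: n => [|n IH]; first by rewrite binaryS.
rewrite binaryS ?expn_gt0 // expnS mul2n odd_double doubleK IH.
by [].
Qed.

Lemma rel_coef_surj (j : 'I_1) : exists i : 'I_2, (fun=> ord0 : 'I_1) i = j.
Proof. by exists ord0; rewrite (ord1 j). Qed.

(** Equality is expressed by coefficients 1 and -1, bound 0 and the approximation relation with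
    tolerance 0. *)
Definition csp_rel : rel_buechi_instance :=
  @RelBuechiInstance (csp_mdp G0 GNa wf) 2 1
    (fun i => if i == ord0 then 1%R else (-1)%R) 0%R
    (fun i => if i == ord0 then bp_s1 Ip else bp_s2 Ip)
    (fun=> ord0) rel_coef_surj
    (fun i => if i == ord0 then bp_T1 Ip else bp_T2 Ip)
    (OpApprox (lexx 0%R)).

Lemma csp_rel_yes :
  csp_sat G (nth [::] tbl) I <-> @is_yes (RelBuechi_MD R) csp_rel.
Proof.
have E (s : 'I_1 -> scheduler R (csp_mdp G0 GNa wf)) :
    (\sum_(i < 2) ratr (if i == ord0 then 1 else -1) * buechi_prob (s ord0)
      (if i == ord0 then bp_s1 Ip else bp_s2 Ip)
      (if i == ord0 then bp_T1 Ip else bp_T2 Ip))%R =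
    @buechi_diff R Ip (s ord0) (s ord0).
  rewrite big_ord_recl big_ord1 /= rmorph1 mul1r rmorphN rmorph1 mulN1r.
  by [].
split=> [/csp_one_yes[s [md H]]|[s [md H]]]; last apply/csp_one_yes.
  exists (fun=> s); split=> //=.
  by rewrite (E (fun=> s)) H /approx_eq rmorph0 subrr normr0.
exists (s ord0); split=> //; apply/eqP; rewrite -normr_eq0 eq_le normr_ge0 andbT.
by move: H => /=; rewrite (E s) /approx_eq rmorph0 subr0.
Qed.

Lemma csp_rel_numbers : rel_buechi_numbers csp_rel =
  mdp_list G Na tbl I ++ [:: 2; 1] ++
  (rat_numbers 1 ++ [:: if same then 4 else 5; 0] ++ target_list 0 abs1 I ++
   rat_numbers (-1) ++ [:: if same then 4 else 3; 0] ++ target_list 2 abs2 I) ++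
  rat_numbers 0 ++ [:: 2] ++ rat_numbers 0.
Proof.
have H x : x < 6 -> nat_of_ord (inord x : 'I_(nstates I).+1) = x.
  by move=> x6; rewrite inordK // /nstates; lia.
rewrite /rel_buechi_numbers; congr (_ ++ (_ ++ (_ ++ _))); first exact: mdp_numbersE.
rewrite [list_all _]list_all_ord2 -!catA; congr (_ ++ (_ ++ (_ ++ (_ ++ (_ ++ _))))).
- by congr [:: _; _]; apply: (H (if same then 4 else 5)); case: (same).
- exact: target_numbersE.
- by congr [:: _; _]; apply: (H (if same then 4 else 3)); case: (same).
- exact: target_numbersE.
Qed.

End FixedCSP.

Lemma pt_pair_list G Na tbl same abs1 abs2 :
  pt (fun I => mdp_list G Na tbl I ++ [:: if same then 4 else 5; if same then 4 else 3] ++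
    target_list 0 abs1 I ++ target_list 2 abs2 I).
Proof.
have h1 := pt_mdp_list G Na tbl; have h2 := pt_target_list 0 abs1.
by have h3 := pt_target_list 2 abs2; pt_solve.
Qed.

Section Shapes.
Variables (same abs1 abs2 : bool).

Lemma eq_one_hard_shape : strongly_NP_hard (@subproblem (BuechiEq_one_scheduler R)
  (pair_shape same abs1 abs2)).
Proof.
apply: NP_hard_of_pt; first exact: unary_inj.
  move=> [I sI] [I' sI'] /= E; have := @buechi_pair_numbers_inj I I' [::] [::].
  by rewrite !cats0 => /(_ E)[->].
move=> A K /csp_pair_reduction[G [Na [tbl [inst [G0 [GNa [wf [pi H]]]]]]]].
exists (fun x => exist _ (csp_pair G0 GNa (wf x) same abs1 abs2)
  (csp_pair_shape G0 GNa (wf x) same abs1 abs2)).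
exists (fun xs => wcode unary (mdp_list G Na tbl (inst xs) ++
  [:: if same then 4 else 5; if same then 4 else 3] ++
    target_list 0 abs1 (inst xs) ++ target_list 2 abs2 (inst xs))); split.
- by apply: pt_wcode_unary; exact: (pt_comp (pt_pair_list G Na tbl same abs1 abs2) pi).
- by move=> x; rewrite /= pair_numbersE.
- by move=> x; rewrite H; exact: csp_one_yes.
Qed.

Lemma eq_two_hard_shape : strongly_NP_hard (@subproblem (BuechiEq_two_schedulers R)
  (pair_shape same abs1 abs2)).
Proof.
apply: NP_hard_of_pt; first exact: unary_inj.
  move=> [I sI] [I' sI'] /= E; have := @buechi_pair_numbers_inj I I' [::] [::].
  by rewrite !cats0 => /(_ E)[->].
move=> A K /csp_pair_reduction[G [Na [tbl [inst [G0 [GNa [wf [pi H]]]]]]]].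
exists (fun x => exist _ (csp_pair G0 GNa (wf x) same abs1 abs2)
  (csp_pair_shape G0 GNa (wf x) same abs1 abs2)).
exists (fun xs => wcode unary (mdp_list G Na tbl (inst xs) ++
  [:: if same then 4 else 5; if same then 4 else 3] ++
    target_list 0 abs1 (inst xs) ++ target_list 2 abs2 (inst xs))); split.
- by apply: pt_wcode_unary; exact: (pt_comp (pt_pair_list G Na tbl same abs1 abs2) pi).
- by move=> x; rewrite /= pair_numbersE.
- by move=> x; rewrite H; exact: csp_two_yes.
Qed.

End Shapes.

Lemma eq_one_hard : strongly_NP_hard (BuechiEq_one_scheduler R).
Proof.
apply: NP_hard_of_pt; first exact: unary_inj.
  move=> I I' /= E; have := @buechi_pair_numbers_inj I I' [::] [::].
  by rewrite !cats0 => /(_ E)[->].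
move=> A K /csp_pair_reduction[G [Na [tbl [inst [G0 [GNa [wf [pi H]]]]]]]].
exists (fun x => csp_pair G0 GNa (wf x) true true true).
exists (fun xs => wcode unary (mdp_list G Na tbl (inst xs) ++ [:: 4; 4] ++
    target_list 0 true (inst xs) ++ target_list 2 true (inst xs))); split.
- by apply: pt_wcode_unary; exact: (pt_comp (pt_pair_list G Na tbl true true true) pi).
- by move=> x; rewrite /= pair_numbersE.
- by move=> x; rewrite H; exact: csp_one_yes.
Qed.

Lemma eq_two_hard : strongly_NP_hard (BuechiEq_two_schedulers R).
Proof.
apply: NP_hard_of_pt; first exact: unary_inj.
  move=> I I' /= E; have := @buechi_pair_numbers_inj I I' [::] [::].
  by rewrite !cats0 => /(_ E)[->].
move=> A K /csp_pair_reduction[G [Na [tbl [inst [G0 [GNa [wf [pi H]]]]]]]].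
exists (fun x => csp_pair G0 GNa (wf x) true true true).
exists (fun xs => wcode unary (mdp_list G Na tbl (inst xs) ++ [:: 4; 4] ++
    target_list 0 true (inst xs) ++ target_list 2 true (inst xs))); split.
- by apply: pt_wcode_unary; exact: (pt_comp (pt_pair_list G Na tbl true true true) pi).
- by move=> x; rewrite /= pair_numbersE.
- by move=> x; rewrite H; exact: csp_two_yes.
Qed.

Lemma rel_hard : strongly_NP_hard (RelBuechi_MD R).
Proof.
apply: NP_hard_of_pt; first exact: unary_inj.
  by move=> I I' /rel_buechi_numbers_inj ->.
move=> A K /csp_pair_reduction[G [Na [tbl [inst [G0 [GNa [wf [pi H]]]]]]]].
exists (fun x => csp_rel G0 GNa (wf x) true true true).
exists (fun xs => wcode unary (mdp_list G Na tbl (inst xs) ++ [:: 2; 1] ++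
  (rat_numbers 1 ++ [:: 4; 0] ++ target_list 0 true (inst xs) ++
   rat_numbers (-1) ++ [:: 4; 0] ++ target_list 2 true (inst xs)) ++
  rat_numbers 0 ++ [:: 2] ++ rat_numbers 0)); split.
- apply: pt_wcode_unary.
  have h1 := pt_comp (pt_mdp_list G Na tbl) pi.
  have h2 := pt_comp (pt_target_list 0 true) pi.
  by have h3 := pt_comp (pt_target_list 2 true) pi; pt_solve.
- by move=> x; rewrite /= csp_rel_numbers.
- by move=> x; rewrite H; exact: csp_rel_yes.
Qed.

(** Index 0 ends a number, 1 and 2 are the two digits. The word is produced directly from [e];
    passing through the unary number [2 ^ e] would take exponential time. *)
Lemma wcode_eps e :
  wcode binary [:: 0; 1; 2 ^ e] = [:: 0; 2; 0] ++ nseq e 1 ++ [:: 2; 0].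
Proof.
have b0 : binary 0 = [::] by apply/nilP; rewrite nilp_binary.
have b1 : binary 1 = [:: true] by rewrite binaryS // b0.
rewrite /wcode /flatten; cbn [map foldr]; rewrite b0 b1 binary_exp2 map_cat map_nseq.
by rewrite cats0 -!catA.
Qed.

Lemma approx_numbers G Na tbl I (G0 : 0 < G) (GNa : G <= Na)
    (wf : csp_wf G 5 Na (nth [::] tbl) I) :
  wcode binary (buechi_pair_eps_numbers (csp_eps G0 GNa wf false true true)) =
  wcode binary (mdp_list G Na tbl I ++ [:: 5; 3] ++ target_list 0 true I ++
    target_list 2 true I) ++ [:: 0; 2; 0] ++ nseq (eps_exp G I) 1 ++ [:: 2; 0].
Proof.
rewrite /buechi_pair_eps_numbers wcode_cat.
rewrite [buechi_pair_numbers _]pair_numbersE [rat_numbers _]rat_numbers_inv ?expn_gt0 //.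
by rewrite wcode_eps.
Qed.

Lemma pt_approx G Na tbl (inst : seq nat -> csp) : pt inst ->
  pt (fun xs => wcode binary (mdp_list G Na tbl (inst xs) ++ [:: 5; 3] ++
    target_list 0 true (inst xs) ++ target_list 2 true (inst xs)) ++
    [:: 0; 2; 0] ++ nseq (eps_exp G (inst xs)) 1 ++ [:: 2; 0]).
Proof.
move=> pi; apply: pt_cat.
  by apply: pt_wcode_binary; exact: (pt_comp (pt_pair_list G Na tbl false true true) pi).
by rewrite /eps_exp; pt_solve.
Qed.

Lemma approx_numbers_inj : injective buechi_pair_eps_numbers.
Proof.
move=> [I e e0] [I' e' e0']; rewrite /buechi_pair_eps_numbers /=.
move=> /buechi_pair_numbers_inj[-> /rat_numbers_inj E].
by case: _ / E e0' => e0'; rewrite (Prop_irrelevance e0 e0').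
Qed.

Lemma approx_one_hard : problem_NP_hard (BuechiApprox_one_scheduler R).
Proof.
apply: NP_hard_of_pt; first exact: binary_inj.
  by move=> I I' /approx_numbers_inj ->.
move=> A K /csp_pair_reduction[G [Na [tbl [inst [G0 [GNa [wf [pi H]]]]]]]].
exists (fun x => csp_eps G0 GNa (wf x) false true true).
eexists; split; first exact: (pt_approx G Na tbl pi).
  by move=> x; exact: esym (approx_numbers _ _ _).
by move=> x; rewrite H; exact: csp_eps_one_yes.
Qed.

Lemma approx_two_hard : problem_NP_hard (BuechiApprox_two_schedulers R).
Proof.
apply: NP_hard_of_pt; first exact: binary_inj.
  by move=> I I' /approx_numbers_inj ->.
move=> A K /csp_pair_reduction[G [Na [tbl [inst [G0 [GNa [wf [pi H]]]]]]]].
exists (fun x => csp_eps G0 GNa (wf x) false true true).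
eexists; split; first exact: (pt_approx G Na tbl pi).
  by move=> x; exact: esym (approx_numbers _ _ _).
by move=> x; rewrite H; exact: csp_eps_two_yes.
Qed.

End Hardness.

End Reductions.
Import Reductions.

(** * Exact rational arithmetic and the verifier of certificates *)

Module Verifier.
Import all_classical all_reals all_analysis.
Import Order.TTheory GRing.Theory Num.Theory.

(* A rational in lowest terms: sign, numerator, denominator, and Bezout
   coefficients that certify coprimality. *)
Definition crat : Type := bool * bnat * bnat * (bnat * bnat).
Definition csign (q : crat) : bool := q.1.1.1.
Definition cnum (q : crat) : bnat := q.1.1.2.
Definition cden (q : crat) : bnat := q.1.2.
Definition crat0 : crat := (false, Bn 0, Bn 1, (Bn 1, Bn 0)).

(** Instances are written in lowest terms, so coprimality must be tested; with Bezout coefficients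
    supplied, multiplication and addition are enough. The second condition excludes a negative
    zero. *)
Definition crat_ok (q : crat) : bool :=
  beq (bmul (cden q) q.2.1) (badd (bmul (cnum q) q.2.2) (Bn 1)) &&
  (csign q ==> ~~ beq (cnum q) (Bn 0)).

Definition crat_val (q : crat) : rat :=
  ((-1) ^+ csign q * ((nb (cnum q))%:R / (nb (cden q))%:R))%R.

Definition crat_numbers (q : crat) : seq bnat :=
  [:: Bn (csign q : nat); cnum q; cden q].

Lemma crat_okP q : crat_ok q ->
  [/\ 0 < nb (cden q), coprime (nb (cnum q)) (nb (cden q)) &
      csign q -> nb (cnum q) != 0].
Proof.
case/andP => /eqP /= E /implyP sg.
have d0 : 0 < nb (cden q) by case: (nb (cden q)) E => //; lia.
split=> //.
rewrite /coprime -dvdn1 -(@dvdn_addr (nb (cnum q) * nb q.2.2)).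
  by rewrite -E dvdn_mulr // dvdn_gcdr.
by rewrite dvdn_mulr // dvdn_gcdl.
Qed.

Lemma crat_numbersE q : crat_ok q ->
  rat_numbers (crat_val q) = map nb (crat_numbers q).
Proof.
move=> /crat_okP[d0 co sg]; rewrite /rat_numbers.
have d0' : (0 < (nb (cden q))%:Z)%R by rewrite ltz_nat.
have E : crat_val q = ((((-1) ^+ csign q * (nb (cnum q))%:Z)%R)%:~R /
    ((nb (cden q))%:Z)%:~R)%R.
  by rewrite /crat_val mulrA intrM rmorphXn /= -!pmulrn.
have c : coprime `|((-1) ^+ csign q * (nb (cnum q))%:Z)%R| `|(nb (cden q))%:Z%R|.
  by rewrite abszM abszX /= exp1n mul1n.
have nE : numq (crat_val q) = ((-1) ^+ csign q * (nb (cnum q))%:Z)%R.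
  by rewrite E coprimeq_num // gtr0_sg // mul1r.
have dE : denq (crat_val q) = (nb (cden q))%:Z%R by rewrite E coprimeq_den // (gt_eqF d0').
have sE : (crat_val q < 0)%R = csign q.
  rewrite /crat_val; case s: (csign q) sg => sg; last first.
    by rewrite mul1r; apply/negbTE; rewrite -leNgt divr_ge0 ?ler0n.
  by rewrite mulN1r oppr_lt0 divr_gt0 ?ltr0n // lt0n sg.
by rewrite nE dE sE abszM abszX exp1n mul1n.
Qed.

(** The extended Euclidean algorithm also bounds the Bezout coefficients by the numbers themselves,
    which keeps the certificate short. *)
Lemma crat_of (x : rat) : exists q, [/\ crat_ok q, crat_val q = x,
  nb (cnum q) = `|numq x|%N, nb (cden q) = `|denq x|%N &
  nb q.2.1 <= (nb (cnum q)).+1 /\ nb q.2.2 <= nb (cden q)].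
Proof.
have d0 : 0 < `|denq x| by rewrite absz_gt0 denq_neq0.
have co : gcdn `|denq x| `|numq x| = 1 by rewrite gcdnC; apply/eqP/coprime_num_den.
case: (egcdnP `|numq x| d0) => u v; rewrite co muln1 => E lt_v.
exists ((x < 0)%R, Bn `|numq x|, Bn `|denq x|, (Bn u, Bn v)); split=> //=.
- rewrite /crat_ok /beq /cden /cnum /csign /= mulnC E [v * _]mulnC eqxx /=.
  by apply/implyP => x0; rewrite absz_eq0 numq_eq0 lt_eqF.
- rewrite /crat_val /csign /cnum /cden /= -[RHS]divq_num_den mulrA.
  congr (_ / _)%R; last by rewrite -{2}(absz_denq x) -pmulrn.
  by rewrite {2}(intEsign (numq x)) numq_lt0 intrM rmorphXn /= -pmulrn.
- split; last exact: ltnW.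
  rewrite -ltnS -(ltn_pmul2r d0) E.
  apply: (@leq_ltn_trans (`|denq x| * `|numq x| + 1)); last by lia.
  by rewrite leq_add2r leq_mul2r (ltnW lt_v) orbT.
Qed.

(* A difference of natural numbers over a common denominator. *)
Definition frac : Type := bnat * bnat * bnat.
Definition frac_ok (f : frac) : bool := ~~ beq f.2 (Bn 0).
Definition frac_val (f : frac) : rat :=
  (((nb f.1.1)%:R - (nb f.1.2)%:R) / (nb f.2)%:R)%R.
Definition frac_of (q : crat) : frac :=
  if csign q then (Bn 0, cnum q, cden q) else (cnum q, Bn 0, cden q).
Definition fadd (f g : frac) : frac :=
  (badd (bmul f.1.1 g.2) (bmul g.1.1 f.2),
   badd (bmul f.1.2 g.2) (bmul g.1.2 f.2), bmul f.2 g.2).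
Definition fmul (f g : frac) : frac :=
  (badd (bmul f.1.1 g.1.1) (bmul f.1.2 g.1.2),
   badd (bmul f.1.1 g.1.2) (bmul f.1.2 g.1.1), bmul f.2 g.2).
Definition fleq (f g : frac) : bool :=
  bleq (badd (bmul f.1.1 g.2) (bmul g.1.2 f.2))
       (badd (bmul g.1.1 f.2) (bmul f.1.2 g.2)).
Definition feq (f g : frac) : bool := fleq f g && fleq g f.
Definition frac0 : frac := (Bn 0, Bn 0, Bn 1).
Definition frac1 : frac := (Bn 1, Bn 0, Bn 1).
Definition fsum (l : seq frac) : frac := foldl fadd frac0 l.

Lemma frac_okP f : frac_ok f -> ((nb f.2)%:R != 0 :> rat)%R.
Proof. by rewrite pnatr_eq0. Qed.

Lemma frac_of_ok q : crat_ok q -> frac_ok (frac_of q).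
Proof.
by move=> /crat_okP[d0 _ _]; rewrite /frac_of; case: ifP => _; rewrite /frac_ok /beq /= -lt0n.
Qed.

Lemma frac_ofE q : frac_val (frac_of q) = crat_val q.
Proof.
rewrite /frac_of /crat_val /frac_val; case: csign => /=.
  by rewrite sub0r mulN1r mulNr.
by rewrite subr0 mul1r.
Qed.

Lemma fadd_ok f g : frac_ok f -> frac_ok g -> frac_ok (fadd f g).
Proof. by rewrite /frac_ok /beq /= muln_eq0 negb_or => -> ->. Qed.

Lemma fmul_ok f g : frac_ok f -> frac_ok g -> frac_ok (fmul f g).
Proof. by rewrite /frac_ok /beq /= muln_eq0 negb_or => -> ->. Qed.

Lemma faddE f g : frac_ok f -> frac_ok g ->
  frac_val (fadd f g) = (frac_val f + frac_val g)%R.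
Proof.
move=> /frac_okP f0 /frac_okP g0; rewrite /frac_val /= !natrD !natrM.
by field; rewrite f0 g0.
Qed.

Lemma fmulE f g : frac_ok f -> frac_ok g ->
  frac_val (fmul f g) = (frac_val f * frac_val g)%R.
Proof.
move=> /frac_okP f0 /frac_okP g0; rewrite /frac_val /= !natrD !natrM.
by field; rewrite f0 g0.
Qed.

Lemma fleqE f g : frac_ok f -> frac_ok g ->
  fleq f g = (frac_val f <= frac_val g)%R.
Proof.
move=> f0 g0; have f1 : (0 < (nb f.2)%:R :> rat)%R by rewrite ltr0n lt0n.
have g1 : (0 < (nb g.2)%:R :> rat)%R by rewrite ltr0n lt0n.
rewrite /frac_val ler_pdivrMr // mulrAC ler_pdivlMr // !mulrBl.
rewrite lerBlDr addrAC lerBrDr -!natrM -!natrD ler_nat /fleq /bleq /=.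
by rewrite [X in _ = (_ <= X)]addnC; congr (_ <= _); lia.
Qed.

Lemma feqE f g : frac_ok f -> frac_ok g ->
  feq f g = (frac_val f == frac_val g).
Proof. by move=> f0 g0; rewrite /feq !fleqE // eq_le. Qed.

Lemma fsumP (l : seq frac) : all frac_ok l ->
  frac_ok (fsum l) /\ frac_val (fsum l) = (\sum_(f <- l) frac_val f)%R.
Proof.
rewrite /fsum; suff H f0 : frac_ok f0 -> all frac_ok l ->
    frac_ok (foldl fadd f0 l) /\
    frac_val (foldl fadd f0 l) = (frac_val f0 + \sum_(f <- l) frac_val f)%R.
  move=> lok; have [//|h1 h2] := H frac0 _ lok; split=> //.
  by rewrite h2 /frac_val /= subrr mul0r add0r.
elim: l f0 => [|f l IH] f0 f0ok /=; first by rewrite big_nil addr0.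
move=> /andP[fok lok]; have [h1 h2] := IH _ (fadd_ok f0ok fok) lok; split=> //.
by rewrite h2 faddE // big_cons addrA.
Qed.

Lemma pt_fadd (X : encType) (f g : X -> frac) : pt f -> pt g -> pt (fun x => fadd (f x) (g x)).
Proof. by move=> pf pg; rewrite /fadd; pt_solve. Qed.

Lemma pt_fmul (X : encType) (f g : X -> frac) : pt f -> pt g -> pt (fun x => fmul (f x) (g x)).
Proof. by move=> pf pg; rewrite /fmul; pt_solve. Qed.

Lemma pt_fleq (X : encType) (f g : X -> frac) : pt f -> pt g -> pt (fun x => fleq (f x) (g x)).
Proof. by move=> pf pg; rewrite /fleq; pt_solve. Qed.

Lemma pt_feq (X : encType) (f g : X -> frac) : pt f -> pt g -> pt (fun x => feq (f x) (g x)).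
Proof. by move=> pf pg; rewrite /feq; apply: pt_andb; exact: pt_fleq. Qed.

Lemma pt_frac_of (X : encType) (f : X -> crat) : pt f -> pt (fun x => frac_of (f x)).
Proof. by move=> pf; rewrite /frac_of /csign /cnum /cden; pt_solve. Qed.

Lemma pt_crat_ok (X : encType) (f : X -> crat) : pt f -> pt (fun x => crat_ok (f x)).
Proof. by move=> pf; rewrite /crat_ok /csign /cnum /cden; pt_solve. Qed.

Lemma pt_cnum (X : encType) (f : X -> crat) : pt f -> pt (fun x => cnum (f x)).
Proof. by move=> pf; rewrite /cnum; pt_solve. Qed.

Lemma pt_cden (X : encType) (f : X -> crat) : pt f -> pt (fun x => cden (f x)).
Proof. by move=> pf; rewrite /cden; pt_solve. Qed.

Lemma pt_csign (X : encType) (f : X -> crat) : pt f -> pt (fun x => csign (f x)).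
Proof. by move=> pf; rewrite /csign; pt_solve. Qed.

(** Fractions are never reduced. Under addition their bit lengths add up to within one, so this
    measure satisfies the additive criterion for folds and sums stay polynomial. *)
Definition flen (f : frac) : nat :=
  maxn (bitlen (nb f.1.1)) (maxn (bitlen (nb f.1.2)) (bitlen (nb f.2))).

Lemma flen_add f g : flen (fadd f g) <= flen f + (flen g).+1.
Proof.
have H a b c d : bitlen (a * b + c * d) <=
    (maxn (bitlen a + bitlen b) (bitlen c + bitlen d)).+1.
  apply: leq_trans (bitlenD _ _) _; have := bitlenM a b; have := bitlenM c d.
  by lia.
rewrite /flen /=.
have := H (nb f.1.1) (nb g.2) (nb g.1.1) (nb f.2).
have := H (nb f.1.2) (nb g.2) (nb g.1.2) (nb f.2).
have := bitlenM (nb f.2) (nb g.2).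
by lia.
Qed.

Lemma pt_fsum (X : encType) (l : X -> seq frac) : pt l -> pt (fun x => fsum (l x)).
Proof.
move=> pl; rewrite /fsum.
have flen_sz (f : frac) : flen f <= sz f.
  case: f => [[a b] c]; rewrite /flen !sz_pair /=.
  by have := bitlen_sz a; have := bitlen_sz b; have := bitlen_sz c; lia.
apply: (pt_foldl (mu := fun _ => flen) (step := fun _ => fadd)) => //.
- exact: pt_const.
- by apply: pt_fadd; pt_solve.
- exists 6 => x f; apply: (@leq_trans (16 * (flen f + 2))).
    case: f => [[a b] c]; rewrite /flen !sz_pair /=.
    by have := sz_bnat a; have := sz_bnat b; have := sz_bnat c; lia.
  apply: (@leq_trans ((sz x + flen f + 2) ^ 4 * (sz x + flen f + 2))).
    apply: leq_mul; last by lia.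
    by apply: (@leq_trans (2 ^ 4)) => //; apply: leq_exp2rW; lia.
  by rewrite -expnSr leq_pexp2l //; lia.
- by exists 1 => x f; rewrite expn1; have := flen_sz f; lia.
- exists 1 => x f g; rewrite expn1; apply: leq_trans (flen_add _ _) _.
  by have := flen_sz g; lia.
Qed.

Ltac pt_ext ::= lazymatch goal with
  | |- pt (fun x => binary (nb (@?f x))) => apply: pt_nbinary
  | |- pt (fun x => binary (@?f x)) => apply: pt_binary
  | |- pt (fun x => Bn (bitval (@?f x))) => apply: pt_bitval
  | |- pt (fun x => Bn (@?f x)) => apply: pt_Bn
  | |- pt (fun x => badd (@?f x) (@?g x)) => apply: pt_badd
  | |- pt (fun x => bmul (@?f x) (@?g x)) => apply: pt_bmul
  | |- pt (fun x => bleq (@?f x) (@?g x)) => apply: pt_bleq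
  | |- pt (fun x => beq (@?f x) (@?g x)) => apply: pt_beq
  | |- pt (fun x => fadd (@?f x) (@?g x)) => apply: pt_fadd
  | |- pt (fun x => fmul (@?f x) (@?g x)) => apply: pt_fmul
  | |- pt (fun x => fleq (@?f x) (@?g x)) => apply: pt_fleq
  | |- pt (fun x => feq (@?f x) (@?g x)) => apply: pt_feq
  | |- pt (fun x => frac_of (@?f x)) => apply: pt_frac_of
  | |- pt (fun x => crat_ok (@?f x)) => apply: pt_crat_ok
  | |- pt (fun x => cnum (@?f x)) => apply: pt_cnum
  | |- pt (fun x => cden (@?f x)) => apply: pt_cden
  | |- pt (fun x => csign (@?f x)) => apply: pt_csign
  | |- pt (fun x => fsum (@?f x)) => apply: pt_fsum
  end.

Ltac pt_check := fail.
Ltac pt_solve_check := repeat (cbv beta zeta; first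
  [ assumption | exact: pt_const | pt_check | pt_ext | pt1 | apply: pt_if | pt_eta ]).

(** * The verifier *)

Definition term_data : Type := crat * nat * nat * seq bool.
Definition sol_data : Type := seq bnat * bnat * seq nat * seq nat.
(** Sizes, transition table, terms, bound with relation and tolerance describe the instance; the
    last two components, actions of the schedulers and solutions for the terms, are the witness.
    Having the instance here turns parsing of the word into a comparison. *)
Definition cert : Type :=
  (nat * nat * nat * nat) * seq (seq (seq crat)) * seq term_data *
  (crat * (nat * crat)) * seq (seq nat) * seq sol_data.

Section Accessors.
Variable J : cert.
Definition jS : nat := J.1.1.1.1.1.1.1.1.
Definition jA : nat := J.1.1.1.1.1.1.1.2.
Definition jm : nat := J.1.1.1.1.1.1.2.
Definition jn : nat := J.1.1.1.1.1.2.
Definition jP s a t : crat := nth crat0 (nth [::] (nth [::] J.1.1.1.1.2 s) a) t.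
Definition jterm i : term_data := nth (crat0, 0, 0, [::]) J.1.1.1.2 i.
Definition jcoef i := (jterm i).1.1.1.
Definition jinit i := (jterm i).1.1.2.
Definition jindex i := (jterm i).1.2.
Definition jtarget i s := nth false (jterm i).2 s.
Definition jbound : crat := J.1.1.2.1.
Definition jtag : nat := J.1.1.2.2.1.
Definition jeps : crat := J.1.1.2.2.2.
Definition jact j s : nat := nth 0 (nth [::] J.1.2 j) s.
Definition jsol i : sol_data := nth ([::], Bn 1, [::], [::]) J.2 i.
Definition jX i s := nth (Bn 0) (jsol i).1.1.1 s.
Definition jD i := (jsol i).1.1.2.
Definition jlab i s := nth 0 (jsol i).1.2 s.
Definition jrk i s := nth 0 (jsol i).2 s.

Definition j_enabled s a := feq (fsum [seq frac_of (jP s a t) | t <- iota 0 jS]) frac1.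
Definition j_zero s a t := beq (cnum (jP s a t)) (Bn 0).

Definition mdp_check : bool :=
  [&& 0 < jS, 0 < jA & all (fun s =>
    all (fun a => all (fun t => [&& crat_ok (jP s a t), ~~ csign (jP s a t) &
        bleq (cnum (jP s a t)) (cden (jP s a t))]) (iota 0 jS) &&
      (j_enabled s a || all (fun t => j_zero s a t) (iota 0 jS))) (iota 0 jA) &&
    has (fun a => j_enabled s a) (iota 0 jA)) (iota 0 jS)].

Definition terms_check : bool :=
  all (fun i => [&& crat_ok (jcoef i), jinit i < jS & jindex i < jn]) (iota 0 jm) &&
  all (fun j => has (fun i => jindex i == j) (iota 0 jm)) (iota 0 jn).

Definition op_check : bool :=
  [&& crat_ok jbound, jtag < 4 & (1 < jtag) ==> (crat_ok jeps && ~~ csign jeps)].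

Definition sched_check : bool :=
  all (fun j => all (fun s => (jact j s < jA) && j_enabled s (jact j s)) (iota 0 jS))
    (iota 0 jn).

Definition descends i s :=
  has (fun t => ~~ j_zero s (jact (jindex i) s) t && (jrk i t < jrk i s)) (iota 0 jS).

(** An executable form of [solves], for the values [jX / jD]: labels 0 and 1 claim closed sets with
    known value, any other label claims the harmonic equation. *)
Definition sol_check (i : nat) : bool :=
  ~~ beq (jD i) (Bn 0) && all (fun s =>
    if jlab i s == 0 then
      [&& ~~ jtarget i s, all (fun t => ~~ j_zero s (jact (jindex i) s) t ==>
          (jlab i t == 0)) (iota 0 jS) & beq (jX i s) (Bn 0)]
    else if jlab i s == 1 then
      [&& jtarget i s || descends i s,
          all (fun t => ~~ j_zero s (jact (jindex i) s) t ==>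
            (jlab i t == 1)) (iota 0 jS) & beq (jX i s) (jD i)]
    else descends i s &&
      feq (fsum [seq fmul (frac_of (jP s (jact (jindex i) s) t)) (jX i t, Bn 0, jD i)
                | t <- iota 0 jS]) (jX i s, Bn 0, jD i)) (iota 0 jS).

Definition j_value : frac :=
  fsum [seq fmul (frac_of (jcoef i)) (jX i (jinit i), Bn 0, jD i) | i <- iota 0 jm].

Definition rel_check : bool :=
  let b := frac_of jbound in let e := frac_of jeps in
  let close := fleq j_value (fadd b e) && fleq b (fadd j_value e) in
  if jtag == 0 then ~~ fleq j_value b
  else if jtag == 1 then fleq b j_value
  else if jtag == 2 then close else ~~ close.

Definition cert_check : bool :=
  [&& mdp_check, terms_check, op_check, sched_check,
      all (fun i => sol_check i) (iota 0 jm) & rel_check].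

Definition cert_numbers : seq bnat :=
  [:: Bn jS; Bn jA] ++
  flatten [seq flatten [seq flatten [seq crat_numbers (jP s a t)
    | t <- iota 0 jS] | a <- iota 0 jA] | s <- iota 0 jS] ++
  [:: Bn jm; Bn jn] ++
  flatten [seq crat_numbers (jcoef i) ++ [:: Bn (jinit i); Bn (jindex i)] ++
    [seq Bn (jtarget i s : nat) | s <- iota 0 jS] | i <- iota 0 jm] ++
  crat_numbers jbound ++ Bn jtag :: (if 1 < jtag then crat_numbers jeps else [::]).

End Accessors.

Section AccessorsPT.
Context {X : encType}.
Variables (J : X -> cert) (f g h : X -> nat).
Hypotheses (pJ : pt J) (pf : pt f) (pg : pt g) (ph : pt h).

Lemma pt_jS : pt (fun x => jS (J x)).
Proof. by rewrite /jS; pt_solve. Qed.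

Lemma pt_jA : pt (fun x => jA (J x)).
Proof. by rewrite /jA; pt_solve. Qed.

Lemma pt_jm : pt (fun x => jm (J x)).
Proof. by rewrite /jm; pt_solve. Qed.

Lemma pt_jn : pt (fun x => jn (J x)).
Proof. by rewrite /jn; pt_solve. Qed.

Lemma pt_jbound : pt (fun x => jbound (J x)).
Proof. by rewrite /jbound; pt_solve. Qed.

Lemma pt_jtag : pt (fun x => jtag (J x)).
Proof. by rewrite /jtag; pt_solve. Qed.

Lemma pt_jeps : pt (fun x => jeps (J x)).
Proof. by rewrite /jeps; pt_solve. Qed.

Lemma pt_jcoef : pt (fun x => jcoef (J x) (f x)).
Proof. by rewrite /jcoef /jterm /jsol; pt_solve. Qed.

Lemma pt_jinit : pt (fun x => jinit (J x) (f x)).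
Proof. by rewrite /jinit /jterm /jsol; pt_solve. Qed.

Lemma pt_jindex : pt (fun x => jindex (J x) (f x)).
Proof. by rewrite /jindex /jterm /jsol; pt_solve. Qed.

Lemma pt_jD : pt (fun x => jD (J x) (f x)).
Proof. by rewrite /jD /jterm /jsol; pt_solve. Qed.

Lemma pt_jtarget : pt (fun x => jtarget (J x) (f x) (g x)).
Proof. by rewrite /jtarget /jterm /jsol; pt_solve. Qed.

Lemma pt_jact : pt (fun x => jact (J x) (f x) (g x)).
Proof. by rewrite /jact /jterm /jsol; pt_solve. Qed.

Lemma pt_jX : pt (fun x => jX (J x) (f x) (g x)).
Proof. by rewrite /jX /jterm /jsol; pt_solve. Qed.

Lemma pt_jlab : pt (fun x => jlab (J x) (f x) (g x)).
Proof. by rewrite /jlab /jterm /jsol; pt_solve. Qed.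

Lemma pt_jrk : pt (fun x => jrk (J x) (f x) (g x)).
Proof. by rewrite /jrk /jterm /jsol; pt_solve. Qed.

Lemma pt_jP : pt (fun x => jP (J x) (f x) (g x) (h x)).
Proof. by rewrite /jP; pt_solve. Qed.

End AccessorsPT.

Ltac pt_check ::= lazymatch goal with
  | |- pt (fun x => jS (@?J x)) => apply: pt_jS
  | |- pt (fun x => jA (@?J x)) => apply: pt_jA
  | |- pt (fun x => jm (@?J x)) => apply: pt_jm
  | |- pt (fun x => jn (@?J x)) => apply: pt_jn
  | |- pt (fun x => jbound (@?J x)) => apply: pt_jbound
  | |- pt (fun x => jtag (@?J x)) => apply: pt_jtag
  | |- pt (fun x => jeps (@?J x)) => apply: pt_jeps
  | |- pt (fun x => jcoef (@?J x) (@?f x)) => apply: pt_jcoef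
  | |- pt (fun x => jinit (@?J x) (@?f x)) => apply: pt_jinit
  | |- pt (fun x => jindex (@?J x) (@?f x)) => apply: pt_jindex
  | |- pt (fun x => jD (@?J x) (@?f x)) => apply: pt_jD
  | |- pt (fun x => jtarget (@?J x) (@?f x) (@?g x)) => apply: pt_jtarget
  | |- pt (fun x => jact (@?J x) (@?f x) (@?g x)) => apply: pt_jact
  | |- pt (fun x => jX (@?J x) (@?f x) (@?g x)) => apply: pt_jX
  | |- pt (fun x => jlab (@?J x) (@?f x) (@?g x)) => apply: pt_jlab
  | |- pt (fun x => jrk (@?J x) (@?f x) (@?g x)) => apply: pt_jrk
  | |- pt (fun x => jP (@?J x) (@?f x) (@?g x) (@?h x)) => apply: pt_jP
  end.

Lemma pt_j_enabled (X : encType) (J : X -> cert) (f g : X -> nat) :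
  pt J -> pt f -> pt g -> pt (fun x => j_enabled (J x) (f x) (g x)).
Proof.
move=> pJ pf pg; rewrite /j_enabled; apply: pt_feq; last exact: pt_const.
apply: pt_fsum; apply: pt_map; first by pt_solve_check.
have h1 : pt (fun p : X * nat => J p.1) by apply: (pt_comp pJ); pt_solve.
have h2 : pt (fun p : X * nat => f p.1) by apply: (pt_comp pf); pt_solve.
have h3 : pt (fun p : X * nat => g p.1) by apply: (pt_comp pg); pt_solve.
by pt_solve_check.
Qed.

Lemma pt_j_zero (X : encType) (J : X -> cert) (f g h : X -> nat) :
  pt J -> pt f -> pt g -> pt h -> pt (fun x => j_zero (J x) (f x) (g x) (h x)).
Proof. by move=> pJ pf pg ph; rewrite /j_zero; pt_solve_check. Qed.

Ltac pt_check ::= lazymatch goal with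
  | |- pt (fun x => jS (@?J x)) => apply: pt_jS
  | |- pt (fun x => jA (@?J x)) => apply: pt_jA
  | |- pt (fun x => jm (@?J x)) => apply: pt_jm
  | |- pt (fun x => jn (@?J x)) => apply: pt_jn
  | |- pt (fun x => jbound (@?J x)) => apply: pt_jbound
  | |- pt (fun x => jtag (@?J x)) => apply: pt_jtag
  | |- pt (fun x => jeps (@?J x)) => apply: pt_jeps
  | |- pt (fun x => jcoef (@?J x) (@?f x)) => apply: pt_jcoef
  | |- pt (fun x => jinit (@?J x) (@?f x)) => apply: pt_jinit
  | |- pt (fun x => jindex (@?J x) (@?f x)) => apply: pt_jindex
  | |- pt (fun x => jD (@?J x) (@?f x)) => apply: pt_jD
  | |- pt (fun x => jtarget (@?J x) (@?f x) (@?g x)) => apply: pt_jtarget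
  | |- pt (fun x => jact (@?J x) (@?f x) (@?g x)) => apply: pt_jact
  | |- pt (fun x => jX (@?J x) (@?f x) (@?g x)) => apply: pt_jX
  | |- pt (fun x => jlab (@?J x) (@?f x) (@?g x)) => apply: pt_jlab
  | |- pt (fun x => jrk (@?J x) (@?f x) (@?g x)) => apply: pt_jrk
  | |- pt (fun x => jP (@?J x) (@?f x) (@?g x) (@?h x)) => apply: pt_jP
  | |- pt (fun x => j_enabled (@?J x) (@?f x) (@?g x)) => apply: pt_j_enabled
  | |- pt (fun x => j_zero (@?J x) (@?f x) (@?g x) (@?h x)) => apply: pt_j_zero
  end.

Lemma pt_mdp_check : pt mdp_check.
Proof. by rewrite /mdp_check; pt_solve_check. Qed.

Lemma pt_terms_check : pt terms_check.
Proof. by rewrite /terms_check; pt_solve_check. Qed.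

Lemma pt_op_check : pt op_check.
Proof. by rewrite /op_check; pt_solve_check. Qed.

Lemma pt_sched_check : pt sched_check.
Proof. by rewrite /sched_check; pt_solve_check. Qed.

Lemma pt_sol_check : pt (fun p : cert * nat => sol_check p.1 p.2).
Proof. by rewrite /sol_check /descends; pt_solve_check. Qed.

Lemma pt_j_value : pt j_value.
Proof. by rewrite /j_value; pt_solve_check. Qed.

Lemma pt_rel_check : pt rel_check.
Proof. by have H := pt_j_value; rewrite /rel_check; pt_solve_check. Qed.

Lemma pt_cert_check : pt cert_check.
Proof.
have h1 := pt_mdp_check; have h2 := pt_terms_check; have h3 := pt_op_check.
have h4 := pt_sched_check; have h5 := pt_rel_check.
rewrite /cert_check; do 4! (apply: pt_andb => //); apply: pt_andb => //.
by apply: pt_all; [pt_solve_check|exact: pt_sol_check].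
Qed.

Lemma pt_cert_numbers : pt cert_numbers.
Proof. by rewrite /cert_numbers /crat_numbers; pt_solve_check. Qed.

Definition dec_crat : tree -> crat :=
  dec_prod (dec_prod (dec_prod dec_bool dec_bnat) dec_bnat) (dec_prod dec_bnat dec_bnat).
Definition dec_cert : tree -> cert :=
  dec_prod (dec_prod (dec_prod (dec_prod (dec_prod
    (dec_prod (dec_prod (dec_prod dec_nat dec_nat) dec_nat) dec_nat)
    (dec_seq (dec_seq (dec_seq dec_crat))))
    (dec_seq (dec_prod (dec_prod (dec_prod dec_crat dec_nat) dec_nat) (dec_seq dec_bool))))
    (dec_prod dec_crat (dec_prod dec_nat dec_crat)))
    (dec_seq (dec_seq dec_nat)))
    (dec_seq (dec_prod (dec_prod (dec_prod (dec_seq dec_bnat) dec_bnat) (dec_seq dec_nat))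
       (dec_seq dec_nat))).

Lemma pt_dec_cert : pt dec_cert.
Proof.
rewrite /dec_cert /dec_crat.
by repeat first [exact: pt_dec_bool | exact: pt_dec_nat | exact: pt_dec_bnat
  | apply: pt_dec_seq | apply: pt_dec_prod].
Qed.

Lemma dec_certK (J : cert) : dec_cert (enc J) = J.
Proof.
rewrite /dec_cert /dec_crat.
by repeat first [exact: dec_boolK | exact: dec_natK | exact: dec_bnatK
  | move=> ?; apply: dec_seqK | move=> ?; apply: dec_prodK | apply: dec_seqK
  | apply: dec_prodK].
Qed.

Definition seq_eqb (l l' : seq nat) : bool :=
  (size l == size l') && all (fun i => nth 0 l i == nth 0 l' i) (iota 0 (size l)).

Lemma seq_eqbP l l' : reflect (l = l') (seq_eqb l l').
Proof.
apply: (iffP andP) => [[/eqP sl /allP H]|->]; last by split=> //; apply/allP.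
by apply: (@eq_from_nth _ 0) => // i il; apply/eqP/H; rewrite mem_iota.
Qed.

Lemma pt_seq_eqb (X : encType) (f g : X -> seq nat) :
  pt f -> pt g -> pt (fun x => seq_eqb (f x) (g x)).
Proof.
move=> pf pg; rewrite /seq_eqb; apply: pt_andb; first by pt_solve.
have hf : pt (fun p : X * nat => f p.1) by apply: (pt_comp pf); pt_solve.
have hg : pt (fun p : X * nat => g p.1) by apply: (pt_comp pg); pt_solve.
by pt_solve.
Qed.

Definition vletter (x : option bool + bool) : nat :=
  match x with
  | inl None => 0 | inl (Some b) => (b : nat).+1 | inr b => (b : nat).+3
  end.

Definition wcodeb (ns : seq bnat) : seq nat :=
  flatten [seq [seq (nat_of_bool b).+1 | b <- binary (nb n)] ++ [:: 0] | n <- ns].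

(** Letters below 3 belong to the word and 3 and 4 to the certificate, so two filters separate
    them. *)
Definition verify_code (l : seq nat) : bool :=
  let J := dec_cert (parse_tree [seq a == 4 | a <- [seq a <- l | 3 <= a]]) in
  seq_eqb (wcodeb (cert_numbers J)) [seq a <- l | a < 3] && cert_check J.

Definition verify (x : seq (option bool + bool)) : bool := verify_code (map vletter x).

Lemma polytime_verify : polytime_decidable verify.
Proof.
have pJ : pt (fun l : seq nat =>
    dec_cert (parse_tree [seq a == 4 | a <- [seq a <- l | 3 <= a]])).
  by apply: (pt_comp pt_dec_cert); apply: pt_parse; pt_solve.
have pV : pt verify_code.
  apply: pt_andb; last exact: (pt_comp pt_cert_check pJ).
  have h := pt_comp pt_cert_numbers pJ.
  by apply: pt_seq_eqb; rewrite /wcodeb; pt_solve.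
apply: (@polytime_of_pt _ _ vletter [:: false; true] false
  (fun l => [:: nat_of_bool (verify_code l)])).
- by pt_solve.
- by move=> x; rewrite /verify; case: (verify_code _).
- by move=> x; case: (verify_code _).
Qed.

End Verifier.
Import Verifier.

(** * Existence, uniqueness and size of the solution of the Buechi equations *)

Module LinearSystems.
Import perm all_classical all_reals all_analysis.
Import Order.TTheory GRing.Theory Num.Theory.
Local Open Scope ring_scope.

(** The rank is the length of a shortest path into [Y]; the second state on such a path has a
    smaller one. *)
Lemma rank_exists (T : finType) (e : rel T) (Y : pred T) :
  exists rk : T -> nat, (forall s, (rk s <= #|T|)%N) /\
  forall s, ~~ Y s -> [exists y, Y y && connect e s y] ->
    exists t, [/\ e s t, (rk t < rk s)%N & [exists y, Y y && connect e t y]].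
Proof.
pose D s k := [exists p : k.-tuple T, path e s p && Y (last s p)].
pose rk s := find (D s) (iota 0 #|T|).
exists rk; split=> [s|s nY /existsP[y /andP[Yy /connectP[p pp yE]]]].
  by rewrite (leq_trans (find_size _ _)) // size_iota.
have hasD : has (D s) (iota 0 #|T|).
  (* A path without repetitions has fewer than [#|T|] edges, so the search range is long enough. *)
  rewrite yE in Yy; case/shortenP: pp Yy => p' pp' up' _ Yp'.
  apply/hasP; exists (size p'); last first.
    by apply/existsP; exists (in_tuple p'); rewrite pp'.
  rewrite mem_iota /= add0n; have := max_card (mem (s :: p')).
  by rewrite (card_uniqP up').
have := nth_find 0%N hasD; rewrite -/(rk s).
have rks : (rk s < #|T|)%N by move: hasD; rewrite has_find size_iota.
rewrite nth_iota // add0n; case k: (rk s) => [|k'] /existsP[q].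
  by rewrite [q]tuple0 /= (negPf nY).
case/tupleP: q => t q /= /andP[/andP[est pq] Yq].
exists t; split=> //; last first.
  by apply/existsP; exists (last t q); rewrite Yq /=; apply/connectP; exists q.
rewrite ltnS leqNgt; apply/negP => lt_k; have := before_find 0%N lt_k.
rewrite nth_iota ?add0n; last by rewrite (ltn_trans _ rks) // k.
by move=> /existsP; apply; exists q; rewrite pq.
Qed.

Section Solution.
Variables (M : mdp) (d : state M -> action M) (T : {set state M}).
Hypothesis den : forall s, enabled s (d s).
Local Notation p s t := (trans s (d s) t).

Definition solves (lab rk : state M -> nat) (x : state M -> rat) : Prop :=
  [/\ forall s, lab s = 0%N ->
        [/\ s \notin T, x s = 0 & forall t, p s t != 0 -> lab t = 0%N],
      forall s, lab s = 1%N ->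
        [/\ s \in T \/ exists2 t, p s t != 0 & (rk t < rk s)%N, x s = 1 &
            forall t, p s t != 0 -> lab t = 1%N] &
      forall s, lab s != 0%N -> lab s != 1%N ->
        (exists2 t, p s t != 0 & (rk t < rk s)%N) /\ x s = \sum_t p s t * x t].

Lemma p_ge0 s t : 0 <= p s t.
Proof. by case/andP: (trans_bounds s (d s) t). Qed.

Lemma p_sum s : \sum_t p s t = 1.
Proof. exact/eqP/den. Qed.

(** The difference between the true and the claimed values is 0 on labels 0 and 1 and harmonic
    elsewhere. The maximum principle, fed with the ranks, applies to it and to its negative. *)
Lemma solves_sound (R : realType) (sigma : scheduler R M) lab rk x :
  (forall h s a, decision sigma h s a = (a == d s)%:R) -> solves lab rk x ->
  forall s, buechi_prob sigma s T = ratr (x s).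
Proof.
move=> sd [H0 H1 H2].
have pn s t : (chain_prob R d s t != 0) = (p s t != 0) by rewrite /chain_prob fmorph_eq0.
have h0 s : lab s = 0%N -> buechi_prob sigma s T = 0.
  move=> ls; apply: (buechi_zero sd (C := fun s => lab s == 0%N)); rewrite ?ls //.
    by move=> u t /eqP/H0[_ _ cl]; rewrite pn => /cl ->.
  by move=> u /eqP/H0[].
have h1 s : lab s = 1%N -> buechi_prob sigma s T = 1.
  move=> ls; apply: (@buechi_one R M sigma d sd T (fun s => lab s == 1%N) _ rk); rewrite ?ls //.
    by move=> u t /eqP/H1[_ _ cl]; rewrite pn => /cl ->.
  by move=> u /eqP/H1[[|[t]] *]; [left|right; exists t; rewrite ?pn].
have xh s : lab s != 0%N -> lab s != 1%N ->
    ratr (x s) = \sum_t chain_prob R d s t * ratr (x t) :> R.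
  move=> l0 l1; have [_ ->] := H2 s l0 l1; rewrite rmorph_sum /=.
  by apply: eq_bigr => t _; rewrite rmorphM.
pose g s : R := buechi_prob sigma s T - ratr (x s).
have gE s : lab s != 0%N -> lab s != 1%N -> g s = \sum_t chain_prob R d s t * g t.
  move=> l0 l1; rewrite /g (buechi_harmonic sd) xh // -sumrB.
  by apply: eq_bigr => t _; rewrite mulrBr.
have g0 s : lab s = 0%N \/ lab s = 1%N -> g s = 0.
  case=> ls; rewrite /g; first by have [_ -> _] := H0 s ls; rewrite h0 // rmorph0 subrr.
  by have [_ -> _] := H1 s ls; rewrite h1 // rmorph1 subrr.
have key (f : state M -> R) : (forall s, lab s = 0%N \/ lab s = 1%N -> f s = 0) ->
    (forall s, lab s != 0%N -> lab s != 1%N ->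
       f s = \sum_t chain_prob R d s t * f t) -> forall s, f s <= 0.
  move=> f0 fE s; apply: (max_principle (rk := rk) (C := predT)
    (chain_prob_ge0 R d) (chain_prob_sum sd)) => // u _.
  have [l0|l0] := eqVneq (lab u) 0%N; first by left; rewrite f0 //; left.
  have [l1|l1] := eqVneq (lab u) 1%N; first by left; rewrite f0 //; right.
  right; rewrite -fE //; split=> //; have [[t pt rt] _] := H2 u l0 l1.
  by exists t; rewrite ?pn.
have g_le s : g s <= 0 by exact: key.
have g_ge s : - g s <= 0.
  apply: (key (fun s => - g s)) => [u /g0 ->|u l0 l1]; first by rewrite oppr0.
  by rewrite gE // -sumrN; apply: eq_bigr => t _; rewrite mulrN.
move=> s; apply/eqP; rewrite -subr_eq0 -/(g s) eq_le g_le /=.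
by rewrite -oppr_le0 g_ge.
Qed.

(** A state is [bad] if it cannot reach the target and [doomed] if it can reach a bad one. Label 0
    is for bad states, 1 for those not doomed, 2 for the rest. Ranks measure the distance to the
    target within label 1 and the distance to the bad states otherwise. *)
Lemma labels_exist : exists (lab rk : state M -> nat),
  [/\ forall s, (lab s <= 2)%N /\ (rk s <= (mdp_ns M).+1)%N,
      forall s, lab s = 0%N -> s \notin T /\ forall t, p s t != 0 -> lab t = 0%N,
      forall s, lab s = 1%N ->
        (s \in T \/ exists2 t, p s t != 0 & (rk t < rk s)%N) /\
        (forall t, p s t != 0 -> lab t = 1%N) &
      forall s, lab s != 0%N -> lab s != 1%N ->
        exists2 t, p s t != 0 & (rk t < rk s)%N].
Proof.
pose e s t := p s t != 0.
pose bad s := ~~ [exists y, (y \in T) && connect e s y].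
pose doomed s := [exists y, bad y && connect e s y].
have reachS (Y : pred (state M)) s t : e s t ->
    [exists y, Y y && connect e t y] -> [exists y, Y y && connect e s y].
  move=> est /existsP[y /andP[Yy cy]]; apply/existsP; exists y; rewrite Yy /=.
  exact: connect_trans (connect1 est) cy.
have [rT [bT HT]] := rank_exists e (mem T).
have [rB [bB HB]] := rank_exists e bad.
pose lab s : nat := if bad s then 0%N else if doomed s then 2%N else 1%N.
pose rk s := if lab s == 1%N then rT s else rB s.
exists lab, rk; split.
- move=> s; rewrite /rk; split; first by rewrite /lab; case: ifP => // _; case: ifP.
  by rewrite -[X in (_ <= X)%N]card_ord; case: ifP => _; [apply: bT|apply: bB].
- move=> s; rewrite {1}/lab; case bs: (bad s); last by case: ifP.
  move=> _; split.
    apply: contraL bs => sT; rewrite negbK; apply/existsP; exists s.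
    by rewrite sT connect0.
  move=> t est; rewrite /lab ifT //; apply: contra bs => H; exact: reachS est H.
- move=> s; rewrite {1}/lab; case bs: (bad s) => //; case ds: (doomed s) => // _.
  have good t : e s t -> lab t = 1%N.
    move=> est; rewrite /lab; have nd : doomed t = false.
      by apply: contraFF ds => H; exact: reachS est H.
    rewrite nd ifF //; apply: contraFF nd => bt; apply/existsP; exists t.
    by rewrite bt connect0.
  split; last exact: good.
  have [sT|sT] := boolP (s \in T); first by left.
  right; have [t [est lt _]] := HT s sT (negbFE bs); exists t => //.
  have ls : lab s = 1%N by rewrite /lab bs ds.
  by rewrite /rk (good t est) ls.
- move=> s; rewrite {1 2}/lab; case bs: (bad s) => //; case ds: (doomed s) => // _ _.
  have [t [est lt dt]] := HB s (negbT bs) ds; exists t => //.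
  have ls : lab s = 2%N by rewrite /lab bs ds.
  (* The successor can still reach a bad state, so it does not have label 1 and its rank is measured
     in the same way. *)
  have lt1 : (lab t == 1%N) = false.
    by rewrite /lab; case: ifP => // _; rewrite -/(doomed t) in dt; rewrite dt.
  by rewrite /rk ls lt1.
Qed.

(** A product instead of a least common multiple: it is just as good for clearing denominators, and
    polynomially many bits are all that is needed. *)
Definition all_dens : nat :=
  (\prod_(s : state M) \prod_(a : action M) \prod_(t : state M) `|denq (trans s a t)|)%N.

Lemma dvdn_all_dens (s : state M) (a : action M) (t : state M) : (`|denq (trans s a t)| %| all_dens)%N.
Proof.
rewrite /all_dens (bigD1 s) //= (bigD1 a) //= (bigD1 t) //=.
by rewrite -!mulnA dvdn_mulr.
Qed.

Lemma all_dens_gt0 : (0 < all_dens)%N.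
Proof.
rewrite /all_dens; do 3! (apply: prodn_gt0 => ?).
by rewrite absz_gt0 denq_neq0.
Qed.

(** The Leibniz formula has [n!] terms, each a product of [n] entries. *)
Lemma det_bound n (B : 'M[int]_n) (b : nat) :
  (forall i j, `|B i j| <= b%:Z) -> (`|\det B| <= n`! * b ^ n)%N.
Proof.
move=> Bb; rewrite -lez_nat abszE /determinant.
apply: le_trans (ler_norm_sum _ _ _) _.
apply: (@le_trans _ _ (\sum_(s : 'S_n) (b ^ n)%:Z)); last first.
  by rewrite sumr_const card_Sn -mulr_natr natz -PoszM mulnC.
apply: ler_sum => s _; rewrite normrM normrX normrN1 expr1n mul1r normr_prod.
rewrite -[(b ^ n)%:Z]natz natrX -[X in _ ^+ X]card_ord -prodr_const.
by apply: ler_prod => i _; rewrite normr_ge0 /= natz Bb.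
Qed.

(** The system has the identity minus the transition matrix restricted to label 2. Multiplying by
    all denominators gives an integer matrix [B] with entries of size at most [2 * all_dens], and
    [|\det B|] is a common denominator of the solution. *)
Lemma solution_exists (R : realType) : exists lab rk (N : state M -> nat) (D : nat),
  [/\ (0 < D)%N, (D <= (mdp_ns M).+1`! * (2 * all_dens) ^ (mdp_ns M).+1)%N,
      forall s, (N s <= D)%N,
      forall s, (lab s <= 2)%N /\ (rk s <= (mdp_ns M).+1)%N &
      solves lab rk (fun s => (N s)%:R / D%:R)].
Proof.
have [lab [rk [lr H0 H1 H2]]] := labels_exist.
pose A : 'M[rat]_((mdp_ns M).+1) := \matrix_(s, t)
  ((s == t)%:R - (lab s == 2%N)%:R * p s t).
have lab2 s : lab s != 0%N -> lab s != 1%N -> lab s = 2%N.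
  by have [] := lr s; case: (lab s) => [|[|[|]]].
have mulA (v : state M -> rat) s : \sum_t A s t * v t =
    v s - (lab s == 2%N)%:R * \sum_t p s t * v t.
  under eq_bigr do rewrite mxE mulrBl.
  rewrite sumrB (bigD1 s) //= eqxx mul1r big1 ?addr0 => [|t ne]; last first.
    by rewrite eq_sym (negPf ne) mul0r.
  by rewrite mulr_sumr; congr (_ - _); apply: eq_bigr => t _; rewrite mulrA.
(* A kernel vector is harmonic on label 2 and 0 elsewhere; the maximum principle for it and for its
   negative makes it vanish. *)
have Au : A \in unitmx.
  rewrite -unitmx_tr -row_free_unit; apply: inj_row_free => v vA.
  have vE s : v ord0 s = (lab s == 2%N)%:R * \sum_t p s t * v ord0 t.
    have h : (v *m A^T) ord0 s = 0 by rewrite vA mxE.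
    have E : \sum_t A s t * v ord0 t = 0.
      by rewrite mxE in h; rewrite -[RHS]h; apply: eq_bigr => t _; rewrite [A^T _ _]mxE mulrC.
    by apply/eqP; rewrite -subr_eq0 -(mulA (fun t => v ord0 t)) E.
  have key (f : state M -> rat) :
      (forall s, f s = (lab s == 2%N)%:R * \sum_t p s t * f t) -> forall s, f s <= 0.
    move=> fE s; apply: (max_principle (rk := rk) (C := predT) p_ge0 p_sum) => // u _.
    have [l2|l2] := eqVneq (lab u) 2%N; last by left; rewrite fE (negPf l2) mul0r.
    right; split; first by rewrite {1}fE l2 eqxx mul1r.
    by apply: H2; rewrite l2.
  apply/rowP => s; rewrite mxE; apply/eqP; rewrite eq_le.
  rewrite (key (fun s => v ord0 s)) //= -oppr_le0 (key (fun s => - v ord0 s)) // => u.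
  by rewrite vE -mulrN -sumrN; congr (_ * _); apply: eq_bigr => t _; rewrite mulrN.
pose b : 'cV[rat]_((mdp_ns M).+1) := \col_s (lab s == 1%N)%:R.
pose xc := invmx A *m b; pose x s := xc s ord0.
have AxE : A *m xc = b by rewrite mulmxA mulmxV // mul1mx.
have xE s : x s - (lab s == 2%N)%:R * \sum_t p s t * x t = (lab s == 1%N)%:R.
  rewrite -mulA; have := congr1 (fun B : 'cV_(mdp_ns M).+1 => B s ord0) AxE.
  by rewrite !mxE => <-; apply: eq_bigr => t _; rewrite mxE.
have sx : solves lab rk x.
  split.
  - move=> s ls; have [sT cl] := H0 s ls; split=> //.
    by have := xE s; rewrite ls /= mul0r subr0.
  - move=> s ls; have [sT cl] := H1 s ls; split=> //.
    by have := xE s; rewrite ls /= mul0r subr0.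
  - move=> s l0 l1; split; first exact: H2.
    have := xE s; rewrite (lab2 s l0 l1) /= mul1r => /eqP.
    by rewrite subr_eq0 => /eqP.
pose L := all_dens.
pose z s t : int := numq (p s t) * (L %/ `|denq (p s t)|)%N%:Z.
have zE s t : (z s t)%:~R = L%:R * p s t.
  have dv := dvdn_all_dens s (d s) t.
  have dE : `|denq (p s t)|%N%:R = (denq (p s t))%:~R :> rat by rewrite pmulrn absz_denq.
  by rewrite /z intrM numqE -dE -pmulrn -mulrA -natrM [X in X%:R]mulnC (divnK dv) mulrC.
pose B : 'M[int]_((mdp_ns M).+1) := \matrix_(s, t)
  (L%:Z * (s == t)%:R - (lab s == 2%N)%:R * z s t).
have BA : map_mx intr B = L%:R *: A.
  apply/matrixP => s t; rewrite !mxE intrB intrM [((lab s == 2%N)%:R * z s t)%:~R]intrM.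
  rewrite zE mulrBr; congr (_ - _); first by rewrite -pmulrn rmorph_nat.
  by rewrite rmorph_nat mulrCA.
have L0 : L%:R != 0 :> rat by rewrite pnatr_eq0 -lt0n all_dens_gt0.
have detB : \det B != 0.
  have detA : \det A != 0 by move: Au; rewrite unitmxE unitfE.
  rewrite -(intr_eq0 rat) -det_map_mx BA detZ; apply: mulf_neq0 => //.
  exact: expf_neq0.
(* Cramer's rule in the form [\det B *: xc = \adj B *m (L *: b)], whose right side is integral. *)
have int_x s : exists w : int, (\det B)%:~R * x s = w%:~R.
  have E : (\det B)%:~R *: xc = map_mx intr (\adj B) *m (L%:R *: b).
    rewrite -AxE scalemxAl -BA mulmxA map_mx_adj mul_adj_mx det_map_mx.
    by rewrite mul_scalar_mx.
  exists (\sum_t (\adj B) s t * (L%:Z * (lab t == 1%N)%:R)).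
  have h : ((\det B)%:~R *: xc) s ord0 = (\det B)%:~R * x s by rewrite mxE.
  rewrite -h E mxE rmorph_sum /=; apply: eq_bigr => t _.
  rewrite [map_mx _ _ _ _]mxE [(_ *: b) _ _]mxE [b _ _]mxE.
  by rewrite !intrM -pmulrn rmorph_nat.
(* The solution consists of Buechi probabilities of the chain, which bounds it without a look at the
   linear system. *)
have x01 s : 0 <= x s <= 1.
  have [sg md sd] := @md_scheduler R M d den.
  have E := solves_sound sd sx s.
  have h0 : 0 <= buechi_prob sg s T by first [exact: buechi_ge0 | exact: (buechi_ge0 sd)].
  have h1 : buechi_prob sg s T <= 1 by first [exact: buechi_le1 | exact: (buechi_le1 sd)].
  have r1 : (1 : R) = ratr 1 by rewrite rmorph1.
  by move: h0 h1; rewrite E ler0q r1 ler_rat => -> ->.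
have [w wE] := fin_all_exists int_x.
have NE s : (`|w s|%N%:R / `|\det B|%N%:R : rat) = x s.
  have /andP[x0 _] := x01 s.
  rewrite !natr_absz !intr_norm -wE normrM (ger0_norm x0) mulrAC divff ?mul1r //.
  by rewrite normr_eq0 intr_eq0.
have z01 s t : 0 <= z s t <= L%:Z.
  have /andP[p0 p1] := trans_bounds s (d s) t.
  rewrite -(ler0z rat) -(ler_int rat) zE -pmulrn mulr_ge0 ?ler0n //=.
  by rewrite ler_piMr ?ler0n.
exists lab, rk, (fun s => `|w s|%N), `|\det B|%N; split=> //.
- by rewrite absz_gt0.
- apply: det_bound => s t; rewrite mxE; have := z01 s t; rewrite -/L.
  by case: (s == t); case: (lab s == 2%N); rewrite /= ?mulr1 ?mulr0 ?mul1r ?mul0r; lia.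
- move=> s; have /andP[_] := x01 s; rewrite -NE ler_pdivrMr ?mul1r ?ler_nat //.
  by rewrite ltr0n absz_gt0.
- by rewrite (_ : (fun s => _) = x) //; apply/funext => s; exact: NE.
Qed.

End Solution.

End LinearSystems.
Import LinearSystems.

(** * Sizes of certificates in terms of the length of the encoded instance *)

Module CertificateSizes.
Import all_classical all_reals all_analysis.
Import Order.TTheory GRing.Theory Num.Theory.

Lemma wcodebE ns : wcodeb ns = wcode binary (map nb ns).
Proof. by rewrite /wcodeb /wcode -map_comp. Qed.

Lemma letters_vletter : cancel (fun a => vletter (inl a)) (nth None letters).
Proof. by case=> [[]|]. Qed.

Lemma map_vletter_write ns :
  map (fun a => vletter (inl a)) (write binary ns) = wcode binary ns.
Proof.
rewrite -wcodeE -map_comp; apply: map_id_in => i /(allP (wcode_lt _ _)).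
by case: i => [|[|[|]]].
Qed.

Lemma verify_word (x : seq (option bool)) (c : seq bool) :
  verify (map inl x ++ map inr c) =
  seq_eqb (wcodeb (cert_numbers (dec_cert (parse_tree c))))
    (map (fun a => vletter (inl a)) x) && cert_check (dec_cert (parse_tree c)).
Proof.
rewrite /verify /verify_code map_cat -!map_comp !filter_cat.
have -> : [seq a <- map (vletter \o inl) x | 3 <= a] = [::].
  by elim: x => //= -[[]|] x IH.
have -> : [seq a <- map (vletter \o inl) x | a < 3] = map (fun a => vletter (inl a)) x.
  by elim: x => //= -[[]|] x -> /=.
have -> : [seq a <- map (vletter \o inr) c | a < 3] = [::].
  by elim: c => //= -[] c IH.
have -> : [seq a <- map (vletter \o inr) c | 3 <= a] = map (vletter \o inr) c.
  by elim: c => //= -[] c -> /=.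
have -> : [seq a == 4 | a <- [::] ++ map (vletter \o inr) c] = c.
  by rewrite cat0s -map_comp; apply: map_id_in => -[].
by rewrite cats0.
Qed.

Lemma wcodeb_eq x ns : reflect (x = write binary (map nb ns))
  (seq_eqb (wcodeb ns) (map (fun a => vletter (inl a)) x)).
Proof.
rewrite wcodebE; apply: (iffP (seq_eqbP _ _)) => [E|->]; last by rewrite map_vletter_write.
by rewrite -wcodeE E -map_comp map_id_in // => a _; exact: letters_vletter.
Qed.

Lemma all_iotaP n (F : nat -> bool) :
  reflect (forall i : 'I_n, F i) (all F (iota 0 n)).
Proof.
apply: (iffP allP) => H i; first by apply: H; rewrite mem_iota add0n /=.
by rewrite mem_iota add0n /= => lt_in; exact: (H (Ordinal lt_in)).
Qed.

Lemma has_iotaP n (F : nat -> bool) :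
  reflect (exists i : 'I_n, F i) (has F (iota 0 n)).
Proof.
apply: (iffP hasP) => [[i]|[i Fi]]; last by exists (i : nat); rewrite // mem_iota add0n /=.
by rewrite mem_iota add0n /= => lt_in Fi; exists (Ordinal lt_in).
Qed.

Lemma nth_map_enum (T : Type) (x0 : T) n (F : 'I_n -> T) (i : 'I_n) :
  nth x0 [seq F j | j <- enum 'I_n] i = F i.
Proof. by rewrite (nth_map i) ?size_enum_ord // nth_ord_enum. Qed.

Lemma map_nb_flatten n (f : nat -> seq bnat) :
  map nb (flatten [seq f i | i <- iota 0 n]) = list_all (fun i : 'I_n => map nb (f i)).
Proof. by rewrite (list_all_ord n (fun i => map nb (f i))) map_flatten -map_comp. Qed.

Section Small.
Variable K : nat.
Local Notation B := (K + 2).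

(** Sizes are tracked by exponents of [K + 2] alone: a pair or a list of at most [K] entries raises
    the exponent by two, so nested data are bounded by counting. *)
Definition small (X : encType) (e : nat) (x : X) : Prop := sz x <= B ^ e.

Lemma pow_gt0 e : 0 < B ^ e.
Proof. by rewrite expn_gt0 addn2. Qed.

Lemma pow_le e f : e <= f -> B ^ e <= B ^ f.
Proof. by move=> ef; rewrite leq_pexp2l // addn2. Qed.

Lemma pow_S e c : c <= B -> c * B ^ e <= B ^ e.+1.
Proof. by move=> cB; rewrite expnS leq_mul2r cB orbT. Qed.

Lemma pow_double e : 2 * B ^ e <= B ^ e.+1.
Proof. by apply: pow_S; rewrite addn2. Qed.

Lemma small_le (X : encType) e f (x : X) : e <= f -> small e x -> small f x.
Proof. by move=> /pow_le ef h; apply: leq_trans h ef. Qed.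

Lemma small_pair (X Y : encType) e (x : X) (y : Y) :
  small e x -> small e y -> small e.+2 (x, y).
Proof.
rewrite /small sz_pair /=; have := pow_double e; have := pow_double e.+1.
by have := pow_gt0 e; lia.
Qed.

Lemma small_seq (X : encType) e (l : seq X) :
  size l <= K -> all (fun x => sz x <= B ^ e) l -> small e.+2 l.
Proof.
move=> lK /sz_seq_le h; rewrite /small; apply: leq_trans h _.
have h1 := pow_double e; have h0 := pow_gt0 e.
apply: (@leq_trans (B ^ e.+1 * K + 1)).
  by rewrite leq_add2r; apply: leq_mul => //; lia.
have := pow_gt0 e.+1; have : B ^ e.+2 = B ^ e.+1 * K + B ^ e.+1 * 2 by rewrite expnSr mulnDr.
by lia.
Qed.

Lemma small_map (T : Type) (X : encType) e (l : seq T) (f : T -> X) :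
  size l <= K -> (forall t, small e (f t)) -> small e.+2 (map f l).
Proof.
move=> lK fe; apply: small_seq; rewrite ?size_map //.
by elim: l {lK} => //= a l ->; rewrite andbT; exact: fe.
Qed.

Lemma small_nat (n : nat) : n <= B -> small 3 n.
Proof. by rewrite /small sz_nat => nB; rewrite !expnS expn0 muln1; nia. Qed.

Lemma small_bool (b : bool) : small 2 b.
Proof. by apply: leq_trans (sz_bool b) _; rewrite !expnS expn0 muln1; nia. Qed.

Lemma small_bnat e (n : bnat) : bitlen (nb n) <= B ^ e -> small (e + 3) n.
Proof.
move=> h; apply: leq_trans (sz_bnat n) _; rewrite addn3.
have := pow_double e; have := pow_double e.+1; have := pow_double e.+2.
by have := pow_gt0 e; lia.
Qed.

Lemma small_crat (x : rat) (q : crat) :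
  nb (cnum q) = `|numq x|%N -> nb (cden q) = `|denq x|%N ->
  nb q.2.1 <= (nb (cnum q)).+1 /\ nb q.2.2 <= nb (cden q) ->
  bitlen `|numq x|%N <= K -> bitlen `|denq x|%N <= K -> small 10 q.
Proof.
case: q => [[[b n] d] [u v]] /= nE dE [uE vE] nK dK.
rewrite /cnum /cden /= in nE dE uE vE.
have K1 k : k <= K -> k <= B ^ 1 by rewrite expn1; lia.
have hn : small 4 n by apply: (@small_bnat 1); rewrite nE K1.
have hd : small 4 d by apply: (@small_bnat 1); rewrite dE K1.
have hv : small 4 v.
  by apply: (@small_bnat 1); apply: K1; apply: leq_trans (leq_bitlen vE) _; rewrite dE.
have hu : small 4 u.
  apply: (@small_bnat 1); rewrite expn1; apply: leq_trans (leq_bitlen uE) _.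
  rewrite -addn1; apply: leq_trans (bitlenD _ _) _; rewrite nE.
  have b1 : bitlen 1 <= 1 by exact: bitlen_le.
  by lia.
apply: (@small_pair _ _ 8); last first.
  by apply: (@small_le _ 6) => //; apply: (@small_pair _ _ 4).
apply: (@small_pair _ _ 6); last by apply: (@small_le _ 4).
by apply: (@small_pair _ _ 4) => //; apply: (@small_le _ 2) => //; exact: small_bool.
Qed.

Lemma bitlen_prod (T : finType) (f : T -> nat) e : #|T| <= K ->
  (forall i, bitlen (f i) <= B ^ e) -> bitlen (\prod_i f i) <= B ^ e.+1.
Proof.
move=> TK fe; apply: (@leq_trans (#|T| * B ^ e + 1)).
  have -> : \prod_i f i = \prod_(i <- enum T) f i by rewrite big_enum.
  rewrite cardE; elim: (enum T) => [|a l IH] /=.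
    by rewrite big_nil; exact: (bitlen_le 1).
  rewrite big_cons; apply: leq_trans (bitlenM _ _) _.
  by have := fe a; rewrite mulSn; lia.
rewrite expnS mulnDl; apply: leq_add; first by rewrite leq_mul2r TK orbT.
by rewrite muln_gt0 pow_gt0.
Qed.

Lemma bitlenX a k e : k <= K -> bitlen a <= B ^ e -> bitlen (a ^ k) <= B ^ e.+1.
Proof.
move=> kK ae; rewrite -[X in _ ^ X]card_ord -prod_nat_const.
by apply: bitlen_prod; rewrite ?card_ord.
Qed.

Lemma bitlen_fact n : n <= K -> bitlen n`! <= B ^ 2.
Proof.
move=> nK; rewrite fact_prod big_add1 /= big_mkord.
apply: bitlen_prod; rewrite ?card_ord // => i; rewrite expn1.
by apply: leq_trans (bitlen_le _) _; have := ltn_ord i; lia.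
Qed.
End Small.

Lemma bitlen_write n ns : n \in ns -> bitlen n <= size (write binary ns).
Proof.
elim: ns => //= m ns IH; rewrite inE /write /= size_cat size_rcons size_map size_binary.
by case/orP=> [/eqP->|/IH]; rewrite /write; lia.
Qed.

Lemma size_write ns : size ns <= size (write binary ns).
Proof.
elim: ns => //= m ns IH; rewrite /write /= size_cat size_rcons.
by rewrite /write in IH; lia.
Qed.

Lemma mem_list_all (T : finType) (f : T -> seq nat) x n : n \in f x -> n \in list_all f.
Proof. by move=> nf; apply/flattenP; exists (f x) => //; apply: map_f; rewrite mem_enum. Qed.

Lemma card_list_all (T : finType) (f : T -> seq nat) :
  (forall x, 0 < size (f x)) -> #|T| <= size (list_all f).
Proof.
move=> f0; rewrite /list_all cardE; elim: (enum T) => //= a l IH.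
by rewrite size_cat; have := f0 a; lia.
Qed.

Lemma leq_size_list_all (T : finType) (f : T -> seq nat) x : size (f x) <= size (list_all f).
Proof.
have : x \in enum T by rewrite mem_enum.
rewrite /list_all; elim: (enum T) => //= a l IH; rewrite inE size_cat.
by move=> /orP[/eqP->|/IH]; [exact: leq_addr | lia].
Qed.

(** The numbers of states, actions and terms are written in binary and could be exponential in their
    own length; they are bounded because the word also lists something for each state, action and
    term. *)
Lemma rel_buechi_bounds (I : rel_buechi_instance) (K : nat) :
  K = size (write binary (rel_buechi_numbers I)) ->
  [/\ (mdp_ns (rb_mdp I)).+1 <= K /\ (mdp_na (rb_mdp I)).+1 <= K,
      rb_m I <= K /\ rb_n I <= K,
      forall (s : state (rb_mdp I)) a t, bitlen `|numq (trans s a t)|%N <= K /\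
        bitlen `|denq (trans s a t)|%N <= K,
      forall i : 'I_(rb_m I), bitlen `|numq (rb_coef i)|%N <= K /\
        bitlen `|denq (rb_coef i)|%N <= K &
      forall x, x = rb_bound I \/ (exists h, rb_op I = @OpApprox x h) \/
          (exists h, rb_op I = @OpNotApprox x h) ->
        bitlen `|numq x|%N <= K /\ bitlen `|denq x|%N <= K].
Proof.
move=> KE; pose tr := list_all (fun s : state (rb_mdp I) =>
  list_all (fun a : action (rb_mdp I) =>
    list_all (fun t : state (rb_mdp I) => rat_numbers (trans s a t)))).
pose tm := list_all (fun i : 'I_(rb_m I) =>
    rat_numbers (rb_coef i) ++ [:: (rb_init i : nat); (rb_index i : nat)] ++
    set_numbers (rb_target i)).
have NE : rel_buechi_numbers I = ([:: (mdp_ns (rb_mdp I)).+1; (mdp_na (rb_mdp I)).+1]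
    ++ tr) ++ [:: rb_m I; rb_n I] ++ tm ++ rat_numbers (rb_bound I) ++
    relop_numbers (rb_op I) by [].
have szK : size (rel_buechi_numbers I) <= K by rewrite KE size_write.
have mem n : n \in rel_buechi_numbers I -> bitlen n <= K by rewrite KE; exact: bitlen_write.
have ratK x : (forall n, n \in rat_numbers x -> n \in rel_buechi_numbers I) ->
    bitlen `|numq x|%N <= K /\ bitlen `|denq x|%N <= K.
  by move=> H; split; apply/mem/H; rewrite !inE eqxx ?orbT.
have trK : size tr <= K by apply: leq_trans szK; rewrite NE !size_cat; lia.
have tmK : size tm <= K by apply: leq_trans szK; rewrite NE !size_cat; lia.
have t0 (s : state (rb_mdp I)) (a : action (rb_mdp I)) :
    0 < size (list_all (fun t : state (rb_mdp I) => rat_numbers (trans s a t))).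
  by apply: leq_trans (card_list_all _) => //; rewrite card_ord.
have a0 (s : state (rb_mdp I)) : (mdp_na (rb_mdp I)).+1 <=
    size (list_all (fun a : action (rb_mdp I) =>
    list_all (fun t : state (rb_mdp I) => rat_numbers (trans s a t)))).
  by rewrite -[X in X <= _]card_ord; apply: card_list_all => a; exact: t0.
have SK : (mdp_ns (rb_mdp I)).+1 <= K.
  apply: leq_trans trK; rewrite -[X in X <= _]card_ord; apply: card_list_all => s.
  exact: leq_trans (a0 s).
have AK : (mdp_na (rb_mdp I)).+1 <= K.
  apply: leq_trans (a0 ord0) _; apply: leq_trans trK.
  exact: (@leq_size_list_all _ (fun s : state (rb_mdp I) => list_all (fun a : action (rb_mdp I) =>
    list_all (fun t : state (rb_mdp I) => rat_numbers (trans s a t)))) ord0).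
have mK : rb_m I <= K.
  apply: leq_trans tmK; rewrite -[X in X <= _]card_ord; apply: card_list_all => i.
  by rewrite size_cat.
(* Nothing is listed per scheduler, but every scheduler index is used by some term, so there are at
   most as many schedulers as terms. *)
have nK : rb_n I <= K.
  apply: leq_trans mK; rewrite -[X in X <= _]card_ord -[X in _ <= X]card_ord.
  have [g gE] := fin_all_exists (@rb_index_surj I).
  by apply: (@leq_card _ _ g) => j j' e; rewrite -(gE j) -(gE j') e.
split=> //.
- move=> s a t; apply: ratK => n h; rewrite NE !mem_cat.
  have -> : n \in tr by apply: (mem_list_all (x := s)); apply: (mem_list_all (x := a));
    exact: (mem_list_all (x := t)).
  by rewrite orbT.
- move=> i; apply: ratK => n h; rewrite NE !mem_cat.
  have -> : n \in tm by apply: (mem_list_all (x := i)); rewrite mem_cat h.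
  by rewrite !orbT.
- move=> x [->|[[h E]|[h E]]]; apply: ratK => n hn; rewrite NE !mem_cat.
  + by rewrite hn !orbT.
  + have -> : n \in relop_numbers (rb_op I) by rewrite E /relop_numbers in_cons hn orbT.
    by rewrite !orbT.
  + have -> : n \in relop_numbers (rb_op I) by rewrite E /relop_numbers in_cons hn orbT.
    by rewrite !orbT.
Qed.

End CertificateSizes.
Import CertificateSizes.

(** * Certificates as descriptions of instances, and the meaning of the checks *)

Module Representations.
Import all_classical all_reals all_analysis.
Import Verifier.
Import Order.TTheory GRing.Theory Num.Theory.
Local Open Scope ring_scope.

Lemma crat_val_eq0 q : crat_ok q -> (crat_val q == 0) = beq (cnum q) (Bn 0).
Proof.
case/crat_okP => d0 _ _; rewrite /crat_val mulf_eq0 signr_eq0 mulf_eq0 invr_eq0 !pnatr_eq0 /beq /=.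
by rewrite (gtn_eqF d0) orbF.
Qed.

Lemma crat_val_ge0 q : crat_ok q -> (0 <= crat_val q) = ~~ csign q.
Proof.
case/crat_okP => d0 _ sg; rewrite /crat_val; case: (csign q) sg => sg /=; last first.
  by rewrite mul1r divr_ge0.
apply/negbTE; rewrite -ltNge mulN1r oppr_lt0 divr_gt0 ?ltr0n //.
by rewrite lt0n sg.
Qed.

Lemma crat_val_le1 q : crat_ok q -> ~~ csign q ->
  (crat_val q <= 1) = bleq (cnum q) (cden q).
Proof.
case/crat_okP => d0 _ _ /negPf sg; rewrite /crat_val sg mul1r ler_pdivrMr ?ltr0n //.
by rewrite mul1r ler_nat.
Qed.

Lemma fsum_iota n (f : nat -> frac) : (forall i : 'I_n, frac_ok (f i)) ->
  frac_ok (fsum [seq f i | i <- iota 0 n]) /\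
  frac_val (fsum [seq f i | i <- iota 0 n]) = \sum_(i < n) frac_val (f i).
Proof.
move=> fo; have /fsumP[h1 h2] : all frac_ok [seq f i | i <- iota 0 n].
  by rewrite all_map; apply/all_iotaP.
split=> //; rewrite h2 big_map -[n in iota 0 n]subn0 -/(index_iota 0 n).
by rewrite big_mkord.
Qed.

Lemma frac_val1 : frac_val frac1 = 1.
Proof. by rewrite /frac_val /= subr0 divr1. Qed.

Lemma frac_val_nat (x d : bnat) : frac_val (x, Bn 0, d) = (nb x)%:R / (nb d)%:R.
Proof. by rewrite /frac_val /= subr0. Qed.

Lemma j_enabledE J n (s a : nat) : jS J = n ->
  (forall t : 'I_n, crat_ok (jP J s a t)) ->
  j_enabled J s a = (\sum_(t < n) crat_val (jP J s a t) == 1).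
Proof.
move=> SE ok; rewrite /j_enabled SE.
have [h1 h2] := @fsum_iota n (fun t => frac_of (jP J s a t)) (fun t => frac_of_ok (ok t)).
rewrite feqE // h2 frac_val1; congr (_ == _).
by apply: eq_bigr => t _; rewrite frac_ofE.
Qed.

(** A certificate consists of plain lists read with defaults, an instance of dependent records with
    proofs. A relation lets both directions be treated alike: from a checked certificate to an
    instance, and from an instance to its certificate. *)
Record represents (J : cert) (I : rel_buechi_instance) : Prop := Represents {
  rep_S : jS J = (mdp_ns (rb_mdp I)).+1;
  rep_A : jA J = (mdp_na (rb_mdp I)).+1;
  rep_m : jm J = rb_m I;
  rep_n : jn J = rb_n I;
  rep_P : forall (s : state (rb_mdp I)) (a : action (rb_mdp I)) (t : state (rb_mdp I)),
    crat_ok (jP J s a t) /\ crat_val (jP J s a t) = trans s a t;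
  rep_coef : forall i : 'I_(rb_m I),
    crat_ok (jcoef J i) /\ crat_val (jcoef J i) = rb_coef i;
  rep_init : forall i : 'I_(rb_m I), jinit J i = rb_init i;
  rep_index : forall i : 'I_(rb_m I), jindex J i = rb_index i;
  rep_target : forall (i : 'I_(rb_m I)) (s : state (rb_mdp I)),
    jtarget J i s = (s \in rb_target i);
  rep_bound : crat_ok (jbound J) /\ crat_val (jbound J) = rb_bound I;
  rep_op : match rb_op I with
    | OpGt => jtag J = 0%N
    | OpGe => jtag J = 1%N
    | OpApprox e _ => [/\ jtag J = 2%N, crat_ok (jeps J) & crat_val (jeps J) = e]
    | OpNotApprox e _ => [/\ jtag J = 3%N, crat_ok (jeps J) & crat_val (jeps J) = e]
    end }.

Section Represents.
Variables (J : cert) (I : rel_buechi_instance).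
Hypothesis rep : represents J I.
Local Notation M := (rb_mdp I).

Lemma rep_numbers : map nb (cert_numbers J) = rel_buechi_numbers I.
Proof.
rewrite /cert_numbers /rel_buechi_numbers /mdp_numbers !map_cat -!catA !map_nb_flatten.
rewrite (rep_S rep) (rep_A rep) (rep_m rep) (rep_n rep).
congr (_ ++ (_ ++ (_ ++ (_ ++ (_ ++ _))))) => //.
- apply: eq_list_all => s; rewrite map_nb_flatten; apply: eq_list_all => a.
  rewrite map_nb_flatten; apply: eq_list_all => t.
  by have [ok <-] := rep_P rep s a t; rewrite crat_numbersE.
- apply: eq_list_all => i; rewrite !map_cat; have [ok <-] := rep_coef rep i.
  rewrite (rep_init rep) (rep_index rep) (crat_numbersE ok).
  have tE (s : state M) : (s \in rb_target i) = jtarget J i s by rewrite (rep_target rep).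
  rewrite (set_numbersE tE).
  by rewrite -map_comp.
- by have [ok <-] := rep_bound rep; rewrite crat_numbersE.
- have := rep_op rep; case: (rb_op I) => [|| e e0 | e e0]; rewrite /relop_numbers.
  + by move=> ->.
  + by move=> ->.
  + by case=> tE ok <-; rewrite tE (crat_numbersE ok).
  + by case=> tE ok <-; rewrite tE (crat_numbersE ok).
Qed.

Lemma rep_enabled (s : state M) (a : action M) : j_enabled J s a = enabled s a.
Proof.
rewrite (j_enabledE (rep_S rep)) => [|t]; last by case: (rep_P rep s a t).
by rewrite /enabled; congr (_ == _); apply: eq_bigr => t _; case: (rep_P rep s a t).
Qed.

Lemma rep_zero (s : state M) (a : action M) (t : state M) :
  j_zero J s a t = (trans s a t == 0).
Proof. by have [ok <-] := rep_P rep s a t; rewrite crat_val_eq0. Qed.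

Lemma sol_checkP (i : 'I_(rb_m I)) (d : state M -> action M) :
  (forall s : state M, jact J (jindex J i) s = d s) ->
  sol_check J i <-> nb (jD J i) != 0%N /\
    solves d (rb_target i) (fun s => jlab J i s) (fun s => jrk J i s)
      (fun s => (nb (jX J i s))%:R / (nb (jD J i))%:R).
Proof.
move=> act; rewrite /sol_check.
case: (boolP (beq (jD J i) (Bn 0))) => D0 /=.
  by split=> // -[/negP[]].
have Dn : (nb (jD J i))%:R != 0 :> rat by rewrite pnatr_eq0.
set x := fun s : state M => _ / _.
have zeroE (s t : state M) :
    j_zero J s (jact J (jindex J i) s) t = (trans s (d s) t == 0).
  by rewrite act rep_zero.
have descE (s : state M) : descends J i s <->
    exists2 t : state M, trans s (d s) t != 0 & (jrk J i t < jrk J i s)%N.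
  rewrite /descends (rep_S rep); split=> [/has_iotaP[t]|[t h1 h2]].
    by rewrite zeroE => /andP[]; exists t.
  by apply/has_iotaP; exists t; rewrite zeroE h1.
have allE (s : state M) k :
    all (fun t => ~~ j_zero J s (jact J (jindex J i) s) t ==> (jlab J i t == k))
      (iota 0 (mdp_ns M).+1) <-> forall t : state M, trans s (d s) t != 0 -> jlab J i t = k.
  split=> [/all_iotaP H t|H].
    by have := H t; rewrite zeroE => /implyP h /h/eqP.
  by apply/all_iotaP => t; rewrite zeroE; apply/implyP => /H/eqP.
have x0 (s : state M) : beq (jX J i s) (Bn 0) = (x s == 0).
  by rewrite /x mulf_eq0 invr_eq0 (negPf Dn) orbF pnatr_eq0.
have x1 (s : state M) : beq (jX J i s) (jD J i) = (x s == 1).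
  by rewrite /x -[RHS](inj_eq (mulIf Dn)) divfK // mul1r eqr_nat.
have fok (s : state M) : frac_ok (jX J i s, Bn 0, jD J i) by [].
have sumE (s : state M) :
    feq (fsum [seq fmul (frac_of (jP J s (jact J (jindex J i) s) t))
      (jX J i t, Bn 0, jD J i) | t <- iota 0 (mdp_ns M).+1]) (jX J i s, Bn 0, jD J i) =
    (x s == \sum_t trans s (d s) t * x t).
  have ok (t : state M) : frac_ok (frac_of (jP J s (jact J (jindex J i) s) t)).
    by rewrite act; apply: frac_of_ok; case: (rep_P rep s (d s) t).
  have [h1 h2] := @fsum_iota (mdp_ns M).+1
    (fun t => fmul (frac_of (jP J s (jact J (jindex J i) s) t)) (jX J i t, Bn 0, jD J i))
    (fun t => fmul_ok (ok t) (fok t)).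
  rewrite feqE // h2 frac_val_nat eq_sym; congr (_ == _).
  apply: eq_bigr => t _; rewrite fmulE // frac_val_nat frac_ofE act.
  by have [_ ->] := rep_P rep s (d s) t.
split.
- rewrite (rep_S rep) => /all_iotaP H; split=> //; split.
  + move=> s ls; have := H s; rewrite ls eqxx (rep_target rep) x0.
    by move=> /and3P[nt /allE h /eqP e].
  + move=> s ls; have := H s; rewrite ls eqxx (_ : (1 == 0)%N = false) // (rep_target rep) x1.
    move=> /and3P[nt /allE h /eqP e]; split=> //.
    by case/orP: nt => [|/descE]; [left|right].
  + move=> s l0 l1; have := H s; rewrite (negPf l0) (negPf l1) sumE.
    by move=> /andP[/descE h /eqP e].
- case=> _ [H0 H1 H2]; rewrite (rep_S rep); apply/all_iotaP => s.
  case: ifPn => [/eqP l0|l0].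
    have [nt e h] := H0 s l0; rewrite (rep_target rep) nt x0 e eqxx andbT /=.
    exact/allE.
  case: ifPn => [/eqP l1|l1].
    have [nt e h] := H1 s l1; rewrite (rep_target rep) x1 e eqxx andbT.
    apply/andP; split; last exact/allE.
    by apply/orP; case: nt => [|nt]; [left|right; apply/descE].
  have [h e] := H2 s l0 l1; rewrite sumE -e eqxx andbT; exact/descE.
Qed.

Lemma rel_checkP (R : realType) : (forall i : 'I_(rb_m I), nb (jD J i) != 0%N) ->
  rel_check J <-> relop_holds (rb_op I)
    (ratr (\sum_(i < rb_m I) rb_coef i *
      ((nb (jX J i (rb_init i)))%:R / (nb (jD J i))%:R)) : R) (ratr (rb_bound I)).
Proof.
move=> D0; set v := \sum_(i < _) _.
have vP : frac_ok (j_value J) /\ frac_val (j_value J) = v.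
  have ok (i : 'I_(rb_m I)) : frac_ok (frac_of (jcoef J i)).
    by apply: frac_of_ok; case: (rep_coef rep i).
  have ok' (i : 'I_(rb_m I)) : frac_ok (jX J i (jinit J i), Bn 0, jD J i) by exact: D0.
  have [h1 h2] := @fsum_iota (rb_m I)
    (fun i => fmul (frac_of (jcoef J i)) (jX J i (jinit J i), Bn 0, jD J i))
    (fun i => fmul_ok (ok i) (ok' i)).
  rewrite /j_value (rep_m rep); split=> //; rewrite h2; apply: eq_bigr => i _.
  rewrite fmulE // frac_val_nat frac_ofE (rep_init rep).
  by have [_ ->] := rep_coef rep i.
have [vok vE] := vP; have [bok bE] := rep_bound rep.
have bok' := frac_of_ok bok.
pose close := fleq (j_value J) (fadd (frac_of (jbound J)) (frac_of (jeps J))) &&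
    fleq (frac_of (jbound J)) (fadd (j_value J) (frac_of (jeps J))).
have closeE : crat_ok (jeps J) -> close =
    (`|ratr v - ratr (rb_bound I)| <= ratr (crat_val (jeps J)) :> R).
  move=> eok; have eok' := frac_of_ok eok.
  rewrite /close !fleqE ?fadd_ok // !faddE // !frac_ofE vE bE.
  by rewrite -rmorphB -ratr_norm ler_rat ler_distl lerBlDr andbC.
rewrite /relop_holds /approx_eq.
have := rep_op rep; case: (rb_op I) => [|| e e0 | e e0].
- move=> tE; have -> : rel_check J = ~~ fleq (j_value J) (frac_of (jbound J)).
    by rewrite /rel_check tE.
  by rewrite fleqE // vE frac_ofE bE -ltNge ltr_rat.
- move=> tE; have -> : rel_check J = fleq (frac_of (jbound J)) (j_value J).
    by rewrite /rel_check tE.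
  by rewrite fleqE // vE frac_ofE bE ler_rat.
- case=> tE eok <-; have -> : rel_check J = close by rewrite /rel_check tE.
  by rewrite closeE.
- case=> tE eok <-; have -> : rel_check J = ~~ close by rewrite /rel_check tE.
  by rewrite closeE // -ltNge.
Qed.

End Represents.

End Representations.
Import Representations.

(** * Soundness, completeness and length of certificates *)

Module Membership.
Import all_classical all_reals all_analysis.
Import Verifier.
Import Order.TTheory GRing.Theory Num.Theory.
Local Open Scope ring_scope.

(** The checks supply the proof fields of the process, the surjectivity of the scheduler indices,
    and the sign condition on the tolerance. *)
Lemma represented (J : cert) : mdp_check J -> terms_check J -> op_check J ->
  exists I, represents J I.
Proof.
move=> mc /andP[/all_iotaP tc /all_iotaP sc] /and3P[bok tag4 eok].
have [S SE] : exists S, jS J = S.+1.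
  by exists (jS J).-1; case/and3P: mc => S0 _ _; rewrite prednK.
have [A AE] : exists A, jA J = A.+1.
  by exists (jA J).-1; case/and3P: mc => _ A0 _; rewrite prednK.
case/and3P: mc => _ _; rewrite SE AE => /all_iotaP mc.
have pc (s : 'I_S.+1) (a : 'I_A.+1) (t : 'I_S.+1) : [&& crat_ok (jP J s a t),
    ~~ csign (jP J s a t) & bleq (cnum (jP J s a t)) (cden (jP J s a t))].
  by have /andP[/all_iotaP/(_ a)/andP[/all_iotaP/(_ t)]] := mc s.
have ok (s : 'I_S.+1) (a : 'I_A.+1) (t : 'I_S.+1) : crat_ok (jP J s a t).
  by case/and3P: (pc s a t).
pose tr (s : 'I_S.+1) (a : 'I_A.+1) (t : 'I_S.+1) := crat_val (jP J s a t).
have enE (s : 'I_S.+1) (a : 'I_A.+1) : j_enabled J s a = (\sum_t tr s a t == 1).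
  exact: (j_enabledE SE (ok s a)).
have tb s a t : 0 <= tr s a t <= 1.
  case/and3P: (pc s a t) => o sg le.
  by rewrite /tr crat_val_ge0 // sg crat_val_le1.
have te s : exists a, \sum_t tr s a t = 1.
  have /andP[_ /has_iotaP[a]] := mc s; rewrite enE => /eqP e; by exists a.
have td s a : \sum_t tr s a t <> 1 -> \sum_t tr s a t = 0.
  move=> ne; have /andP[/all_iotaP/(_ a)/andP[_]] := mc s; rewrite enE.
  case/orP=> [/eqP//|/all_iotaP z _]; apply: big1 => t _.
  by apply/eqP; rewrite /tr crat_val_eq0 //; exact: z.
have idx (i : 'I_(jm J)) : (jindex J i < jn J)%N by case/and3P: (tc i).
have surj (j : 'I_(jn J)) : exists i, Ordinal (idx i) = j.
  by have /has_iotaP[i /eqP e] := sc j; exists i; exact: val_inj.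
have [op opE] : exists op : relop, match op with
    | OpGt => jtag J = 0%N
    | OpGe => jtag J = 1%N
    | OpApprox e _ => [/\ jtag J = 2%N, crat_ok (jeps J) & crat_val (jeps J) = e]
    | OpNotApprox e _ => [/\ jtag J = 3%N, crat_ok (jeps J) & crat_val (jeps J) = e]
    end.
  case tE: (jtag J) tag4 eok => [|[|[|[|//]]]] _ eok.
  - by exists OpGt.
  - by exists OpGe.
  - case/andP: eok => o sg; have e0 : 0 <= crat_val (jeps J) by rewrite crat_val_ge0.
    by exists (OpApprox e0).
  - case/andP: eok => o sg; have e0 : 0 <= crat_val (jeps J) by rewrite crat_val_ge0.
    by exists (OpNotApprox e0).
pose M := @MDP S A tr tb te td.
exists (@RelBuechiInstance M (jm J) (jn J) (fun i => crat_val (jcoef J i))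
  (crat_val (jbound J)) (fun i => inord (jinit J i)) (fun i => Ordinal (idx i)) surj
  (fun i => [set s : 'I_S.+1 | jtarget J i s]) op).
split=> //=.
- by move=> i; case/and3P: (tc i).
- by move=> i; rewrite inordK // -SE; case/and3P: (tc i).
- by move=> i s; rewrite inE.
Qed.

Lemma cert_sound (R : realType) (J : cert) : cert_check J ->
  exists I : instance (RelBuechi_MD R),
    is_yes I /\ map nb (cert_numbers J) = numbers I.
Proof.
case/and5P => mc tc oc sc /andP[/all_iotaP solc rc].
have [I rep] := represented mc tc oc.
exists I; split; last exact: rep_numbers.
move: sc; rewrite /sched_check (rep_n rep) (rep_S rep) (rep_A rep) => /all_iotaP sc.
have act (j : 'I_(rb_n I)) (s : state (rb_mdp I)) :
    (jact J j s < (mdp_na (rb_mdp I)).+1)%N && j_enabled J s (jact J j s).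
  by have /all_iotaP/(_ s) := sc j.
pose d (j : 'I_(rb_n I)) (s : state (rb_mdp I)) : action (rb_mdp I) := inord (jact J j s).
have dE (j : 'I_(rb_n I)) (s : state (rb_mdp I)) : jact J j s = d j s by rewrite inordK //; case/andP: (act j s).
have den j s : enabled s (d j s).
  by rewrite -(rep_enabled rep) -dE; case/andP: (act j s).
have /boolp.choice[sigma sP] : forall j, exists sg : scheduler R (rb_mdp I),
    memoryless_deterministic sg /\
    forall h s a, decision sg h s a = (a == d j s)%:R.
  by move=> j; have [sg h1 h2] := md_scheduler R (den j); exists sg.
exists sigma; split; first by move=> j; case: (sP j).
rewrite (rep_m rep) in solc.
have hact (i : 'I_(rb_m I)) (s : state (rb_mdp I)) :
    jact J (jindex J i) s = d (rb_index i) s by rewrite (rep_index rep i) dE.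
have sol i := (sol_checkP rep (hact i)).1 (solc i).
have D0 (i : 'I_(rb_m I)) : nb (jD J i) != 0%N by case: (sol i).
have := (rel_checkP rep R D0).1 rc; rewrite rmorph_sum /=.
suff -> : \sum_(i < rb_m I) ratr (rb_coef i * ((nb (jX J i (rb_init i)))%:R / (nb (jD J i))%:R)) =
  \sum_(i < rb_m I) ratr (rb_coef i) *
    buechi_prob (sigma (rb_index i)) (rb_init i) (rb_target i) :> R by [].
apply: eq_bigr => i _; rewrite rmorphM; congr (_ * _).
have [_ sd] := sP (rb_index i); have [_ si] := sol i.
by rewrite (solves_sound sd si).
Qed.

(** For the two order relations the tolerance is a placeholder 0, so that all certificates have the
    same shape; [cert_numbers] omits it. *)
Definition op_data (op : relop) : nat * rat :=
  match op with
  | OpGt => (0%N, 0) | OpGe => (1%N, 0)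
  | OpApprox e _ => (2, e) | OpNotApprox e _ => (3, e)
  end.

Section Complete.
Variables (I : rel_buechi_instance) (cr : rat -> crat).
Local Notation M := (rb_mdp I).
Variables (d : 'I_(rb_n I) -> state M -> action M).
Variables (lab rk N : 'I_(rb_m I) -> state M -> nat) (D : 'I_(rb_m I) -> nat).

Definition the_cert : cert :=
  (((mdp_ns M).+1, (mdp_na M).+1, rb_m I, rb_n I),
   [seq [seq [seq cr (trans s a t) | t <- enum (state M)]
     | a <- enum (action M)] | s <- enum (state M)],
   [seq (cr (rb_coef i), nat_of_ord (rb_init i), nat_of_ord (rb_index i),
      [seq s \in rb_target i | s <- enum (state M)]) | i <- enum 'I_(rb_m I)],
   (cr (rb_bound I), ((op_data (rb_op I)).1, cr (op_data (rb_op I)).2)),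
   [seq [seq nat_of_ord (d j s) | s <- enum (state M)] | j <- enum 'I_(rb_n I)],
   [seq ([seq Bn (N i s) | s <- enum (state M)], Bn (D i),
      [seq lab i s | s <- enum (state M)], [seq rk i s | s <- enum (state M)])
     | i <- enum 'I_(rb_m I)]).
Local Notation J := the_cert.

Lemma the_P (s : state M) (a : action M) (t : state M) : jP J s a t = cr (trans s a t).
Proof. by rewrite /jP !nth_map_enum. Qed.

Lemma the_term (i : 'I_(rb_m I)) : jterm J i =
  (cr (rb_coef i), nat_of_ord (rb_init i), nat_of_ord (rb_index i),
      [seq s \in rb_target i | s <- enum (state M)]).
Proof. by rewrite /jterm nth_map_enum. Qed.

Lemma the_sol (i : 'I_(rb_m I)) : jsol J i =
  ([seq Bn (N i s) | s <- enum (state M)], Bn (D i),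
      [seq lab i s | s <- enum (state M)], [seq rk i s | s <- enum (state M)]).
Proof. by rewrite /jsol nth_map_enum. Qed.

Lemma the_act (j : 'I_(rb_n I)) (s : state M) : jact J j s = d j s.
Proof. by rewrite /jact !nth_map_enum. Qed.

Hypothesis crP : forall x, crat_ok (cr x) /\ crat_val (cr x) = x.

Lemma the_represents : represents J I.
Proof.
have hb : crat_ok (jbound J) /\ crat_val (jbound J) = rb_bound I := crP _.
split=> //.
- by move=> s a t; rewrite the_P.
- by move=> i; rewrite /jcoef the_term; exact: crP.
- by move=> i; rewrite /jinit the_term.
- by move=> i; rewrite /jindex the_term.
- by move=> i s; rewrite /jtarget the_term nth_map_enum.
- rewrite /jtag /jeps /=; case: (rb_op I) => [|| e e0 | e e0] //=; by have [] := crP e.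
Qed.

Lemma the_mdp_check : mdp_check J.
Proof.
have rep := the_represents.
rewrite /mdp_check (rep_S rep) (rep_A rep); apply/and3P; split=> //.
apply/all_iotaP => s.
apply/andP; split; last first.
  have [a e] := trans_enabled s; apply/has_iotaP; exists a.
  by rewrite (rep_enabled rep); apply/eqP.
apply/all_iotaP => a; apply/andP; split.
  apply/all_iotaP => t; have [ok e] := rep_P rep s a t; rewrite ok /=.
  have /andP[h0 h1] := trans_bounds s a t.
  by rewrite -e in h0 h1; rewrite crat_val_ge0 // in h0; rewrite h0 -crat_val_le1.
rewrite (rep_enabled rep); have [//|ne] := boolP (enabled s a).
have z : \sum_t trans s a t = 0 by apply: trans_disabled => e; case/eqP: ne.
apply/all_iotaP => t; rewrite (rep_zero rep); apply/eqP.
by apply: (psumr_eq0P _ z) => // u _; case/andP: (trans_bounds s a u).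
Qed.

Lemma the_cert_check (R : realType) (sigma : 'I_(rb_n I) -> scheduler R M) :
  (forall j h s a, decision (sigma j) h s a = (a == d j s)%:R) ->
  (forall i, (0 < D i)%N /\ solves (d (rb_index i)) (rb_target i) (lab i) (rk i)
     (fun s => (N i s)%:R / (D i)%:R)) ->
  relop_holds (rb_op I)
    (\sum_(i < rb_m I) ratr (rb_coef i) *
       buechi_prob (sigma (rb_index i)) (rb_init i) (rb_target i)) (ratr (rb_bound I)) ->
  cert_check J.
Proof.
move=> sd sol holds; have rep := the_represents.
have den j s : enabled s (d j s) by apply: (md_enabled (sd j)).
have DE (i : 'I_(rb_m I)) : nb (jD J i) = D i by rewrite /jD the_sol.
have XE (i : 'I_(rb_m I)) (s : state M) : nb (jX J i s) = N i s by rewrite /jX the_sol nth_map_enum.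
have D0 (i : 'I_(rb_m I)) : nb (jD J i) != 0%N by rewrite DE -lt0n; case: (sol i).
have xE (i : 'I_(rb_m I)) : (fun s : state M => (nb (jX J i s))%:R / (nb (jD J i))%:R) =
    (fun s => (N i s)%:R / (D i)%:R :> rat).
  by apply/funext => s; rewrite DE XE.
have lE (i : 'I_(rb_m I)) : (fun s : state M => jlab J i s) = lab i.
  by apply/funext => s; rewrite /jlab the_sol nth_map_enum.
have rE (i : 'I_(rb_m I)) : (fun s : state M => jrk J i s) = rk i.
  by apply/funext => s; rewrite /jrk the_sol nth_map_enum.
apply/and5P; split.
- exact: the_mdp_check.
- apply/andP; split.
    apply/all_iotaP => i; have [ok _] := rep_coef rep i.
    by rewrite ok (rep_init rep) (rep_index rep) (rep_S rep) (rep_n rep) !ltn_ord.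
  apply/all_iotaP => j; have [i e] := rb_index_surj j.
  by apply/has_iotaP; exists i; rewrite (rep_index rep i) e.
- have [bok _] := rep_bound rep; rewrite /op_check bok.
  have := rep_op rep; case: (rb_op I) => [|| e e0 | e e0].
  + by move=> ->.
  + by move=> ->.
  + by case=> tE ok E; rewrite tE ok -crat_val_ge0 // E e0.
  + by case=> tE ok E; rewrite tE ok -crat_val_ge0 // E e0.
- apply/all_iotaP => j; apply/all_iotaP => s.
  by rewrite (the_act j s) (rep_A rep) ltn_ord (rep_enabled rep) den.
apply/andP; split.
  apply/all_iotaP => i.
  have h (s : state M) : jact J (jindex J i) s = d (rb_index i) s.
    by rewrite (rep_index rep i) the_act.
  apply/(sol_checkP rep h); split; first exact: D0.
  by rewrite xE lE rE; case: (sol i).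
apply/(rel_checkP rep R D0); rewrite rmorph_sum /=.
suff -> : \sum_(i < rb_m I) ratr (rb_coef i * ((nb (jX J i (rb_init i)))%:R / (nb (jD J i))%:R)) =
  \sum_(i < rb_m I) ratr (rb_coef i) *
    buechi_prob (sigma (rb_index i)) (rb_init i) (rb_target i) :> R by [].
apply: eq_bigr => i _; rewrite rmorphM; congr (_ * _).
by rewrite (solves_sound (sd (rb_index i)) (sol i).2) DE XE.
Qed.

(** Coded rationals have exponent 10, and so do the solution values, whose bit lengths are bounded
    through the factorial and the power of [all_dens]. Each enclosing list or pair adds two; the
    outermost pair leads from 28 to 30. *)
Lemma the_cert_size (K : nat) : (forall x, [/\ nb (cnum (cr x)) = `|numq x|%N,
    nb (cden (cr x)) = `|denq x|%N & nb (cr x).2.1 <= (nb (cnum (cr x))).+1 /\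
    nb (cr x).2.2 <= nb (cden (cr x))]%N) ->
  K = size (write binary (rel_buechi_numbers I)) ->
  (forall i, (D i <= (mdp_ns M).+1`! * (2 * all_dens M) ^ (mdp_ns M).+1)%N) ->
  (forall i s, [/\ N i s <= D i, lab i s <= 2 & rk i s <= (mdp_ns M).+1]%N) ->
  (sz J <= (K + 2) ^ 30)%N.
Proof.
move=> crE KE DB b.
have [[SK AK] [mK nK] tK cK oK] := rel_buechi_bounds KE.
have K0 : (0 < K)%N by exact: leq_trans SK.
have b0 : (bitlen 0 <= K)%N by rewrite (leq_trans (bitlen_le 0)).
have b1 : (bitlen 1 <= K)%N by exact: leq_trans (bitlen_le 1) K0.
have scr x : (bitlen `|numq x| <= K /\ bitlen `|denq x| <= K)%N -> small K 10 (cr x).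
  by move=> [h1 h2]; have [e1 e2 e3] := crE x; exact: (small_crat e1 e2 e3).
have szS : (size (enum (state M)) <= K)%N by rewrite size_enum_ord.
have szA : (size (enum (action M)) <= K)%N by rewrite size_enum_ord.
have szm : (size (enum 'I_(rb_m I)) <= K)%N by rewrite size_enum_ord.
have szn : (size (enum 'I_(rb_n I)) <= K)%N by rewrite size_enum_ord.
have nat3 n : (n <= K)%N -> small K 3 n by move=> nK'; apply: small_nat; lia.
have epsK : (bitlen `|numq (op_data (rb_op I)).2| <= K /\
    bitlen `|denq (op_data (rb_op I)).2| <= K)%N.
  case E: (rb_op I) => [|| e e0 | e e0] /=; rewrite ?b0 ?b1 //; apply: oK; right.
    by left; exists e0.
  by right; exists e0.
(* One unit of the exponent per product over states, actions and states again. *)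
have LK : (bitlen (all_dens M) <= (K + 2) ^ 4)%N.
  do 3! (apply: bitlen_prod => [|?]; first by rewrite card_ord).
  by rewrite expn1; apply: (leq_trans (tK _ _ _).2); exact: leq_addr.
have L2 : (bitlen (2 * all_dens M) <= (K + 2) ^ 5)%N.
  apply: leq_trans (bitlenM _ _) _; have h := pow_double K 4; have := pow_le K (leq0n 4).
  have b2 : (bitlen 2 <= 2)%N by exact: bitlen_le.
  have : (2 <= (K + 2) ^ 4)%N by apply: leq_trans (pow_le K (isT : (1 <= 4)%N)); rewrite expn1; lia.
  by lia.
have DK i : (bitlen (D i) <= (K + 2) ^ 7)%N.
  apply: leq_trans (leq_bitlen (DB i)) _; apply: leq_trans (bitlenM _ _) _.
  have h1 := bitlen_fact SK; have h2 := bitlenX SK L2.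
  by have := pow_double K 6; have := pow_le K (isT : (2 <= 6)%N); lia.
have sD i : small K 10 (Bn (D i)) by exact: (small_bnat (e := 7) (n := Bn (D i)) (DK i)).
have sN i s : small K 10 (Bn (N i s)).
  apply: (small_bnat (e := 7) (n := Bn (N i s))); apply: leq_trans (DK i).
  by apply: leq_bitlen; case: (b i s).
apply: (@small_pair K _ _ 28); last first.
  apply: (@small_le K _ 20) => //; apply: small_map => // i.
  apply: (@small_pair K _ _ 16); last first.
    apply: (@small_le K _ 5) => //; apply: small_map => // s.
    by apply: nat3; apply: leq_trans SK; case: (b i s).
  apply: (@small_pair K _ _ 14); last first.
    apply: (@small_le K _ 5) => //; apply: small_map => // s.
    by apply: small_nat; case: (b i s); lia.
  apply: (@small_pair K _ _ 12); last by apply: (@small_le K _ 10).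
  by apply: small_map.
apply: (@small_pair K _ _ 26); last first.
  apply: (@small_le K _ 7) => //; apply: small_map => // j; apply: small_map => // s.
  by apply: nat3; apply: ltnW; apply: leq_trans AK.
apply: (@small_pair K _ _ 24); last first.
  apply: (@small_le K _ 14) => //; apply: (@small_pair K _ _ 12).
    by apply: (@small_le K _ 10) => //; apply: scr; apply: oK; left.
  apply: (@small_pair K _ _ 10); last exact: scr.
  apply: (@small_le K _ 4) => //; apply: leq_trans (pow_double K 3) => //.
  rewrite sz_nat; have : ((op_data (rb_op I)).1 <= 3)%N by case: (rb_op I).
  have : (2 ^ 3 <= (K + 2) ^ 3)%N by rewrite leq_exp2r // addn2.
  by move: ((K + 2) ^ 3)%N => B3; rewrite (_ : (2 ^ 3)%N = 8%N) //; lia.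
apply: (@small_pair K _ _ 22); last first.
  apply: (@small_le K _ 18) => //; apply: small_map => // i.
  apply: (@small_pair K _ _ 14); last first.
    apply: (@small_le K _ 4) => //; apply: small_map => // s; exact: small_bool.
  apply: (@small_pair K _ _ 12); last first.
    by apply: (@small_le K _ 3) => //; apply/nat3/ltnW/(leq_trans _ nK).
  apply: (@small_pair K _ _ 10); first by apply: scr; exact: cK.
  by apply: (@small_le K _ 3) => //; apply/nat3/ltnW/(leq_trans _ SK).
apply: (@small_pair K _ _ 20); last first.
  apply: (@small_le K _ 16) => //; do 3! (apply: small_map => // ?).
  by apply: scr; exact: tK.
apply: (@small_le K _ 9) => //; apply: (@small_pair K _ _ 7); last first.
  by apply: (@small_le K _ 3) => //; exact: nat3.
apply: (@small_pair K _ _ 5); last by apply: (@small_le K _ 3) => //; exact: nat3.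
by apply: (@small_pair K _ _ 3); exact: nat3.
Qed.

End Complete.

Lemma rel_in_NP (R : realType) : problem_in_NP (RelBuechi_MD R).
Proof.
exists verify, (('X + 2%:P) ^+ 30); split; first exact: polytime_verify.
move=> x; split=> [[I [yes xE]]|[c [_]]]; last first.
  rewrite verify_word => /andP[/wcodeb_eq xE /(cert_sound R)[I [yes nE]]].
  by exists I; split; rewrite // xE nE.
have [sigma [md holds]] := yes.
have [d sd] := boolp.choice md.
have [cr crP] := boolp.choice crat_of.
(* Labels, ranks, numerators and denominator are packed into one tuple, so that a single choice
   yields them for all terms. *)
have /boolp.choice[y yP] : forall i : 'I_(rb_m I), exists y : (state (rb_mdp I) -> nat) *
    (state (rb_mdp I) -> nat) * (state (rb_mdp I) -> nat) * nat,
    [/\ (0 < y.2)%N,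
        (y.2 <= (mdp_ns (rb_mdp I)).+1`! *
           (2 * all_dens (rb_mdp I)) ^ (mdp_ns (rb_mdp I)).+1)%N,
        forall s, (y.1.2 s <= y.2)%N,
        forall s, (y.1.1.1 s <= 2)%N /\ (y.1.1.2 s <= (mdp_ns (rb_mdp I)).+1)%N &
        solves (d (rb_index i)) (rb_target i) y.1.1.1 y.1.1.2
          (fun s => (y.1.2 s)%:R / y.2%:R)].
  move=> i; have den s : enabled s (d (rb_index i) s).
    by apply: (md_enabled (sd (rb_index i))).
  have [lab [rk [N [D H]]]] := solution_exists (rb_target i) den R.
  by exists (lab, rk, N, D).
pose J := the_cert cr d (fun i => (y i).1.1.1) (fun i => (y i).1.1.2)
  (fun i => (y i).1.2) (fun i => (y i).2).
have crok q : crat_ok (cr q) /\ crat_val (cr q) = q by case: (crP q).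
exists (TreeMachines.code (enc J)); split.
  rewrite size_code horner_exp hornerD hornerX hornerC natrXE natrDE.
  apply: (@the_cert_size I cr d) => //.
  - by move=> q; case: (crP q).
  - by rewrite xE.
  - by move=> i; case: (yP i).
  - by move=> i s; have [_ _ h1 h2 _] := yP i; have [] := h2 s; split.
rewrite verify_word parse_tree_code dec_certK; apply/andP; split.
  by apply/wcodeb_eq; rewrite xE (rep_numbers (the_represents _ _ _ _ _ crok)).
by apply: (the_cert_check crok sd) => // i; case: (yP i).
Qed.

End Membership.
Import Membership.

From mathcomp Require Import all_classical all_reals all_analysis.

Theorem theorem6p23 (R : realType) :
  [/\ strongly_NP_complete (RelBuechi_MD R),
      strongly_NP_hard (BuechiEq_one_scheduler R) /\
      strongly_NP_hard (BuechiEq_two_schedulers R),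
      (forall same_init abs1 abs2 : bool,
        strongly_NP_hard (@subproblem (BuechiEq_one_scheduler R)
          (pair_shape same_init abs1 abs2)) /\
        strongly_NP_hard (@subproblem (BuechiEq_two_schedulers R)
          (pair_shape same_init abs1 abs2))) &
      problem_NP_hard (BuechiApprox_one_scheduler R) /\
      problem_NP_hard (BuechiApprox_two_schedulers R)].
Proof.
split.
- by split; [exact: rel_in_NP | exact: rel_hard].
- by split; [exact: eq_one_hard | exact: eq_two_hard].
- move=> same_init abs1 abs2.
  by split; [exact: eq_one_hard_shape | exact: eq_two_hard_shape].
- by split; [exact: approx_one_hard | exact: approx_two_hard].
Qed.
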